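(* Let $N\ge1$, let $q$ be real with $0<|q|<1$, and let $0<r<\frac{1-|q|}{|1-q|}$. For the $N$-particle $q$-TAZRP, for all $X=(x_N,\dots,x_1)\in\mathbf{S}$, $Y=(y_N,\dots,y_1)\in\mathbf{S}$ and $t\ge0$, $$P_Y(X;t)=W_X\Big(\frac{1}{2\pi i}\Big)^N\oint_{\mathcal{C}_r}\cdots\oint_{\mathcal{C}_r}\sum_{\sigma\in\mathbb{S}_N}A_\sigma\prod_{i=1}^N z_{\sigma(i)}^{x_i-y_{\sigma(i)}-1}e^{\epsilon(z_i)t}\,dz_1\cdots dz_N,$$ where $W_X=1\big/\prod_{\mathbf{x}\in\Lambda(X)}[\eta_X(\mathbf{x})]_q!$ and $\epsilon(z)=\frac1z-1$.
   Context: $[k]_q=1+q+\cdots+q^{k-1}$, $[k]_q!=[1]_q\cdots[k]_q$. $\mathbf{S}=\{(x_N,\dots,x_1)\in\mathbb{Z}^N:x_N\le\cdots\le x_1\}$ is the set of configurations of $N$ indistinguishable particles on $\mathbb{Z}$ ($x_j$ is the position of the $j$-th right-most particle; several particles may share a site). $\Lambda(X)$ is the set of occupied sites of $X$ and $\eta_X(\mathbf{x})$ the number of particles at site $\mathbf{x}$. The $q$-TAZRP is the continuous-time Markov chain on $\mathbf{S}$ in which, independently for each occupied site $\mathbf{x}$, one particle jumps from $\mathbf{x}$ to $\mathbf{x}+1$ at rate $[\eta(\mathbf{x})]_q$. $P_Y(X;t)$ is the probability that the process started at $Y$ is at $X$ at time $t$. $\mathcal{C}_r$ is the positively oriented circle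 of radius $r$ about $0$. For $1\le\alpha<\beta\le N$, $S_{\beta\alpha}=-\dfrac{z_\beta-qz_\alpha-(1-q)z_\alpha z_\beta}{z_\alpha-qz_\beta-(1-q)z_\alpha z_\beta}$; an inversion of $\sigma\in\mathbb{S}_N$ is a pair $(\alpha,\beta)$ with $\alpha<\beta$ and $\sigma^{-1}(\beta)<\sigma^{-1}(\alpha)$; $A_\sigma=\prod_{(\alpha,\beta)\text{ inversion of }\sigma}S_{\beta\alpha}$. *)

(* Defs.v *)
From Stdlib Require Import Reals ZArith List Bool.
Import ListNotations.
Open Scope R_scope.

Definition qint (q : R) (k : nat) : R :=
  fold_right Rplus 0 (map (fun m => q ^ m) (seq 0 k)).
Definition qfact (q : R) (k : nat) : R :=
  fold_right Rmult 1 (map (qint q) (seq 1 k)).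

(* A configuration X = (x_N,...,x_1) is stored as the list [x_1; x_2; ...; x_N]
   (list index i, 0-based, holds x_(i+1)). *)
Definition conf := list Z.

Definition in_S (N : nat) (X : conf) : Prop :=
  length X = N /\
  (forall i : nat, (S i < N)%nat -> (nth (S i) X 0%Z <= nth i X 0%Z)%Z).

Definition eta (X : conf) (x : Z) : nat := count_occ Z.eq_dec X x.

(* index j is the first (right-most labelled) particle of its site;
   the occupied sites Lambda(X) are in bijection with such indices *)
Definition is_top (X : conf) (j : nat) : bool :=
  match j with
  | O => true
  | S j' => if Z.eq_dec (nth j' X 0%Z) (nth j X 0%Z) then false else true
  end.

Definition tops (X : conf) : list nat := filter (is_top X) (seq 0 (length X)).

Definition jump (X : conf) (j : nat) : conf :=
  firstn j X ++ (nth j X 0%Z + 1)%Z :: skipn (S j) X.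

Definition rate (q : R) (X : conf) (j : nat) : R := qint q (eta X (nth j X 0%Z)).

Definition total_rate (q : R) (X : conf) : R :=
  fold_right Rplus 0 (map (rate q X) (tops X)).

(* Qpow q k Y X = (Q^k)(Y,X), Q the generator of the q-TAZRP:
   Q(Y,Y) = - total rate, Q(Y, jump Y j) = rate q Y j. Q^(k+1) = Q Q^k. *)
Fixpoint Qpow (q : R) (k : nat) (Y X : conf) : R :=
  match k with
  | O => if list_eq_dec Z.eq_dec Y X then 1 else 0
  | S k' => - total_rate q Y * Qpow q k' Y X +
            fold_right Rplus 0
              (map (fun j => rate q Y j * Qpow q k' (jump Y j) X) (tops Y))
  end.

(* P is the transition probability P_Y(X;t) = (exp(tQ))(Y,X)
   (rates are bounded, so the semigroup is the exponential series) *)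
Definition trans_prob (q : R) (Y X : conf) (t : R) (P : R) : Prop :=
  infinite_sum (fun k => t ^ k / INR (fact k) * Qpow q k Y X) P.

Definition W (q : R) (X : conf) : R :=
  / fold_right Rmult 1 (map (fun j => qfact q (eta X (nth j X 0%Z))) (tops X)).

Definition Cx := (R * R)%type.
Definition RtoC (a : R) : Cx := (a, 0).
Definition C0 : Cx := (0, 0).
Definition C1 : Cx := (1, 0).
Definition Ci : Cx := (0, 1).
Definition Cadd (z w : Cx) : Cx := (fst z + fst w, snd z + snd w).
Definition Copp (z : Cx) : Cx := (- fst z, - snd z).
Definition Csub (z w : Cx) : Cx := Cadd z (Copp w).
Definition Cmul (z w : Cx) : Cx :=
  (fst z * fst w - snd z * snd w, fst z * snd w + snd z * fst w).
Definition Cinv (z : Cx) : Cx :=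
  (fst z / (fst z ^ 2 + snd z ^ 2), - snd z / (fst z ^ 2 + snd z ^ 2)).
Definition Cdiv (z w : Cx) : Cx := Cmul z (Cinv w).
Fixpoint Cpow (z : Cx) (n : nat) : Cx :=
  match n with O => C1 | S n' => Cmul z (Cpow z n') end.
Definition Czpow (z : Cx) (k : Z) : Cx :=
  match k with
  | Z0 => C1
  | Zpos p => Cpow z (Pos.to_nat p)
  | Zneg p => Cinv (Cpow z (Pos.to_nat p))
  end.
Definition Cexp (z : Cx) : Cx := (exp (fst z) * cos (snd z), exp (fst z) * sin (snd z)).
Definition Csum (l : list Cx) : Cx := fold_right Cadd C0 l.
Definition Cprod (l : list Cx) : Cx := fold_right Cmul C1 l.

(* a permutation sigma of {0,...,n-1} is the list [sigma(0); ...; sigma(n-1)] *)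
Fixpoint insert_all (x : nat) (l : list nat) : list (list nat) :=
  match l with
  | [] => [[x]]
  | y :: l' => (x :: y :: l') :: map (cons y) (insert_all x l')
  end.
Fixpoint perms (n : nat) : list (list nat) :=
  match n with
  | O => [[]]
  | S n' => flat_map (insert_all n') (perms n')
  end.

Definition Sba (q : R) (zb za : Cx) : Cx :=
  Copp (Cdiv (Csub (Csub zb (Cmul (RtoC q) za)) (Cmul (RtoC (1 - q)) (Cmul za zb)))
             (Csub (Csub za (Cmul (RtoC q) zb)) (Cmul (RtoC (1 - q)) (Cmul za zb)))).

(* A_sigma = prod over inversions (alpha,beta) (alpha<beta, beta before alpha
   in sigma) of S_{beta alpha}.  Positions i<j with sigma(i) > sigma(j) give the
   inversion (alpha,beta) = (sigma(j), sigma(i)). *)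
Definition A_sigma (q : R) (n : nat) (s : list nat) (z : list Cx) : Cx :=
  Cprod (flat_map (fun i =>
    map (fun j => Sba q (nth (nth i s O) z C0) (nth (nth j s O) z C0))
      (filter (fun j => Nat.ltb i j && Nat.ltb (nth j s O) (nth i s O)) (seq 0 n)))
    (seq 0 n)).

Definition eps (z : Cx) : Cx := Csub (Cinv z) C1.

Definition integrand (q : R) (N : nat) (X Y : conf) (t : R) (z : list Cx) : Cx :=
  Csum (map (fun s =>
    Cmul (A_sigma q N s z)
      (Cprod (map (fun i =>
         Cmul (Czpow (nth (nth i s O) z C0)
                 (nth i X 0%Z - nth (nth i s O) Y 0%Z - 1)%Z)
              (Cexp (Cmul (eps (nth i z C0)) (RtoC t))))
        (seq 0 N))))
    (perms N)).

Definition CRint (f : R -> Cx) (a b : R) (L : Cx) : Prop :=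
  (exists pr : Riemann_integrable (fun th => fst (f th)) a b, RiemannInt pr = fst L) /\
  (exists pr : Riemann_integrable (fun th => snd (f th)) a b, RiemannInt pr = snd L).

Definition circ (r th : R) : Cx := (r * cos th, r * sin th).

Definition contour_int (r : R) (g : R -> Cx) (L : Cx) : Prop :=
  CRint (fun th => Cmul (g th) (Cmul Ci (circ r th))) 0 (2 * PI) L.

Fixpoint iter_contour (r : R) (n : nat) (F : list Cx -> Cx) (L : Cx) : Prop :=
  match n with
  | O => L = F []
  | S n' => exists g : R -> Cx,
      (forall th, iter_contour r n' (fun zs => F (circ r th :: zs)) (g th)) /\
      contour_int r g L
  end.

(* Main.v *)
(* With [v = eps z = 1/z - 1] the scattering factor is
   [S_ba = - (v_a - q v_b) / (v_b - q v_a)].  Exchanging [z_k] and [z_(k+1)] multiplies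
   the Bethe sum [psi] by [S(z_k, z_(k+1))], which makes the integrand times
   [v_(k+1) - q v_k] antisymmetric as soon as [y_k = y_(k+1)]; its contour integral
   vanishes.  This boundary condition turns the free evolution of [N] particles, in
   which a jump of particle [k] is the multiplication by [v_k], into the backward
   equation of the q-TAZRP, because the [v]'s of the particles of a site of occupation
   [m] add up to [[m]_q] times the first of them.  Hence the [k]-th power of the
   generator is the contour integral of the Bethe integrand times [(sum v)^k].

   For [k = 0] remove the largest label.  The integrand is analytic outside the circle
   in the variable of the last position, so only [x_N >= y_N] contributes; it is
   analytic inside the circle in the variable of the largest label, with [S = q] at the
   centre, so only insertions of that label at positions [p] with [x_p = x_N = y_N]
   contribute, each with weight [q] to the number of labels behind it.  Summing the
   weights gives the factor [[eta]_q], and by induction the product of the [[eta]_q!].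

   All integrands are uniform limits of Laurent polynomials on the torus, for which
   integration is the extraction of the constant term. *)

From Coquelicot Require Import Coquelicot.
From Stdlib Require Import Reals ZArith List Bool Lia Lra Permutation.
Require Import Defs.
Import ListNotations.
Open Scope R_scope.

(* All contours coincide, so none can be moved across a pole of [S]; everything has to happen on one
   fixed torus. The bound on [r] says [|q| + |1 - q| r < 1]: this keeps the denominators of [S] away
   from 0 and expands [S] in nonnegative powers of its upper variable and nonpositive powers of its
   lower one. Cauchy's theorem then becomes a statement on exponents (an integral vanishes when no
   admissible exponent is 0), and Fubini reduces to the fact that exchanging two variables preserves
   the constant term. Since [dz = i z dth], the normalised contour integral is a mean over angles
   with an extra factor [z], which cancels the [-1] in the exponents. Time enters only through
   symmetric factors, the powers of the sum of the [v]'s and finally its exponential. Symmetry lets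
   the boundary condition survive multiplication by them, and this closes the induction on the power
   of the generator. Convergence of the exponential series of the generator is a conclusion: it is
   inherited from the uniform convergence of [exp] on the bounded set of values of that sum. *)
Declare Scope cx_scope.
Delimit Scope cx_scope with cx.
Infix "+" := Cadd : cx_scope.
Infix "*" := Cmul : cx_scope.
Infix "-" := Csub : cx_scope.
Infix "/" := Cdiv : cx_scope.
Notation "- x" := (Copp x) : cx_scope.

(** * Complex arithmetic on pairs of reals *)

Lemma Cx_field : field_theory C0 C1 Cadd Cmul Csub Copp Cdiv Cinv eq.
Proof. exact C_field_theory. Qed.
Add Field Cx_field_inst : Cx_field.

Lemma Cx_ext (z w : Cx) : fst z = fst w -> snd z = snd w -> z = w.
Proof. destruct z, w; simpl; congruence. Qed.

Lemma Cmod_add_le (z w : Cx) : Cmod (z + w)%cx <= Cmod z + Cmod w.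
Proof. exact (Cmod_triangle z w). Qed.
Lemma Cmod_mul (z w : Cx) : Cmod (z * w)%cx = Cmod z * Cmod w.
Proof. exact (Cmod_mult z w). Qed.
Lemma Cmod_neg (z : Cx) : Cmod (- z)%cx = Cmod z.
Proof. exact (Cmod_opp z). Qed.
Lemma Cmod_sub_sym (z w : Cx) : Cmod (z - w)%cx = Cmod (w - z)%cx.
Proof. rewrite <- Cmod_neg. f_equal. ring. Qed.
Lemma Cmod_sub_trans (u z w : Cx) :
  Cmod (z - w)%cx <= Cmod (z - u)%cx + Cmod (u - w)%cx.
Proof.
  replace (z - w)%cx with ((z - u) + (u - w))%cx by ring. apply Cmod_add_le.
Qed.
Lemma Cmod_sub_ge (z w : Cx) : Cmod z - Cmod w <= Cmod (z - w)%cx.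
Proof.
  pose proof (Cmod_add_le (z - w)%cx w) as H.
  replace (z - w + w)%cx with z in H by ring. lra.
Qed.
Lemma Cmod_C0 : Cmod C0 = 0.
Proof. exact Cmod_0. Qed.
Lemma Cmod_C1 : Cmod C1 = 1.
Proof. exact Cmod_1. Qed.
Lemma Cmod_RtoC (a : R) : Cmod (RtoC a) = Rabs a.
Proof. exact (Cmod_R a). Qed.
Lemma Cmod_zero (z : Cx) : Cmod z = 0 -> z = C0.
Proof. exact (Cmod_eq_0 z). Qed.
Lemma Cmod_pos_neq (z : Cx) : 0 < Cmod z -> z <> C0.
Proof. intros H E. rewrite E, Cmod_C0 in H. lra. Qed.
Lemma Cmod_Cinv (z : Cx) : z <> C0 -> Cmod (Cinv z) = / Cmod z.
Proof. exact (Cmod_inv z). Qed.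
Lemma fst_le_Cmod (z : Cx) : Rabs (fst z) <= Cmod z.
Proof. eapply Rle_trans; [apply Rmax_l | apply (Rmax_Cmod z)]. Qed.
Lemma snd_le_Cmod (z : Cx) : Rabs (snd z) <= Cmod z.
Proof. eapply Rle_trans; [apply Rmax_r | apply (Rmax_Cmod z)]. Qed.
(** Integrals are taken part by part, and bounds return to the modulus through this inequality. The
    constant 2, in place of sqrt 2, is the source of the factors 2 and [2 ^ n] in the bounds on
    averages. *)
Lemma Cmod_le_parts (z : Cx) (e : R) :
  Rabs (fst z) <= e -> Rabs (snd z) <= e -> Cmod z <= 2 * e.
Proof.
  intros H1 H2. replace z with (RtoC (fst z) + (Ci * RtoC (snd z)))%cx.
  - eapply Rle_trans; [apply Cmod_add_le|].
    rewrite Cmod_mul, !Cmod_RtoC. replace (Cmod Ci) with 1 by (symmetry; exact Cmod_Ci). lra.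
  - apply Cx_ext; simpl; ring.
Qed.

(** The constant [k] may be anything, so the error estimates that end in this lemma need no
    normalisation. *)
Lemma Rle_all_eps (a k : R) : (forall e, 0 < e -> a <= k * e) -> a <= 0.
Proof.
  intros H. destruct (Rle_lt_dec a 0) as [|Ha]; [assumption|exfalso].
  destruct (Rle_lt_dec k 0) as [Hk|Hk].
  - specialize (H 1 Rlt_0_1). lra.
  - specialize (H (a / (2 * k)) ltac:(apply Rdiv_lt_0_compat; lra)).
    replace (k * (a / (2 * k))) with (a / 2) in H by (field; lra). lra.
Qed.

Lemma Cx_eq_eps (z w : Cx) (k : R) :
  (forall e, 0 < e -> Cmod (z - w)%cx <= k * e) -> z = w.
Proof.
  intros H. apply Rle_all_eps in H.
  assert (E : (z - w)%cx = C0).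
  { apply Cmod_zero. apply Rle_antisym; [exact H | apply Cmod_ge_0]. }
  replace z with (z - w + w)%cx by ring. rewrite E. ring.
Qed.

Lemma Cmul_neq0 (z w : Cx) : z <> C0 -> w <> C0 -> (z * w)%cx <> C0.
Proof. exact (Cmult_neq_0 z w). Qed.

Lemma Cpow_neq0 (z : Cx) (n : nat) : z <> C0 -> Cpow z n <> C0.
Proof.
  intros Hz. induction n; simpl; [|now apply Cmul_neq0].
  apply Cmod_pos_neq. rewrite Cmod_C1; lra.
Qed.

Lemma Czpow_succ (z : Cx) (k : Z) : z <> C0 -> Czpow z (k + 1) = (z * Czpow z k)%cx.
Proof.
  intros Hz. destruct k as [|p|p].
  - simpl. reflexivity.
  - change (Z.pos p + 1)%Z with (Z.pos (p + 1)). simpl.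
    rewrite Pos2Nat.inj_add. change (Pos.to_nat 1) with 1%nat.
    rewrite Nat.add_1_r. reflexivity.
  - destruct (Pos.eq_dec p 1) as [->|Hp].
    + simpl. field. exact Hz.
    + replace p with (Pos.succ (Pos.pred p)) by (apply Pos.succ_pred; exact Hp).
      replace (Z.neg (Pos.succ (Pos.pred p)) + 1)%Z with (Z.neg (Pos.pred p)) by lia.
      cbn [Czpow]. rewrite Pos2Nat.inj_succ. cbn [Cpow].
      field. split; [|exact Hz]. now apply Cpow_neq0.
Qed.

Lemma Czpow_pred (z : Cx) (k : Z) :
  z <> C0 -> Czpow z (k - 1) = (Cinv z * Czpow z k)%cx.
Proof.
  intros Hz. replace k with ((k - 1) + 1)%Z at 2 by lia.
  rewrite Czpow_succ by assumption. field. exact Hz.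
Qed.

Lemma Czpow_add (z : Cx) (a b : Z) :
  z <> C0 -> Czpow z (a + b) = (Czpow z a * Czpow z b)%cx.
Proof.
  intros Hz. revert a. apply Z.bi_induction.
  - now intros ? ? ->.
  - simpl. ring.
  - intros a. split; intros H.
    + replace (Z.succ a + b)%Z with ((a + b) + 1)%Z by lia.
      replace (Z.succ a) with (a + 1)%Z by lia. rewrite !Czpow_succ, H by assumption. ring.
    + replace (a + b)%Z with ((Z.succ a + b) - 1)%Z by lia.
      replace a with (Z.succ a - 1)%Z at 2 by lia. rewrite !Czpow_pred, H by assumption. ring.
Qed.

Lemma Cmod_Cpow (z : Cx) (n : nat) : Cmod (Cpow z n) = Cmod z ^ n.
Proof. induction n; simpl; [apply Cmod_C1|]. now rewrite Cmod_mul, IHn. Qed.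

Lemma Cmod_Czpow (z : Cx) (k : Z) : z <> C0 -> Cmod (Czpow z k) = powerRZ (Cmod z) k.
Proof.
  intros Hz. destruct k; simpl.
  - apply Cmod_C1.
  - apply Cmod_Cpow.
  - rewrite Cmod_Cinv, Cmod_Cpow by now apply Cpow_neq0. reflexivity.
Qed.

Lemma Cmod_circ (r th : R) : 0 < r -> Cmod (circ r th) = r.
Proof.
  intros Hr. unfold Cmod, circ; cbn [fst snd].
  replace ((r * cos th) ^ 2 + (r * sin th) ^ 2) with (r²).
  - apply sqrt_Rsqr. lra.
  - pose proof (sin2_cos2 th). unfold Rsqr in *. nra.
Qed.

Lemma Cpow_circ (r th : R) (n : nat) :
  Cpow (circ r th) n = (r ^ n * cos (INR n * th), r ^ n * sin (INR n * th)).
Proof.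
  induction n.
  - cbn [Cpow INR pow]. rewrite Rmult_0_l, cos_0, sin_0. apply Cx_ext; simpl; ring.
  - cbn [Cpow]. rewrite IHn, S_INR.
    replace ((INR n + 1) * th) with (th + INR n * th) by ring.
    rewrite cos_plus, sin_plus. apply Cx_ext; simpl; ring.
Qed.

Lemma Czpow_circ (r th : R) (k : Z) : 0 < r ->
  Czpow (circ r th) k =
    (powerRZ r k * cos (IZR k * th), powerRZ r k * sin (IZR k * th)).
Proof.
  intros Hr. destruct k as [|p|p].
  - simpl. rewrite Rmult_0_l, cos_0, sin_0. apply Cx_ext; simpl; ring.
  - cbn [Czpow powerRZ]. rewrite Cpow_circ, INR_IZR_INZ, positive_nat_Z. reflexivity.
  - cbn [Czpow powerRZ]. rewrite Cpow_circ, INR_IZR_INZ, positive_nat_Z.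
    change (IZR (Z.neg p)) with (- IZR (Z.pos p)).
    rewrite Ropp_mult_distr_l_reverse, cos_neg, sin_neg.
    set (a := IZR (Z.pos p) * th). set (m := r ^ Pos.to_nat p).
    assert (Hm : 0 < m) by now apply pow_lt.
    assert (E : (m * cos a) ^ 2 + (m * sin a) ^ 2 = m ^ 2).
    { pose proof (sin2_cos2 a) as H. unfold Rsqr in H.
      replace (m ^ 2) with (m ^ 2 * (sin a * sin a + cos a * cos a)) by (rewrite H; ring).
      ring. }
    unfold Cinv; cbn [fst snd]. rewrite E. apply Cx_ext; cbn [fst snd]; field; lra.
Qed.

(** * Averages over the circle *)

Definition avg (f : R -> R) : R := RInt f 0 (2 * PI) / (2 * PI).
(** For z = r e^(i th) this is [1 / (2 pi i)] times the contour integral of [g(z) / z]. *)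
Definition cavg (g : R -> Cx) : Cx := (avg (fun th => fst (g th)), avg (fun th => snd (g th))).
Definition ccont (g : R -> Cx) : Prop :=
  (forall x, continuous (fun th => fst (g th)) x) /\
  (forall x, continuous (fun th => snd (g th)) x).

Lemma two_PI_pos : 0 < 2 * PI.
Proof. pose proof PI_RGT_0. lra. Qed.

Lemma cont_ex_RInt (f : R -> R) (a b : R) : (forall x, continuous f x) -> ex_RInt f a b.
Proof. intros H. apply (@ex_RInt_continuous R_CompleteNormedModule). auto. Qed.

Lemma avg_ext (f g : R -> R) : (forall x, f x = g x) -> avg f = avg g.
Proof. intros H. unfold avg. f_equal. apply RInt_ext. auto. Qed.

Lemma cavg_ext (f g : R -> Cx) : (forall x, f x = g x) -> cavg f = cavg g.
Proof. intros H. unfold cavg. f_equal; apply avg_ext; intros; now rewrite H. Qed.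

Lemma avg_plus (f g : R -> R) :
  (forall x, continuous f x) -> (forall x, continuous g x) ->
  avg (fun x => f x + g x) = avg f + avg g.
Proof.
  intros Hf Hg. unfold avg.
  rewrite (RInt_plus (V := R_CompleteNormedModule) f g) by now apply cont_ex_RInt.
  unfold plus; simpl. field. pose proof two_PI_pos; lra.
Qed.

Lemma avg_scal (f : R -> R) (c : R) : (forall x, continuous f x) ->
  avg (fun x => c * f x) = c * avg f.
Proof.
  intros Hf. unfold avg.
  replace (RInt (fun x => c * f x) 0 (2 * PI)) with (c * RInt f 0 (2 * PI)).
  - field. exact PI_neq0.
  - symmetry. apply (RInt_scal (V := R_CompleteNormedModule) f 0 (2 * PI) c).
    now apply cont_ex_RInt.
Qed.

Lemma RInt_avg (f : R -> R) : 2 * PI * avg f = RInt f 0 (2 * PI).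
Proof. unfold avg. field. exact PI_neq0. Qed.

Lemma avg_const (c : R) : avg (fun _ => c) = c.
Proof.
  unfold avg. rewrite RInt_const. unfold scal; simpl; unfold mult; simpl.
  field. pose proof two_PI_pos; lra.
Qed.

Lemma avg_bound (f : R -> R) (e : R) : (forall x, continuous f x) ->
  (forall x, Rabs (f x) <= e) -> Rabs (avg f) <= e.
Proof.
  intros Hf He. pose proof two_PI_pos as HP. unfold avg, Rdiv.
  rewrite Rabs_mult, (Rabs_pos_eq (/ (2 * PI))) by (left; now apply Rinv_0_lt_compat).
  assert (H : Rabs (RInt f 0 (2 * PI)) <= (2 * PI - 0) * e).
  { apply (abs_RInt_le_const f 0 (2 * PI) e).
    - lra.
    - now apply cont_ex_RInt.
    - auto. }
  apply Rmult_le_reg_r with (2 * PI); [lra|].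
  rewrite Rmult_assoc, Rinv_l by lra. lra.
Qed.

Lemma ccont_const (c : Cx) : ccont (fun _ => c).
Proof. split; intros; apply continuous_const. Qed.

Lemma ccont_ext (f g : R -> Cx) : (forall x, f x = g x) -> ccont f -> ccont g.
Proof.
  intros E [H1 H2]. split; intros x.
  - apply (continuous_ext (fun th => fst (f th))); [intros; now rewrite E | apply H1].
  - apply (continuous_ext (fun th => snd (f th))); [intros; now rewrite E | apply H2].
Qed.

Lemma continuous_mulc (f : R -> R) (c x : R) :
  continuous f x -> continuous (fun y => c * f y) x.
Proof. intros H. apply (continuous_scal_r (V := R_NormedModule) c f x H). Qed.

Lemma ccont_add (f g : R -> Cx) : ccont f -> ccont g -> ccont (fun x => f x + g x)%cx.
Proof.
  intros [H1 H2] [H3 H4]. split; intros x; simpl.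
  - apply (continuous_plus (V := R_NormedModule) (fun th => fst (f th)) (fun th => fst (g th))); auto.
  - apply (continuous_plus (V := R_NormedModule) (fun th => snd (f th)) (fun th => snd (g th))); auto.
Qed.

Lemma ccont_scal (c : Cx) (f : R -> Cx) : ccont f -> ccont (fun x => c * f x)%cx.
Proof.
  intros [H1 H2]. split; intros x; simpl.
  - apply (continuous_minus (V := R_NormedModule) (fun th => fst c * fst (f th)) (fun th => snd c * snd (f th)));
      now apply continuous_mulc.
  - apply (continuous_plus (V := R_NormedModule) (fun th => fst c * snd (f th)) (fun th => snd c * fst (f th)));
      now apply continuous_mulc.
Qed.

Lemma cavg_add (f g : R -> Cx) : ccont f -> ccont g ->
  cavg (fun x => f x + g x)%cx = (cavg f + cavg g)%cx.
Proof.
  intros [H1 H2] [H3 H4]. apply Cx_ext; simpl; now rewrite avg_plus.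
Qed.

Lemma cavg_scal (c : Cx) (f : R -> Cx) : ccont f ->
  cavg (fun x => c * f x)%cx = (c * cavg f)%cx.
Proof.
  intros [H1 H2]. apply Cx_ext; simpl.
  - rewrite (avg_ext _ (fun x => fst c * fst (f x) + (- snd c) * snd (f x))) by (intros; ring).
    rewrite avg_plus, !avg_scal by (auto; intros; now apply continuous_mulc). ring.
  - rewrite avg_plus, !avg_scal by (auto; intros; now apply continuous_mulc). ring.
Qed.

Lemma cavg_const (c : Cx) : cavg (fun _ => c) = c.
Proof. apply Cx_ext; simpl; apply avg_const. Qed.

Lemma cavg_bound (f : R -> Cx) (e : R) : ccont f ->
  (forall x, Cmod (f x) <= e) -> Cmod (cavg f) <= 2 * e.
Proof.
  intros [H1 H2] He. apply Cmod_le_parts; simpl; apply avg_bound; auto; intros x.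
  - eapply Rle_trans; [apply fst_le_Cmod | apply He].
  - eapply Rle_trans; [apply snd_le_Cmod | apply He].
Qed.

Lemma cavg_close (f g : R -> Cx) (e : R) : ccont f -> ccont g ->
  (forall x, Cmod (f x - g x)%cx <= e) -> Cmod (cavg f - cavg g)%cx <= 2 * e.
Proof.
  intros Hf Hg He.
  replace (cavg f - cavg g)%cx with (cavg (fun x => f x + (- C1) * g x)%cx).
  - apply cavg_bound.
    + apply ccont_add; [assumption | now apply ccont_scal].
    + intros x. replace (f x + - C1 * g x)%cx with (f x - g x)%cx by ring. apply He.
  - rewrite cavg_add, cavg_scal by (try assumption; now apply ccont_scal). ring.
Qed.

Lemma continuous_cos_lin (a x : R) : continuous (fun t => cos (a * t)) x.
Proof.
  apply (ex_derive_continuous (V := R_NormedModule)). auto_derive. trivial.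
Qed.
Lemma continuous_sin_lin (a x : R) : continuous (fun t => sin (a * t)) x.
Proof.
  apply (ex_derive_continuous (V := R_NormedModule)). auto_derive. trivial.
Qed.

Lemma ccont_Czpow_circ (r : R) (k : Z) : 0 < r -> ccont (fun th => Czpow (circ r th) k).
Proof.
  intros Hr.
  apply ccont_ext with (fun th =>
    (powerRZ r k * cos (IZR k * th), powerRZ r k * sin (IZR k * th))).
  - intros. now rewrite Czpow_circ.
  - split; intros x; simpl; apply continuous_mulc.
    + apply continuous_cos_lin.
    + apply continuous_sin_lin.
Qed.

Lemma sin_period_Z (k : Z) : sin (IZR k * (2 * PI)) = 0.
Proof. apply sin_eq_0_1. exists (2 * k)%Z. rewrite mult_IZR. ring. Qed.

Lemma cos_period_Z (k : Z) : cos (IZR k * (2 * PI)) = 1.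
Proof.
  replace (IZR k * (2 * PI)) with (2 * (IZR k * PI)) by ring.
  rewrite cos_2a_sin. replace (sin (IZR k * PI)) with 0; [ring|].
  symmetry. apply sin_eq_0_1. now exists k.
Qed.

(** The primitives [sin (k th) / k] and [- cos (k th) / k] take equal values at both ends of the
    period. This orthogonality is the only integral that is ever computed. *)
Lemma cavg_Czpow_circ (r : R) (k : Z) : 0 < r ->
  cavg (fun th => Czpow (circ r th) k) = if (k =? 0)%Z then C1 else C0.
Proof.
  intros Hr. destruct (Z.eqb_spec k 0) as [->|Hk].
  - simpl. apply cavg_const.
  - assert (Hk' : IZR k <> 0) by (intros E; apply Hk; now apply eq_IZR).
    rewrite (cavg_ext _ (fun th =>
      (powerRZ r k * cos (IZR k * th), powerRZ r k * sin (IZR k * th))))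
      by (intros; now apply Czpow_circ).
    assert (Ec : avg (fun th => cos (IZR k * th)) = 0).
    { unfold avg. replace (RInt _ 0 (2 * PI)) with (sin (IZR k * (2 * PI)) / IZR k - sin (IZR k * 0) / IZR k).
      - rewrite sin_period_Z, Rmult_0_r, sin_0. field.
        split; (exact PI_neq0 || assumption).
      - symmetry. apply (is_RInt_unique (V := R_CompleteNormedModule)).
        apply (is_RInt_derive (V := R_CompleteNormedModule) (fun x => sin (IZR k * x) / IZR k) (fun th => cos (IZR k * th))).
        + intros x _. auto_derive; [trivial|]. field. assumption.
        + intros x _. apply continuous_cos_lin. }
    assert (Es : avg (fun th => sin (IZR k * th)) = 0).
    { unfold avg. replace (RInt _ 0 (2 * PI)) with (- cos (IZR k * (2 * PI)) / IZR k - - cos (IZR k * 0) / IZR k).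
      - rewrite cos_period_Z, Rmult_0_r, cos_0. field.
        split; (exact PI_neq0 || assumption).
      - symmetry. apply (is_RInt_unique (V := R_CompleteNormedModule)).
        apply (is_RInt_derive (V := R_CompleteNormedModule) (fun x => - cos (IZR k * x) / IZR k) (fun th => sin (IZR k * th))).
        + intros x _. auto_derive; [trivial|]. field. assumption.
        + intros x _. apply continuous_sin_lin. }
    apply Cx_ext; simpl; rewrite avg_scal.
    + rewrite Ec; ring.
    + apply continuous_cos_lin.
    + rewrite Es; ring.
    + apply continuous_sin_lin.
Qed.

Lemma continuous_unif_approx (g : R -> R) (k : R) :
  (forall e, 0 < e -> exists h, (forall x, continuous h x) /\ forall x, Rabs (g x - h x) <= k * e) ->
  forall x, continuous g x.
Proof.
  intros H x. apply continuity_pt_filterlim. intros e He.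
  (* A positive substitute for [k], whose sign is unknown. Three errors of at most [e / 4] then stay
     below [e]. *)
  set (k' := Rabs k + 1).
  assert (Hk : 0 < k') by (unfold k'; pose proof (Rabs_pos k); lra).
  destruct (H (e / (4 * k'))) as (h & Hh & Hgh); [apply Rdiv_lt_0_compat; lra|].
  assert (Hs : forall y, Rabs (g y - h y) <= e / 4).
  { intros y. eapply Rle_trans; [apply Hgh|].
    apply Rle_trans with (k' * (e / (4 * k'))).
    - apply Rmult_le_compat_r; [left; apply Rdiv_lt_0_compat; lra|].
      unfold k'. pose proof (Rle_abs k). lra.
    - right. field. lra. }
  specialize (Hh x). apply continuity_pt_filterlim in Hh.
  destruct (Hh (e / 4)) as (d & Hd & Hd'); [lra|].
  exists d. split; [assumption|]. intros y Hy. specialize (Hd' y Hy).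
  simpl in *. unfold Rdist in *.
  pose proof (Hs x). pose proof (Hs y).
  unfold Rabs in *; repeat destruct Rcase_abs; lra.
Qed.

(** Provides the continuity of an inner average in the outer angle, as a uniform limit of averages
    of Laurent polynomials. *)
Lemma ccont_unif_approx (g : R -> Cx) (k : R) :
  (forall e, 0 < e -> exists h, ccont h /\ forall x, Cmod (g x - h x)%cx <= k * e) -> ccont g.
Proof.
  intros H. split; apply continuous_unif_approx with k; intros e He;
    destruct (H e He) as (h & [H1 H2] & Hc).
  - exists (fun th => fst (h th)). split; [assumption|]. intros x.
    eapply Rle_trans; [apply (fst_le_Cmod (g x - h x)%cx) | apply Hc].
  - exists (fun th => snd (h th)). split; [assumption|]. intros x.
    eapply Rle_trans; [apply (snd_le_Cmod (g x - h x)%cx) | apply Hc].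
Qed.

Arguments Csum l : simpl never.
Arguments Cprod l : simpl never.

(** * Laurent polynomials on a torus *)

(** Exponents form a function on all of [nat], of which only the first [length zs] values are read:
    removing the first variable is a shift, and altering one exponent involves no lengths. *)
Fixpoint mono (e : nat -> Z) (zs : list Cx) : Cx :=
  match zs with
  | [] => C1
  | z :: zs' => (Czpow z (e O) * mono (fun i => e (S i)) zs')%cx
  end.

Fixpoint zerob (n : nat) (e : nat -> Z) : bool :=
  match n with
  | O => true
  | S n' => (e O =? 0)%Z && zerob n' (fun i => e (S i))
  end.

(** A formal sum whose like terms are not collected; only its values [ev] and its constant term [ct]
    matter. *)
Definition lpoly := list (Cx * (nat -> Z)).
Definition ev (p : lpoly) (zs : list Cx) : Cx :=
  Csum (map (fun ce => fst ce * mono (snd ce) zs)%cx p).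
Definition ct (n : nat) (p : lpoly) : Cx :=
  Csum (map (fun ce => if zerob n (snd ce) then fst ce else C0) p).

Lemma mono_ext (e f : nat -> Z) (zs : list Cx) :
  (forall i, (i < length zs)%nat -> e i = f i) -> mono e zs = mono f zs.
Proof.
  revert e f. induction zs as [|z zs IH]; intros e f H; simpl; [reflexivity|].
  rewrite (H O) by (simpl; lia). f_equal. apply IH. intros. apply H. simpl; lia.
Qed.

Lemma zerob_ext (n : nat) (e f : nat -> Z) :
  (forall i, (i < n)%nat -> e i = f i) -> zerob n e = zerob n f.
Proof.
  revert e f. induction n as [|n IH]; intros e f H; simpl; [reflexivity|].
  rewrite (H O) by lia. f_equal. apply IH. intros. apply H. lia.
Qed.

Lemma zerob_false (n i : nat) (e : nat -> Z) :
  (i < n)%nat -> e i <> 0%Z -> zerob n e = false.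
Proof.
  revert i e. induction n as [|n IH]; intros i e Hi He; simpl; [lia|].
  destruct i as [|i].
  - destruct (Z.eqb_spec (e O) 0); [contradiction | reflexivity].
  - rewrite (IH i); [now rewrite andb_false_r | lia | assumption].
Qed.

Definition torus (r : R) (n : nat) (zs : list Cx) : Prop :=
  length zs = n /\ Forall (fun z => Cmod z = r) zs.

Lemma torus_nil (r : R) : torus r 0 [].
Proof. split; [reflexivity | constructor]. Qed.

Lemma torus_cons (r : R) (n : nat) (z : Cx) (zs : list Cx) :
  Cmod z = r -> torus r n zs -> torus r (S n) (z :: zs).
Proof. intros Hz [H1 H2]. split; [simpl; lia | now constructor]. Qed.

Lemma torus_nth (r : R) (n : nat) (zs : list Cx) (i : nat) :
  torus r n zs -> (i < n)%nat -> Cmod (nth i zs C0) = r.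
Proof.
  intros [H1 H2] Hi. rewrite Forall_forall in H2. apply H2, nth_In. lia.
Qed.

Lemma torus_nth_neq0 (r : R) (n : nat) (zs : list Cx) (i : nat) :
  0 < r -> torus r n zs -> (i < n)%nat -> nth i zs C0 <> C0.
Proof.
  intros Hr Hz Hi. apply Cmod_pos_neq. rewrite (torus_nth r n); assumption.
Qed.

Lemma mono_add (e f : nat -> Z) (zs : list Cx) :
  Forall (fun z => z <> C0) zs ->
  mono (fun i => (e i + f i)%Z) zs = (mono e zs * mono f zs)%cx.
Proof.
  intros H. revert e f. induction H as [|z zs Hz H IH]; intros e f; simpl; [ring|].
  rewrite Czpow_add, (IH (fun i => e (S i)) (fun i => f (S i))) by assumption. ring.
Qed.

Lemma torus_neq0 (r : R) (n : nat) (zs : list Cx) :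
  0 < r -> torus r n zs -> Forall (fun z => z <> C0) zs.
Proof.
  intros Hr [_ H]. eapply Forall_impl; [|exact H]. cbv beta. intros z Hz.
  apply Cmod_pos_neq. lra.
Qed.

Lemma Csum_app (l l' : list Cx) : Csum (l ++ l') = (Csum l + Csum l')%cx.
Proof.
  unfold Csum. induction l as [|z l IH]; simpl; [ring|]. rewrite IH. ring.
Qed.

Lemma Csum_cons (z : Cx) (l : list Cx) : Csum (z :: l) = (z + Csum l)%cx.
Proof. reflexivity. Qed.

Lemma Csum_map_mul {A : Type} (c : Cx) (f : A -> Cx) (l : list A) :
  Csum (map (fun a => c * f a)%cx l) = (c * Csum (map f l))%cx.
Proof.
  induction l as [|a l IH]; simpl; [unfold Csum; simpl; ring|].
  rewrite !Csum_cons, IH. ring.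
Qed.

Lemma ev_cons (c : Cx) (e : nat -> Z) (p : lpoly) (zs : list Cx) :
  ev ((c, e) :: p) zs = (c * mono e zs + ev p zs)%cx.
Proof. reflexivity. Qed.

Lemma ct_cons (n : nat) (c : Cx) (e : nat -> Z) (p : lpoly) :
  ct n ((c, e) :: p) = ((if zerob n e then c else C0) + ct n p)%cx.
Proof. reflexivity. Qed.

Lemma ev_app (p p' : lpoly) (zs : list Cx) : ev (p ++ p') zs = (ev p zs + ev p' zs)%cx.
Proof. unfold ev. now rewrite map_app, Csum_app. Qed.

Lemma ct_app (n : nat) (p p' : lpoly) : ct n (p ++ p') = (ct n p + ct n p')%cx.
Proof. unfold ct. now rewrite map_app, Csum_app. Qed.

Definition pscal (c : Cx) (p : lpoly) : lpoly := map (fun ce => (c * fst ce, snd ce)%cx) p.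
Definition pmap (f : (nat -> Z) -> (nat -> Z)) (p : lpoly) : lpoly :=
  map (fun ce => (fst ce, f (snd ce))) p.
Definition pmul (p p' : lpoly) : lpoly :=
  flat_map (fun ce => pscal (fst ce) (pmap (fun f i => (snd ce i + f i)%Z) p')) p.
(** The first variable is frozen at [z] and its power absorbed into the coefficient, which leaves a
    polynomial in the other variables. *)
Definition slice (p : lpoly) (z : Cx) : lpoly :=
  map (fun ce => (fst ce * Czpow z (snd ce O), fun i => snd ce (S i))%cx) p.

Lemma ev_pscal (c : Cx) (p : lpoly) (zs : list Cx) : ev (pscal c p) zs = (c * ev p zs)%cx.
Proof.
  induction p as [|[a e] p IH]; [unfold ev, Csum; simpl; ring|].
  change (pscal c ((a, e) :: p)) with ((c * a, e)%cx :: pscal c p).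
  rewrite !ev_cons, IH. ring.
Qed.

Lemma ct_pscal (n : nat) (c : Cx) (p : lpoly) : ct n (pscal c p) = (c * ct n p)%cx.
Proof.
  induction p as [|[a e] p IH]; [unfold ct, Csum; simpl; ring|].
  change (pscal c ((a, e) :: p)) with ((c * a, e)%cx :: pscal c p).
  rewrite !ct_cons, IH. destruct (zerob n e); ring.
Qed.

Lemma ev_pmap (f : (nat -> Z) -> (nat -> Z)) (p : lpoly) (zs zs' : list Cx) :
  (forall e, mono (f e) zs = mono e zs') -> ev (pmap f p) zs = ev p zs'.
Proof.
  intros H. unfold ev, pmap. rewrite map_map. f_equal. apply map_ext.
  intros [a e]; simpl. now rewrite H.
Qed.

Lemma ct_pmap (f : (nat -> Z) -> (nat -> Z)) (p : lpoly) (n n' : nat) :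
  (forall e, zerob n (f e) = zerob n' e) -> ct n (pmap f p) = ct n' p.
Proof.
  intros H. unfold ct, pmap. rewrite map_map. f_equal. apply map_ext.
  intros [a e]; simpl. now rewrite H.
Qed.

Lemma ev_pmul (p p' : lpoly) (zs : list Cx) : Forall (fun z => z <> C0) zs ->
  ev (pmul p p') zs = (ev p zs * ev p' zs)%cx.
Proof.
  intros Hz. induction p as [|[a e] p IH]; [unfold ev, Csum; simpl; ring|].
  change (pmul ((a, e) :: p) p') with
    (pscal a (pmap (fun f i => (e i + f i)%Z) p') ++ pmul p p').
  rewrite ev_app, ev_pscal, ev_cons, IH.
  enough (E : ev (pmap (fun f i => (e i + f i)%Z) p') zs = (mono e zs * ev p' zs)%cx)
    by (rewrite E; ring).
  clear IH. induction p' as [|[b f] p' IH]; [unfold ev, Csum; simpl; ring|].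
  change (pmap ?g ((b, f) :: p')) with ((b, g f) :: pmap g p').
  rewrite !ev_cons, IH, mono_add by assumption. ring.
Qed.

Lemma ev_slice (p : lpoly) (z : Cx) (zs : list Cx) : ev (slice p z) zs = ev p (z :: zs).
Proof.
  unfold ev, slice. rewrite map_map. f_equal. apply map_ext. intros [a e]; simpl. ring.
Qed.

Definition approx (r : R) (n : nat) (F : list Cx -> Cx) (eps : R) (p : lpoly) : Prop :=
  forall zs, torus r n zs -> Cmod (F zs - ev p zs)%cx <= eps.

(* The constraint [P] on the exponents replaces analyticity: exponents [>= 0]
   (resp. [<= 0]) in a variable stand for a function that is analytic inside
   (resp. outside) the circle in that variable. *)
Definition LaurentP (r : R) (P : (nat -> Z) -> Prop) (n : nat) (F : list Cx -> Cx) : Prop :=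
  forall eps, 0 < eps ->
    exists p, Forall (fun ce => P (snd ce)) p /\ approx r n F eps p.
Definition Laurent (r : R) := LaurentP r (fun _ => True).

(** Nested like [iter_contour], with the first variable outermost. *)
Fixpoint tavg (r : R) (n : nat) (F : list Cx -> Cx) : Cx :=
  match n with
  | O => F []
  | S n' => cavg (fun th => tavg r n' (fun zs => F (circ r th :: zs)))
  end.

Section Torus.
Variable r : R.
Hypothesis Hr : 0 < r.

Lemma LaurentP_weaken (P Q : (nat -> Z) -> Prop) n F :
  (forall e, P e -> Q e) -> LaurentP r P n F -> LaurentP r Q n F.
Proof.
  intros H HF eps He. destruct (HF eps He) as (p & Hp & Ha). exists p. split; [|assumption].
  eapply Forall_impl; [|exact Hp]. cbv beta. auto.
Qed.

Lemma LaurentP_nice P n F : LaurentP r P n F -> Laurent r n F.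
Proof. apply LaurentP_weaken. auto. Qed.

Lemma LaurentP_ext P n F G :
  (forall zs, torus r n zs -> F zs = G zs) -> LaurentP r P n F -> LaurentP r P n G.
Proof.
  intros H HF eps He. destruct (HF eps He) as (p & Hp & Ha). exists p. split; [assumption|].
  intros zs Hz. rewrite <- H by assumption. auto.
Qed.

Lemma LaurentP_mono (P : (nat -> Z) -> Prop) n e : P e -> LaurentP r P n (mono e).
Proof.
  intros He eps Heps. exists [(C1, e)]. split; [now repeat constructor|].
  intros zs _. rewrite ev_cons. unfold ev, Csum; simpl.
  replace (mono e zs - (C1 * mono e zs + C0))%cx with C0 by ring.
  rewrite Cmod_C0. lra.
Qed.

Lemma LaurentP_add P n F G : LaurentP r P n F -> LaurentP r P n G ->
  LaurentP r P n (fun zs => F zs + G zs)%cx.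
Proof.
  intros HF HG eps He.
  destruct (HF (eps / 2)) as (p & Hp & Ha); [lra|].
  destruct (HG (eps / 2)) as (p' & Hp' & Ha'); [lra|].
  exists (p ++ p'). split; [now apply Forall_app|].
  intros zs Hz. rewrite ev_app.
  replace (F zs + G zs - (ev p zs + ev p' zs))%cx with ((F zs - ev p zs) + (G zs - ev p' zs))%cx by ring.
  eapply Rle_trans; [apply Cmod_add_le|].
  specialize (Ha zs Hz). specialize (Ha' zs Hz). lra.
Qed.

Lemma approx_scal n F eps p c :
  approx r n F eps p -> approx r n (fun zs => c * F zs)%cx (Cmod c * eps) (pscal c p).
Proof.
  intros H zs Hz. rewrite ev_pscal.
  replace (c * F zs - c * ev p zs)%cx with (c * (F zs - ev p zs))%cx by ring.
  rewrite Cmod_mul. apply Rmult_le_compat_l; [apply Cmod_ge_0 | auto].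
Qed.

Lemma LaurentP_scal P n F c : LaurentP r P n F -> LaurentP r P n (fun zs => c * F zs)%cx.
Proof.
  intros HF eps He. pose proof (Cmod_ge_0 c) as Hc.
  destruct (HF (eps / (Cmod c + 1))) as (p & Hp & Ha).
  { apply Rdiv_lt_0_compat; lra. }
  exists (pscal c p). split.
  - unfold pscal. rewrite Forall_map. exact Hp.
  - intros zs Hz. eapply Rle_trans; [apply (approx_scal n F _ p c Ha zs Hz)|].
    apply Rmult_le_reg_r with (Cmod c + 1); [lra|].
    replace (Cmod c * (eps / (Cmod c + 1)) * (Cmod c + 1)) with (Cmod c * eps) by (field; lra).
    nra.
Qed.

(** Closure under uniform limits, through which the geometric and the exponential series enter. *)
Lemma LaurentP_lim P n F :
  (forall eps, 0 < eps -> exists G, LaurentP r P n G /\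
     forall zs, torus r n zs -> Cmod (F zs - G zs)%cx <= eps) -> LaurentP r P n F.
Proof.
  intros H eps He. destruct (H (eps / 2)) as (G & HG & Hc); [lra|].
  destruct (HG (eps / 2)) as (p & Hp & Ha); [lra|].
  exists p. split; [assumption|]. intros zs Hz.
  eapply Rle_trans; [apply (Cmod_sub_trans (G zs))|].
  specialize (Hc zs Hz). specialize (Ha zs Hz). lra.
Qed.

Lemma mono_bounded n e : exists B, 0 <= B /\ forall zs, torus r n zs -> Cmod (mono e zs) <= B.
Proof.
  revert e. induction n as [|n IH]; intros e.
  - exists 1. split; [lra|]. intros zs [H _]. destruct zs; [|discriminate].
    simpl. rewrite Cmod_C1. lra.
  - destruct (IH (fun i => e (S i))) as (B & HB & H).
    exists (powerRZ r (e O) * B). pose proof (powerRZ_lt r (e O) Hr) as Hpos.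
    split; [nra|].
    intros zs [Hl Hz]. destruct zs as [|z zs]; [discriminate|].
    inversion Hz as [|? ? Hz1 Hz2]; subst. simpl.
    rewrite Cmod_mul, Cmod_Czpow by (apply Cmod_pos_neq; lra).
    apply Rmult_le_compat_l; [lra|].
    apply H. split; [simpl in Hl; lia | assumption].
Qed.

Lemma ev_bounded n p : exists B, 0 <= B /\ forall zs, torus r n zs -> Cmod (ev p zs) <= B.
Proof.
  induction p as [|[a e] p (B & HB & H)].
  - exists 0. split; [lra|]. intros zs _. unfold ev, Csum; simpl. rewrite Cmod_C0; lra.
  - destruct (mono_bounded n e) as (B' & HB' & H').
    exists (Cmod a * B' + B). pose proof (Cmod_ge_0 a).
    split; [nra|]. intros zs Hz. rewrite ev_cons.
    eapply Rle_trans; [apply Cmod_add_le|]. rewrite Cmod_mul.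
    specialize (H zs Hz). specialize (H' zs Hz). nra.
Qed.

Lemma LaurentP_bounded P n F : LaurentP r P n F ->
  exists B, 0 <= B /\ forall zs, torus r n zs -> Cmod (F zs) <= B.
Proof.
  intros HF. destruct (HF 1 Rlt_0_1) as (p & _ & Ha).
  destruct (ev_bounded n p) as (B & HB & H). exists (B + 1). split; [lra|].
  intros zs Hz. specialize (Ha zs Hz). specialize (H zs Hz).
  pose proof (Cmod_sub_ge (F zs) (ev p zs)). lra.
Qed.

(** Exponents add under multiplication, so the constraint on the product need only contain the sums
    of the two constraints. *)
Lemma LaurentP_mul (P Q R' : (nat -> Z) -> Prop) n F G :
  (forall e f, P e -> Q f -> R' (fun i => (e i + f i)%Z)) ->
  LaurentP r P n F -> LaurentP r Q n G -> LaurentP r R' n (fun zs => F zs * G zs)%cx.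
Proof.
  intros HPQ HF HG eps He.
  destruct (LaurentP_bounded Q n G HG) as (B & HB & HBG).
  destruct (HF (eps / (2 * (B + 1)))) as (p & Hp & Ha).
  { apply Rdiv_lt_0_compat; lra. }
  destruct (ev_bounded n p) as (B' & HB' & HBp).
  (* From [F G - p p' = (F - p) G + p (G - p')]: the tolerance for [G] depends on the bound [B'] of
     [p], so [p] is chosen before it. *)
  destruct (HG (eps / (2 * (B' + 1)))) as (p' & Hp' & Ha').
  { apply Rdiv_lt_0_compat; lra. }
  exists (pmul p p'). split.
  - apply Forall_forall. intros ce Hce. unfold pmul in Hce.
    apply in_flat_map in Hce. destruct Hce as (c1 & H1 & H2).
    unfold pscal, pmap in H2. rewrite map_map in H2. apply in_map_iff in H2.
    destruct H2 as (c2 & <- & H2). simpl.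
    rewrite Forall_forall in Hp, Hp'. auto.
  - intros zs Hz. rewrite ev_pmul by (now apply (torus_neq0 r n)).
    replace (F zs * G zs - ev p zs * ev p' zs)%cx
      with ((F zs - ev p zs) * G zs + ev p zs * (G zs - ev p' zs))%cx by ring.
    eapply Rle_trans; [apply Cmod_add_le|]. rewrite !Cmod_mul.
    specialize (Ha zs Hz). specialize (Ha' zs Hz). specialize (HBG zs Hz). specialize (HBp zs Hz).
    assert (H1 : Cmod (F zs - ev p zs)%cx * Cmod (G zs) <= eps / (2 * (B + 1)) * B).
    { apply Rmult_le_compat; auto; apply Cmod_ge_0. }
    assert (H2 : Cmod (ev p zs) * Cmod (G zs - ev p' zs)%cx <= B' * (eps / (2 * (B' + 1)))).
    { apply Rmult_le_compat; auto; apply Cmod_ge_0. }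
    assert (H3 : eps / (2 * (B + 1)) * B <= eps / 2).
    { apply Rmult_le_reg_r with (2 * (B + 1)); [lra|].
      replace (eps / (2 * (B + 1)) * B * (2 * (B + 1))) with (eps * B) by (field; lra). nra. }
    assert (H4 : B' * (eps / (2 * (B' + 1))) <= eps / 2).
    { apply Rmult_le_reg_r with (2 * (B' + 1)); [lra|].
      replace (B' * (eps / (2 * (B' + 1))) * (2 * (B' + 1))) with (eps * B') by (field; lra). nra. }
    lra.
Qed.

Lemma Laurent_mul n F G : Laurent r n F -> Laurent r n G -> Laurent r n (fun zs => F zs * G zs)%cx.
Proof. apply LaurentP_mul. auto. Qed.

Lemma mono_zero (zs : list Cx) : mono (fun _ => 0%Z) zs = C1.
Proof. induction zs as [|z zs IH]; simpl; [reflexivity|]. rewrite IH. ring. Qed.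

Lemma LaurentP_const (P : (nat -> Z) -> Prop) n c :
  P (fun _ => 0%Z) -> LaurentP r P n (fun _ => c).
Proof.
  intros HP. apply LaurentP_ext with (fun zs => c * mono (fun _ => 0%Z) zs)%cx.
  - intros. rewrite mono_zero. ring.
  - apply LaurentP_scal. now apply LaurentP_mono.
Qed.

Lemma Laurent_const n c : Laurent r n (fun _ => c).
Proof. now apply LaurentP_const. Qed.

Definition unit_expo (m : nat) (k : Z) (i : nat) : Z := if (i =? m)%nat then k else 0%Z.

Lemma mono_unit_expo (m : nat) (k : Z) (zs : list Cx) : (m < length zs)%nat ->
  mono (unit_expo m k) zs = Czpow (nth m zs C0) k.
Proof.
  revert zs. induction m as [|m IH]; intros [|z zs] H; simpl in H; try lia.
  - simpl. change (fun i => unit_expo 0 k (S i)) with (fun _ : nat => 0%Z).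
    rewrite mono_zero. unfold unit_expo; simpl. ring.
  - simpl. unfold unit_expo at 1; simpl.
    change (fun i => unit_expo (S m) k (S i)) with (unit_expo m k). rewrite IH by lia. ring.
Qed.

Lemma LaurentP_var (P : (nat -> Z) -> Prop) n m k : (m < n)%nat -> P (unit_expo m k) ->
  LaurentP r P n (fun zs => Czpow (nth m zs C0) k).
Proof.
  intros Hm HP. apply LaurentP_ext with (mono (unit_expo m k)).
  - intros zs [Hl _]. apply mono_unit_expo. lia.
  - now apply LaurentP_mono.
Qed.

Lemma Laurent_slice n F z : Laurent r (S n) F -> Cmod z = r -> Laurent r n (fun zs => F (z :: zs)).
Proof.
  intros HF Hz eps He. destruct (HF eps He) as (p & _ & Ha). exists (slice p z). split.
  - apply Forall_forall. auto.
  - intros zs Hzs. rewrite ev_slice. apply Ha. now apply torus_cons.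
Qed.

(** Averaging over the first variable keeps the terms in which its exponent is 0; what remains is
    the constant term in all variables. *)
Lemma ct_slice (n : nat) (p : lpoly) :
  ccont (fun th => ct n (slice p (circ r th))) /\
  cavg (fun th => ct n (slice p (circ r th))) = ct (S n) p.
Proof.
  induction p as [|[a e] p [H1 H2]].
  - split; [exact (ccont_const C0) | exact (cavg_const C0)].
  - set (a' := if zerob n (fun i => e (S i)) then a else C0).
    assert (E : forall th,
      (a' * Czpow (circ r th) (e O) + ct n (slice p (circ r th)))%cx =
      ct n (slice ((a, e) :: p) (circ r th))).
    { intros th. change (slice ((a, e) :: p) (circ r th)) with
        (((a * Czpow (circ r th) (e O))%cx, fun i => e (S i)) :: slice p (circ r th)).
      rewrite ct_cons. unfold a'. destruct (zerob n _); ring. }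
    assert (H3 := ccont_Czpow_circ r (e O) Hr).
    split.
    + eapply ccont_ext; [exact E|]. apply ccont_add; [|assumption]. now apply ccont_scal.
    + rewrite <- (cavg_ext _ _ E), cavg_add, cavg_scal, H2, ct_cons, cavg_Czpow_circ
        by (try assumption; now apply ccont_scal).
      simpl. unfold a'. destruct (Z.eqb (e O) 0), (zerob n _); simpl; ring.
Qed.

Lemma tavg_ext n F G : (forall zs, torus r n zs -> F zs = G zs) -> tavg r n F = tavg r n G.
Proof.
  revert F G. induction n as [|n IH]; intros F G H; simpl.
  - apply H, torus_nil.
  - apply cavg_ext. intros th. apply IH. intros zs Hz. apply H, torus_cons; [|assumption].
    now apply Cmod_circ.
Qed.

(** Each of the [n] averages at most doubles the error, by [cavg_close]. *)
Lemma tavg_approx n F : Laurent r n F -> forall eps p, approx r n F eps p ->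
  Cmod (tavg r n F - ct n p)%cx <= 2 ^ n * eps.
Proof.
  revert F. induction n as [|n IH]; intros F HF eps p Ha.
  - simpl. rewrite Rmult_1_l. replace (ct 0 p) with (ev p []); [apply Ha, torus_nil|].
    unfold ev, ct. f_equal. apply map_ext. intros [a e]; simpl. ring.
  - assert (Hs : forall eps p, approx r (S n) F eps p -> forall th,
      Cmod (tavg r n (fun zs => F (circ r th :: zs)) - ct n (slice p (circ r th)))%cx <= 2 ^ n * eps).
    { intros eps' p' Ha' th. apply IH.
      - apply Laurent_slice; [assumption | now apply Cmod_circ].
      - intros zs Hz. rewrite ev_slice. apply Ha', torus_cons; [now apply Cmod_circ | assumption]. }
    simpl tavg. rewrite <- (proj2 (ct_slice n p)).
    replace (2 ^ S n * eps) with (2 * (2 ^ n * eps)) by (simpl; ring).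
    apply cavg_close; [|apply ct_slice|auto].
    (* The given [p] has one fixed error, whereas continuity of the inner average asks for
       approximants of every precision; these come from [HF]. *)
    apply ccont_unif_approx with (2 ^ n). intros e He.
    destruct (HF e He) as (p' & _ & Ha').
    exists (fun th => ct n (slice p' (circ r th))). split; [apply ct_slice|]. auto.
Qed.

Lemma tavg_ccont n F : Laurent r (S n) F ->
  ccont (fun th => tavg r n (fun zs => F (circ r th :: zs))).
Proof.
  intros HF. apply ccont_unif_approx with (2 ^ n). intros e He.
  destruct (HF e He) as (p & _ & Ha).
  exists (fun th => ct n (slice p (circ r th))). split; [apply ct_slice|]. intros th.
  apply tavg_approx.
  - apply Laurent_slice; [assumption | now apply Cmod_circ].
  - intros zs Hz. rewrite ev_slice. apply Ha, torus_cons; [now apply Cmod_circ | assumption].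
Qed.

(** Reduces identities between iterated integrals to identities between constant terms of
    approximants. *)
Lemma tavg_unique n F c k : Laurent r n F ->
  (forall eps, 0 < eps -> exists p, approx r n F eps p /\ Cmod (ct n p - c)%cx <= k * eps) ->
  tavg r n F = c.
Proof.
  intros HF H. apply Cx_eq_eps with (2 ^ n + k). intros e He.
  destruct (H e He) as (p & Ha & Hc).
  eapply Rle_trans; [apply (Cmod_sub_trans (ct n p))|].
  pose proof (tavg_approx n F HF e p Ha). lra.
Qed.

Lemma tavg_add n F G : Laurent r n F -> Laurent r n G ->
  tavg r n (fun zs => F zs + G zs)%cx = (tavg r n F + tavg r n G)%cx.
Proof.
  intros HF HG. apply tavg_unique with (2 ^ n); [now apply LaurentP_add|]. intros e He.
  destruct (HF (e / 2)) as (p & _ & Ha); [lra|].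
  destruct (HG (e / 2)) as (p' & _ & Ha'); [lra|].
  exists (p ++ p'). split.
  - intros zs Hz. rewrite ev_app.
    replace (F zs + G zs - (ev p zs + ev p' zs))%cx with ((F zs - ev p zs) + (G zs - ev p' zs))%cx by ring.
    eapply Rle_trans; [apply Cmod_add_le|].
    specialize (Ha zs Hz). specialize (Ha' zs Hz). lra.
  - rewrite ct_app.
    replace (ct n p + ct n p' - (tavg r n F + tavg r n G))%cx
      with ((ct n p - tavg r n F) + (ct n p' - tavg r n G))%cx by ring.
    eapply Rle_trans; [apply Cmod_add_le|].
    rewrite (Cmod_sub_sym (ct n p)), (Cmod_sub_sym (ct n p')).
    pose proof (tavg_approx n F HF _ _ Ha). pose proof (tavg_approx n G HG _ _ Ha'). lra.
Qed.

Lemma tavg_scal n F c : Laurent r n F -> tavg r n (fun zs => c * F zs)%cx = (c * tavg r n F)%cx.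
Proof.
  intros HF. apply Cx_eq_eps with (2 * 2 ^ n * Cmod c). intros e He.
  destruct (HF e He) as (p & _ & Ha).
  eapply Rle_trans; [apply (Cmod_sub_trans (ct n (pscal c p)))|].
  pose proof (tavg_approx n _ (LaurentP_scal _ n F c HF) _ _ (approx_scal n F e p c Ha)) as H1.
  pose proof (tavg_approx n F HF _ _ Ha) as H2.
  assert (H3 : Cmod (ct n (pscal c p) - c * tavg r n F)%cx <= Cmod c * (2 ^ n * e)).
  { rewrite ct_pscal. replace (c * ct n p - c * tavg r n F)%cx with (c * (ct n p - tavg r n F))%cx by ring.
    rewrite Cmod_mul, Cmod_sub_sym. apply Rmult_le_compat_l; [apply Cmod_ge_0 | assumption]. }
  lra.
Qed.

Lemma tavg_bound n F B : Laurent r n F -> (forall zs, torus r n zs -> Cmod (F zs) <= B) ->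
  Cmod (tavg r n F) <= 2 ^ n * B.
Proof.
  (* The zero polynomial approximates [F] with error [B]. *)
  intros HF HB. replace (tavg r n F) with (tavg r n F - ct n [])%cx by (unfold ct, Csum; simpl; ring).
  apply tavg_approx; [assumption|]. intros zs Hz. unfold ev, Csum; simpl.
  replace (F zs - C0)%cx with (F zs) by ring. auto.
Qed.

(** Cauchy's theorem in terms of exponents: the approximants have no constant term at all. *)
Lemma tavg_zero (P : (nat -> Z) -> Prop) n F : LaurentP r P n F ->
  (forall e, P e -> zerob n e = false) -> tavg r n F = C0.
Proof.
  intros HF HP. apply tavg_unique with 0; [now apply LaurentP_nice in HF|]. intros e He.
  destruct (HF e He) as (p & Hp & Ha). exists p. split; [assumption|].
  replace (ct n p) with C0.
  - replace (C0 - C0)%cx with C0 by ring. rewrite Cmod_C0. lra.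
  - clear Ha. induction Hp as [|[a f] p Hf Hp IH]; [reflexivity|].
    rewrite ct_cons, <- IH. simpl in Hf. rewrite HP by assumption. ring.
Qed.

Lemma tavg_sum {A : Type} n (f : A -> list Cx -> Cx) (l : list A) :
  (forall a, In a l -> Laurent r n (f a)) ->
  Laurent r n (fun zs => Csum (map (fun a => f a zs) l)) /\
  tavg r n (fun zs => Csum (map (fun a => f a zs) l)) = Csum (map (fun a => tavg r n (f a)) l).
Proof.
  induction l as [|a l IH]; intros H.
  (* The empty polynomial represents the zero function under any constraint, even the impossible
     one. *)
  - split; [exact (Laurent_const n C0)|]. simpl. apply (tavg_zero (fun _ => False)); [|tauto].
    intros eps He. exists []. split; [constructor|]. intros zs _.
    unfold ev, Csum; simpl. replace (C0 - C0)%cx with C0 by ring. rewrite Cmod_C0. lra.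
  - destruct IH as [H1 H2]; [intros; apply H; now right|].
    assert (Ha : Laurent r n (f a)) by (apply H; now left).
    split.
    + apply (LaurentP_add _ n (f a)); assumption.
    + simpl. rewrite !Csum_cons, <- H2. rewrite <- tavg_add by assumption. reflexivity.
Qed.

(** * Exchange of two neighbouring variables *)

Fixpoint swap {A : Type} (k : nat) (l : list A) : list A :=
  match k, l with
  | O, a :: b :: l' => b :: a :: l'
  | S k', a :: l' => a :: swap k' l'
  | _, _ => l
  end.
(** The transposition of [k] and [S k], defined along the recursion of [swap] so that both unfold
    together; [sw_cases] gives the closed form. *)
Fixpoint sw (k i : nat) : nat :=
  match k, i with
  | O, O => 1
  | O, S O => 0
  | O, _ => i
  | S _, O => O
  | S k', S i' => S (sw k' i')
  end%nat.

Lemma nth_swap {A : Type} (k i : nat) (l : list A) (d : A) : (S k < length l)%nat ->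
  nth i (swap k l) d = nth (sw k i) l d.
Proof.
  revert i l. induction k as [|k IH]; intros i [|a l] H; simpl in H; try lia.
  - destruct l as [|b l]; simpl in H; [lia|]. destruct i as [|[|i]]; reflexivity.
  - destruct i; simpl; [reflexivity|]. apply IH. lia.
Qed.

Lemma torus_swap n k zs : torus r n zs -> torus r n (swap k zs).
Proof.
  intros [Hl Hz]. split.
  - rewrite <- Hl. clear. revert zs. induction k as [|k IH]; intros [|a l]; simpl; auto.
    destruct l; reflexivity.
  - clear Hl. revert zs Hz. induction k as [|k IH]; intros [|a l] H; simpl; auto.
    + destruct l; [assumption|]. inversion H as [|? ? Ha Hl']; subst.
      inversion Hl'; subst. now repeat constructor.
    + inversion H; subst. constructor; auto.
Qed.

Lemma mono_swap (k : nat) (e : nat -> Z) (zs : list Cx) : (S k < length zs)%nat ->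
  mono e (swap k zs) = mono (fun i => e (sw k i)) zs.
Proof.
  revert e zs. induction k as [|k IH]; intros e [|a l] H; simpl in H; try lia.
  - destruct l as [|b l]; simpl in H; [lia|]. simpl. ring.
  - simpl. rewrite IH by lia. reflexivity.
Qed.

Lemma zerob_swap (n k : nat) (e : nat -> Z) : (S k < n)%nat ->
  zerob n (fun i => e (sw k i)) = zerob n e.
Proof.
  revert e k. induction n as [|n IH]; intros e k H; [lia|].
  destruct k as [|k].
  - destruct n as [|n]; [lia|]. simpl. 
    destruct (e O =? 0)%Z, (e 1%nat =? 0)%Z; reflexivity.
  - simpl. rewrite (IH (fun i => e (S i))) by lia. reflexivity.
Qed.

Lemma Laurent_swap n k F : (S k < n)%nat -> Laurent r n F -> Laurent r n (fun zs => F (swap k zs)).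
Proof.
  intros Hk HF eps He. destruct (HF eps He) as (p & _ & Ha).
  exists (pmap (fun e i => e (sw k i)) p). split; [apply Forall_forall; auto|].
  intros zs Hz. rewrite (ev_pmap _ p zs (swap k zs)).
  - apply Ha. now apply torus_swap.
  - intros e. rewrite mono_swap; [reflexivity|]. destruct Hz as [-> _]. assumption.
Qed.

(** Fubini for adjacent variables: the exchange permutes exponent vectors and fixes the zero vector,
    so constant terms agree. *)
Lemma tavg_swap n k F : (S k < n)%nat -> Laurent r n F -> tavg r n (fun zs => F (swap k zs)) = tavg r n F.
Proof.
  intros Hk HF. apply tavg_unique with (2 ^ n); [now apply Laurent_swap|]. intros eps He.
  destruct (HF eps He) as (p & _ & Ha).
  exists (pmap (fun e i => e (sw k i)) p). split.
  - intros zs Hz. rewrite (ev_pmap _ p zs (swap k zs)).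
    + apply Ha. now apply torus_swap.
    + intros e. rewrite mono_swap; [reflexivity|]. destruct Hz as [-> _]. assumption.
  - rewrite (ct_pmap _ p n n) by (intros; now apply zerob_swap).
    rewrite Cmod_sub_sym. now apply tavg_approx.
Qed.

(** * Appending a variable on which the function does not depend *)

Lemma torus_snoc_inv n zs : torus r (S n) zs ->
  exists zs' z, zs = zs' ++ [z] /\ torus r n zs' /\ Cmod z = r.
Proof.
  intros [Hl Hz]. destruct (exists_last (l := zs)) as (zs' & z & E); [intros ->; discriminate|].
  exists zs', z. split; [assumption|]. subst zs.
  rewrite length_app in Hl; simpl in Hl. apply Forall_app in Hz. destruct Hz as [H1 H2].
  inversion H2; subst. split; [split; [lia | assumption] | reflexivity].
Qed.

(** The exponents of an approximant in [n] variables are arbitrary from index [n] on, being never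
    read. They must be cleared before a variable with that index is added. *)
Definition trunc_expo (n : nat) (e : nat -> Z) (i : nat) : Z := if (i <? n)%nat then e i else 0%Z.

Lemma mono_trunc_expo n e zs z : length zs = n -> mono (trunc_expo n e) (zs ++ [z]) = mono e zs.
Proof.
  revert n e. induction zs as [|a zs IH]; intros n e <-; simpl.
  - ring.
  - f_equal. rewrite <- (IH (length zs)) by reflexivity. apply mono_ext.
    intros i _. unfold trunc_expo. destruct (Nat.ltb_spec i (length zs)), (Nat.ltb_spec (S i) (S (length zs)));
      try lia; reflexivity.
Qed.

Lemma zerob_trunc_expo n e : zerob (S n) (trunc_expo n e) = zerob n e.
Proof.
  revert e. induction n as [|n IH]; intros e; [reflexivity|].
  change (zerob (S (S n)) (trunc_expo (S n) e)) with ((e O =? 0)%Z && zerob (S n) (fun i => trunc_expo (S n) e (S i))).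
  rewrite (zerob_ext (S n) (fun i => trunc_expo (S n) e (S i)) (trunc_expo n (fun i => e (S i)))).
  - rewrite IH. reflexivity.
  - intros i _. unfold trunc_expo. destruct (Nat.ltb_spec i n), (Nat.ltb_spec (S i) (S n));
      try lia; reflexivity.
Qed.

Lemma approx_weak n F G eps p : approx r n F eps p ->
  (forall zs z, torus r n zs -> Cmod z = r -> G (zs ++ [z]) = F zs) ->
  approx r (S n) G eps (pmap (trunc_expo n) p).
Proof.
  intros Ha HG zs Hz. destruct (torus_snoc_inv n zs Hz) as (zs' & z & -> & Hz' & Hzr).
  rewrite HG, (ev_pmap _ p _ zs') by (try assumption; intros; apply mono_trunc_expo, Hz').
  now apply Ha.
Qed.

Lemma LaurentP_weak P n F G : LaurentP r P n F ->
  (forall zs z, torus r n zs -> Cmod z = r -> G (zs ++ [z]) = F zs) ->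
  LaurentP r (fun e => e n = 0%Z) (S n) G.
Proof.
  intros HF HG eps He. destruct (HF eps He) as (p & _ & Ha).
  exists (pmap (trunc_expo n) p). split.
  - unfold pmap. rewrite Forall_map. apply Forall_forall. intros ce _. simpl.
    unfold trunc_expo. now rewrite Nat.ltb_irrefl.
  - now apply (approx_weak n F).
Qed.

Lemma tavg_weak n F G : Laurent r n F ->
  (forall zs z, torus r n zs -> Cmod z = r -> G (zs ++ [z]) = F zs) ->
  tavg r (S n) G = tavg r n F.
Proof.
  intros HF HG. apply tavg_unique with (2 ^ n).
  - eapply LaurentP_nice, LaurentP_weak; eassumption.
  - intros eps He. destruct (HF eps He) as (p & _ & Ha).
    exists (pmap (trunc_expo n) p). split; [now apply (approx_weak n F)|].
    rewrite (ct_pmap _ p (S n) n) by (intros; apply zerob_trunc_expo).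
    rewrite Cmod_sub_sym. now apply tavg_approx.
Qed.

(** * Contour integrals as averages *)

Lemma CRint_cavg (f : R -> Cx) : ccont f -> CRint f 0 (2 * PI) (RtoC (2 * PI) * cavg f)%cx.
Proof.
  intros [H1 H2].
  assert (E1 : fst (RtoC (2 * PI) * cavg f)%cx = 2 * PI * avg (fun th => fst (f th)))
    by (simpl; ring).
  assert (E2 : snd (RtoC (2 * PI) * cavg f)%cx = 2 * PI * avg (fun th => snd (f th)))
    by (simpl; ring).
  split; [rewrite E1 | rewrite E2].
  - exists (ex_RInt_Reals_0 _ _ _ (cont_ex_RInt _ 0 (2 * PI) H1)).
    rewrite <- RInt_Reals. symmetry; apply RInt_avg.
  - exists (ex_RInt_Reals_0 _ _ _ (cont_ex_RInt _ 0 (2 * PI) H2)).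
    rewrite <- RInt_Reals. symmetry; apply RInt_avg.
Qed.

Lemma Laurent_Cprod n : Laurent r n Cprod.
Proof.
  apply LaurentP_ext with (mono (fun _ => 1%Z)); [|now apply LaurentP_mono].
  intros zs _. induction zs as [|z zs IH]; [reflexivity|].
  change (Cprod (z :: zs)) with (z * Cprod zs)%cx. rewrite <- IH. simpl. ring.
Qed.

(** On the circle [dz = i z dth]: each integration contributes [2 pi i] and one factor [z],
    collected in [Cprod]. *)
Lemma iter_contour_tavg n F : Laurent r n F ->
  iter_contour r n F (Cpow (RtoC (2 * PI) * Ci)%cx n * tavg r n (fun zs => F zs * Cprod zs)%cx)%cx.
Proof.
  revert F. induction n as [|n IH]; intros F HF.
  - simpl. change (Cprod []) with C1. ring.
  - set (c := Cpow (RtoC (2 * PI) * Ci)%cx n).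
    exists (fun th => (c * tavg r n (fun zs => F (circ r th :: zs) * Cprod zs)%cx)%cx).
    split.
    + intros th. apply (IH (fun zs => F (circ r th :: zs))).
      apply Laurent_slice; [assumption | now apply Cmod_circ].
    + assert (HG : Laurent r (S n) (fun zs => F zs * Cprod zs)%cx).
      { apply Laurent_mul; [assumption | apply Laurent_Cprod]. }
      set (h := fun th => tavg r n (fun zs => F (circ r th :: zs) * Cprod (circ r th :: zs))%cx).
      assert (E : forall th, ((Ci * c) * h th)%cx =
        (c * tavg r n (fun zs => F (circ r th :: zs) * Cprod zs) * (Ci * circ r th))%cx).
      { intros th. unfold h.
        rewrite (tavg_ext n _ (fun zs => circ r th * (F (circ r th :: zs) * Cprod zs))%cx)
          by (intros; change (Cprod (circ r th :: zs)) with (circ r th * Cprod zs)%cx; ring).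
        rewrite tavg_scal; [ring|].
        apply Laurent_mul; [|apply Laurent_Cprod].
        apply Laurent_slice; [assumption | now apply Cmod_circ]. }
      unfold contour_int.
      replace (Cpow (RtoC (2 * PI) * Ci) (S n) * tavg r (S n) (fun zs => F zs * Cprod zs))%cx
        with (RtoC (2 * PI) * cavg (fun th => ((Ci * c) * h th)%cx))%cx.
      * rewrite (cavg_ext _ _ E). apply CRint_cavg.
        eapply ccont_ext; [exact E|]. apply ccont_scal. apply (tavg_ccont n _ HG).
      * rewrite cavg_scal by apply (tavg_ccont n _ HG). simpl. unfold h, c. ring.
Qed.

End Torus.

(** * Permutations *)

Lemma Csum_perm (l l' : list Cx) : Permutation l l' -> Csum l = Csum l'.
Proof.
  induction 1; rewrite ?Csum_cons; [reflexivity|congruence|ring|congruence].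
Qed.

Lemma Cprod_cons (z : Cx) (l : list Cx) : Cprod (z :: l) = (z * Cprod l)%cx.
Proof. reflexivity. Qed.

Lemma Cprod_perm (l l' : list Cx) : Permutation l l' -> Cprod l = Cprod l'.
Proof.
  induction 1; rewrite ?Cprod_cons; [reflexivity|congruence|ring|congruence].
Qed.

Lemma Cprod_app (l l' : list Cx) : Cprod (l ++ l') = (Cprod l * Cprod l')%cx.
Proof.
  induction l as [|z l IH]; simpl; [change (Cprod []) with C1; ring|].
  rewrite !Cprod_cons, IH. ring.
Qed.

Lemma insert_all_eq (x : nat) (l : list nat) :
  insert_all x l = map (fun p => firstn p l ++ x :: skipn p l) (seq 0 (S (length l))).
Proof.
  induction l as [|y l IH]; [reflexivity|].
  cbn [insert_all]. rewrite IH.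
  change (seq 0 (S (length (y :: l)))) with (O :: seq 1 (S (length l))).
  rewrite <- (seq_shift (S (length l)) 0). cbn [map]. f_equal.
  rewrite !map_map. apply map_ext. reflexivity.
Qed.

Lemma in_insert_all (x : nat) (l s : list nat) :
  In s (insert_all x l) <-> exists l1 l2, l = l1 ++ l2 /\ s = l1 ++ x :: l2.
Proof.
  rewrite insert_all_eq, in_map_iff. split.
  - intros (p & <- & _). exists (firstn p l), (skipn p l).
    now rewrite firstn_skipn.
  - intros (l1 & l2 & -> & ->). exists (length l1). split.
    + rewrite firstn_app, skipn_app, Nat.sub_diag, firstn_all, skipn_all. simpl.
      now rewrite app_nil_r.
    + apply in_seq. rewrite length_app. lia.
Qed.

Lemma in_perms (n : nat) (s : list nat) : In s (perms n) <-> Permutation s (seq 0 n).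
Proof.
  revert s. induction n as [|n IH]; intros s.
  - simpl. split.
    + intros [<-|[]]. constructor.
    + intros H. left. apply Permutation_sym, Permutation_nil in H. now symmetry.
  - cbn [perms]. rewrite in_flat_map, seq_S. simpl (0 + n)%nat. split.
    + intros (l & Hl & Hs). apply in_insert_all in Hs. destruct Hs as (l1 & l2 & -> & ->).
      apply IH in Hl. apply Permutation_sym.
      rewrite (Permutation_app_comm (seq 0 n) [n]). simpl. apply Permutation_cons_app.
      now apply Permutation_sym.
    + intros H. assert (Hn : In n s).
      { eapply Permutation_in; [apply Permutation_sym, H|]. apply in_or_app. right. now left. }
      apply in_split in Hn. destruct Hn as (l1 & l2 & ->).
      exists (l1 ++ l2). split.
      * apply IH. apply Permutation_app_inv with (a := n) (l3 := seq 0 n) (l4 := []) in H.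
        now rewrite app_nil_r in H.
      * apply in_insert_all. eauto.
Qed.

Lemma perms_lt (n : nat) (s : list nat) (i : nat) : In s (perms n) -> In i s -> (i < n)%nat.
Proof.
  intros Hs Hi. apply in_perms in Hs. apply (Permutation_in i Hs) in Hi.
  apply in_seq in Hi. lia.
Qed.

Lemma perms_length (n : nat) (s : list nat) : In s (perms n) -> length s = n.
Proof.
  intros Hs. apply in_perms, Permutation_length in Hs. now rewrite length_seq in Hs.
Qed.

Lemma perms_NoDup_elt (n : nat) (s : list nat) : In s (perms n) -> NoDup s.
Proof.
  intros Hs. apply in_perms in Hs. eapply Permutation_NoDup; [apply Permutation_sym, Hs|].
  apply seq_NoDup.
Qed.

(** The map [g] recovers from an element the block it comes from, so the blocks are disjoint. For
    [perms] it is the deletion of the inserted label. *)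
Lemma NoDup_flat_map_inv {A B : Type} (f : A -> list B) (g : B -> A) (l : list A) :
  NoDup l -> (forall a, In a l -> NoDup (f a)) ->
  (forall a b, In a l -> In b (f a) -> g b = a) -> NoDup (flat_map f l).
Proof.
  intros Hl. induction Hl as [|a l Ha Hl IH]; intros Hf Hg; simpl; [constructor|].
  apply NoDup_app.
  - apply Hf. now left.
  - apply IH; intros; [apply Hf | apply Hg]; try assumption; now right.
  - intros b Hb Hb'. apply in_flat_map in Hb'. destruct Hb' as (a' & Ha' & Hb').
    apply Ha. rewrite <- (Hg a b (or_introl eq_refl) Hb), (Hg a' b (or_intror Ha') Hb').
    exact Ha'.
Qed.

Lemma perms_NoDup (n : nat) : NoDup (perms n).
Proof.
  induction n as [|n IH]; [repeat constructor; intros []|].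
  cbn [perms]. apply NoDup_flat_map_inv with (g := remove Nat.eq_dec n).
  - exact IH.
  - intros l Hl. assert (Hn : ~ In n l) by (intros H; apply (perms_lt n l) in H; [lia|assumption]).
    clear Hl. induction l as [|y l IHl]; simpl; [repeat constructor; intros []|].
    constructor.
    + intros H. apply in_map_iff in H. destruct H as (s & E & _). injection E as E _.
      apply Hn. now left.
    + apply FinFun.Injective_map_NoDup; [intros ? ? E; now injection E|].
      apply IHl. intros H. apply Hn. now right.
  - intros l s Hl Hs. assert (Hn : ~ In n l) by (intros H; apply (perms_lt n l) in H; [lia|assumption]).
    apply in_insert_all in Hs. destruct Hs as (l1 & l2 & -> & ->).
    rewrite remove_app. simpl. destruct (Nat.eq_dec n n) as [_|]; [|congruence].
    rewrite <- remove_app. apply notin_remove. exact Hn.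
Qed.

Lemma sw_invol (k i : nat) : sw k (sw k i) = i.
Proof.
  revert i. induction k as [|k IH]; intros i.
  - destruct i as [|[|i]]; reflexivity.
  - destruct i; simpl; [reflexivity|]. now rewrite IH.
Qed.

Lemma sw_cases (k i : nat) :
  sw k i = if (i =? k)%nat then S k else if (i =? S k)%nat then k else i.
Proof.
  revert i. induction k as [|k IH]; intros i.
  - destruct i as [|[|i]]; reflexivity.
  - destruct i as [|i]; [reflexivity|].
    change (sw (S k) (S i)) with (S (sw k i)). rewrite IH.
    change (S i =? S k)%nat with (i =? k)%nat. change (S i =? S (S k))%nat with (i =? S k)%nat.
    destruct (i =? k)%nat, (i =? S k)%nat; reflexivity.
Qed.

Lemma sw_k (k : nat) : sw k k = S k.
Proof. now rewrite sw_cases, Nat.eqb_refl. Qed.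
Lemma sw_Sk (k : nat) : sw k (S k) = k.
Proof. rewrite <- (sw_k k) at 1. apply sw_invol. Qed.

Lemma sw_lt (k i n : nat) : (S k < n)%nat -> (i < n)%nat -> (sw k i < n)%nat.
Proof.
  intros H H'. rewrite sw_cases. destruct (Nat.eqb_spec i k), (Nat.eqb_spec i (S k)); lia.
Qed.

Lemma map_sw_perms (n k : nat) (s : list nat) : (S k < n)%nat ->
  In s (perms n) -> In (map (sw k) s) (perms n).
Proof.
  intros Hk Hs. pose proof (perms_NoDup_elt n s Hs) as Hd. apply in_perms.
  apply NoDup_Permutation.
  - apply FinFun.Injective_map_NoDup; [|assumption].
    intros a b E. now rewrite <- (sw_invol k a), E, sw_invol.
  - apply seq_NoDup.
  - intros i. split; intros H.
    + apply in_map_iff in H. destruct H as (j & <- & Hj). apply in_seq.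
      pose proof (perms_lt n s j Hs Hj). pose proof (sw_lt k j n). lia.
    + apply in_map_iff. exists (sw k i). split; [apply sw_invol|].
      apply in_perms in Hs. eapply Permutation_in; [apply Permutation_sym, Hs|].
      apply in_seq in H. apply in_seq. pose proof (sw_lt k i n). lia.
Qed.

(** Left multiplication by a transposition is an involution of the symmetric group; it reindexes the
    Bethe sum. *)
Lemma perms_sw_permutation (n k : nat) : (S k < n)%nat ->
  Permutation (map (map (sw k)) (perms n)) (perms n).
Proof.
  intros Hk.
  assert (Hinv : forall s, map (sw k) (map (sw k) s) = s).
  { intros s. rewrite map_map. erewrite map_ext; [apply map_id|]. apply sw_invol. }
  apply NoDup_Permutation.
  - apply FinFun.Injective_map_NoDup; [|apply perms_NoDup].
    intros a b E. now rewrite <- (Hinv a), E, Hinv.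
  - apply perms_NoDup.
  - intros s. split; intros H.
    + apply in_map_iff in H. destruct H as (s' & <- & H). now apply map_sw_perms.
    + apply in_map_iff. exists (map (sw k) s). split; [apply Hinv | now apply map_sw_perms].
Qed.

(** * Bethe wave functions *)

Definition zn (zs : list Cx) (a : nat) : Cx := nth a zs C0.
Definition pair_factor (q : R) (zs : list Cx) (a b : nat) : Cx :=
  if (b <? a)%nat then Sba q (zn zs a) (zn zs b) else C1.

Fixpoint Aprod (q : R) (s : list nat) (zs : list Cx) : Cx :=
  match s with
  | [] => C1
  | a :: s' => (Cprod (map (pair_factor q zs a) s') * Aprod q s' zs)%cx
  end.

Fixpoint wave (s : list nat) (X : conf) (zs : list Cx) : Cx :=
  match s, X with
  | a :: s', x :: X' => (Czpow (zn zs a) x * wave s' X' zs)%cx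
  | _, _ => C1
  end.

(** Only these two factors depend on the permutation: the powers [- y - 1] and the exponentials
    multiply to the same product for every one of them. *)
Definition psi (q : R) (n : nat) (X : conf) (zs : list Cx) : Cx :=
  Csum (map (fun s => Aprod q s zs * wave s X zs)%cx (perms n)).

Lemma Cprod_filter {A : Type} (f : A -> Cx) (c : A -> bool) (l : list A) :
  Cprod (map f (filter c l)) = Cprod (map (fun a => if c a then f a else C1) l).
Proof.
  induction l as [|a l IH]; [reflexivity|]. simpl. destruct (c a); simpl; rewrite !Cprod_cons, IH.
  - reflexivity.
  - ring.
Qed.

Lemma Cprod_flat_map {A : Type} (f : A -> list Cx) (l : list A) :
  Cprod (flat_map f l) = Cprod (map (fun a => Cprod (f a)) l).
Proof.
  induction l as [|a l IH]; [reflexivity|]. simpl. now rewrite Cprod_app, Cprod_cons, IH.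
Qed.

Lemma map_nth_seq {A : Type} (l : list A) (d : A) :
  map (fun j => nth j l d) (seq 0 (length l)) = l.
Proof.
  induction l as [|a l IH]; [reflexivity|].
  cbn [length]. change (seq 0 (S (length l))) with (O :: seq 1 (length l)).
  rewrite <- seq_shift. cbn [map]. rewrite map_map. f_equal. exact IH.
Qed.

(** Writing 1 for each pair of positions that is not an inversion turns the filtered product into a
    full square. The first row is then the product split off by [Aprod], and the first column is
    trivial. *)
Lemma A_sigma_Aprod (q : R) (s : list nat) (zs : list Cx) :
  A_sigma q (length s) s zs = Aprod q s zs.
Proof.
  set (h := fun (s : list nat) (i j : nat) =>
    if (i <? j)%nat && (nth j s O <? nth i s O)%nat
    then Sba q (zn zs (nth i s O)) (zn zs (nth j s O)) else C1).
  assert (E : A_sigma q (length s) s zs = Cprod (map (fun i =>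
    Cprod (map (h s i) (seq 0 (length s)))) (seq 0 (length s)))).
  { unfold A_sigma. rewrite Cprod_flat_map. f_equal. apply map_ext. intros i.
    rewrite Cprod_filter. reflexivity. }
  rewrite E. clear E. induction s as [|a s IH]; [reflexivity|].
  cbn [length]. change (seq 0 (S (length s))) with (O :: seq 1 (length s)).
  rewrite <- seq_shift. cbn [map]. rewrite Cprod_cons, !map_map. cbn [Aprod]. f_equal.
  - rewrite Cprod_cons. change (h (a :: s) O O) with C1.
    rewrite <- (map_nth_seq s O) at 2. rewrite map_map.
    rewrite (map_ext (fun j => h (a :: s) 0%nat (S j)) (fun j => pair_factor q zs a (nth j s O)))
      by reflexivity.
    ring.
  - rewrite <- IH. f_equal. apply map_ext. intros i.
    rewrite map_map, Cprod_cons. change (h (a :: s) (S i) O) with C1.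
    rewrite (map_ext (fun j => h (a :: s) (S i) (S j)) (h s i)) by reflexivity.
    ring.
Qed.

Lemma zn_swap (k : nat) (zs : list Cx) (a : nat) : (S k < length zs)%nat ->
  zn (swap k zs) a = zn zs (sw k a).
Proof. intros H. unfold zn. now apply nth_swap. Qed.

Lemma wave_swap (k : nat) (s : list nat) (X : conf) (zs : list Cx) : (S k < length zs)%nat ->
  wave s X (swap k zs) = wave (map (sw k) s) X zs.
Proof.
  intros H. revert X. induction s as [|a s IH]; intros [|x X]; simpl; try reflexivity.
  now rewrite zn_swap, IH.
Qed.

Lemma wave_insert (l1 l2 : list nat) (m : nat) (X1 X2 : conf) (x : Z) (zs : list Cx) :
  length l1 = length X1 ->
  wave (l1 ++ m :: l2) (X1 ++ x :: X2) zs = (Czpow (zn zs m) x * wave (l1 ++ l2) (X1 ++ X2) zs)%cx.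
Proof.
  revert X1. induction l1 as [|a l1 IH]; intros [|x1 X1] H; simpl in H; try lia.
  - reflexivity.
  - simpl. rewrite IH by lia. ring.
Qed.

(** A label placed after smaller ones forms no inversion with them, so [m] interacts only with the
    labels behind it. *)
Lemma Aprod_insert (q : R) (l1 l2 : list nat) (m : nat) (zs : list Cx) :
  (forall a, In a l1 -> (a < m)%nat) ->
  Aprod q (l1 ++ m :: l2) zs = (Cprod (map (pair_factor q zs m) l2) * Aprod q (l1 ++ l2) zs)%cx.
Proof.
  induction l1 as [|a l1 IH]; intros H; simpl.
  - reflexivity.
  - rewrite IH by (intros; apply H; now right).
    rewrite !map_app, !Cprod_app. cbn [map]. rewrite Cprod_cons.
    replace (pair_factor q zs a m) with C1; [ring|].
    unfold pair_factor. destruct (Nat.ltb_spec m a); [|reflexivity].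
    specialize (H a (or_introl eq_refl)). lia.
Qed.

(** * The scattering factor on the torus *)

Section Scattering.
Variables q r : R.
Hypothesis Hr0 : 0 < r.
Hypothesis Hr1 : Rabs q + Rabs (1 - q) * r < 1.

Definition den (zb za : Cx) : Cx := (za - RtoC q * zb - RtoC (1 - q) * (za * zb))%cx.

Lemma Sba_den (zb za : Cx) : Sba q zb za = (- (den za zb / den zb za))%cx.
Proof.
  unfold Sba, den. f_equal. f_equal. ring.
Qed.

(** Its modulus is at least [r (1 - |q| - |1 - q| r)], which is positive by [Hr1]. *)
Lemma den_neq0 (zb za : Cx) : Cmod zb = r -> Cmod za = r -> den zb za <> C0.
Proof.
  intros Hb Ha. apply Cmod_pos_neq. unfold den.
  eapply Rlt_le_trans; [|apply Cmod_sub_ge].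
  eapply Rlt_le_trans; [|apply Rplus_le_compat_r, Cmod_sub_ge].
  rewrite !Cmod_mul, !Cmod_RtoC, Ha, Hb. nra.
Qed.

Lemma Sba_inv (za zb : Cx) : Cmod zb = r -> Cmod za = r -> (Sba q zb za * Sba q za zb)%cx = C1.
Proof.
  intros Hb Ha. rewrite !Sba_den. field.
  split; now apply den_neq0.
Qed.

(** Because [den zb za = za zb (eps zb - q eps za)]. Stated without division, in the form in which
    the boundary condition uses it. *)
Lemma Sba_eps (za zb : Cx) : Cmod zb = r -> Cmod za = r ->
  (Sba q zb za * (eps zb - RtoC q * eps za))%cx = (- (eps za - RtoC q * eps zb))%cx.
Proof.
  intros Hb Ha. rewrite Sba_den. pose proof (den_neq0 zb za Hb Ha) as Hd.
  assert (za <> C0) by (apply Cmod_pos_neq; lra).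
  assert (zb <> C0) by (apply Cmod_pos_neq; lra).
  assert (E : RtoC (1 - q) = (C1 - RtoC q)%cx) by (apply Cx_ext; simpl; ring).
  unfold den in *. rewrite E in *. unfold eps. field.
  repeat split; assumption.
Qed.

(** Exchanging neighbouring labels changes the relative order of no pair other than those two
    labels. *)
Lemma pair_factor_swap (k a b : nat) (zs : list Cx) : (S k < length zs)%nat ->
  ~ (a = k /\ b = S k) -> ~ (a = S k /\ b = k) ->
  pair_factor q (swap k zs) a b = pair_factor q zs (sw k a) (sw k b).
Proof.
  intros Hl H1 H2. unfold pair_factor. rewrite !zn_swap by assumption.
  replace (sw k b <? sw k a)%nat with (b <? a)%nat; [reflexivity|].
  rewrite !sw_cases.
  destruct (Nat.eqb_spec a k), (Nat.eqb_spec a (S k)), (Nat.eqb_spec b k), (Nat.eqb_spec b (S k));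
    subst; try lia; repeat (match goal with |- context [(?u <? ?v)%nat] => destruct (Nat.ltb_spec u v) end);
    try lia; reflexivity.
Qed.

(** The exchange creates or destroys the inversion of this pair. Since [S_ba S_ab = 1], both cases
    amount to the same factor. *)
Lemma pair_factor_swap_k (k a b n : nat) (zs : list Cx) : torus r n zs -> (S k < n)%nat ->
  (a = k /\ b = S k) \/ (a = S k /\ b = k) ->
  pair_factor q (swap k zs) a b = (pair_factor q zs (sw k a) (sw k b) * Sba q (zn zs k) (zn zs (S k)))%cx.
Proof.
  intros Hz Hk Hab. unfold pair_factor. rewrite !zn_swap by (destruct Hz; lia).
  destruct Hab as [[-> ->]|[-> ->]]; rewrite !sw_k, !sw_Sk.
  - replace (S k <? k)%nat with false by (symmetry; apply Nat.ltb_ge; lia).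
    replace (k <? S k)%nat with true by (symmetry; apply Nat.ltb_lt; lia).
    symmetry. apply Sba_inv; apply (torus_nth r n); auto; lia.
  - replace (S k <? k)%nat with false by (symmetry; apply Nat.ltb_ge; lia).
    replace (k <? S k)%nat with true by (symmetry; apply Nat.ltb_lt; lia).
    cbv iota. ring.
Qed.

Lemma row_swap_other (k a n : nat) (zs : list Cx) (s : list nat) : torus r n zs -> (S k < n)%nat ->
  (forall b, In b s -> ~ (a = k /\ b = S k) /\ ~ (a = S k /\ b = k)) ->
  Cprod (map (pair_factor q (swap k zs) a) s) = Cprod (map (pair_factor q zs (sw k a)) (map (sw k) s)).
Proof.
  intros Hz Hk H. rewrite map_map. f_equal. apply map_ext_in. intros b Hb.
  destruct (H b Hb). apply pair_factor_swap; try assumption. destruct Hz; lia.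
Qed.

Lemma row_swap (k a c n : nat) (zs : list Cx) (s : list nat) : torus r n zs -> (S k < n)%nat ->
  (a = k /\ c = S k) \/ (a = S k /\ c = k) -> NoDup s -> In c s ->
  Cprod (map (pair_factor q (swap k zs) a) s) =
  (Cprod (map (pair_factor q zs (sw k a)) (map (sw k) s)) * Sba q (zn zs k) (zn zs (S k)))%cx.
Proof.
  intros Hz Hk Hac Hd Hc. apply in_split in Hc. destruct Hc as (l1 & l2 & ->).
  apply NoDup_remove_2 in Hd.
  rewrite !map_app. cbn [map]. rewrite !Cprod_app, !Cprod_cons.
  rewrite (pair_factor_swap_k k a c n) by assumption.
  rewrite !(row_swap_other k a n); try assumption; [ring| |];
    intros b Hb; assert (b <> c) by (intros ->; apply Hd, in_or_app; tauto); lia.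
Qed.

Lemma Aprod_swap_other (k n : nat) (zs : list Cx) (s : list nat) : torus r n zs -> (S k < n)%nat ->
  ~ In k s \/ ~ In (S k) s ->
  Aprod q s (swap k zs) = Aprod q (map (sw k) s) zs.
Proof.
  intros Hz Hk H. induction s as [|a s IH]; simpl; [reflexivity|].
  simpl in H. rewrite IH by tauto. f_equal. apply row_swap_other with n; try assumption.
  intros b Hb. split; intros [-> ->]; tauto.
Qed.

(** The pair of labels [k], [S k] occurs exactly once, in the row of whichever comes first, so the
    extra factor is gained exactly once and is the same for all permutations. *)
Lemma Aprod_swap (k n : nat) (zs : list Cx) (s : list nat) : torus r n zs -> (S k < n)%nat ->
  NoDup s -> In k s -> In (S k) s ->
  Aprod q s (swap k zs) = (Aprod q (map (sw k) s) zs * Sba q (zn zs k) (zn zs (S k)))%cx.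
Proof.
  intros Hz Hk Hd. induction Hd as [|a s Ha Hd IH]; intros H1 H2; [destruct H1|].
  cbn [Aprod map]. destruct (Nat.eq_dec a k) as [->|Hak].
  - destruct H2 as [H2|H2]; [lia|].
    rewrite (row_swap k k (S k) n), (Aprod_swap_other k n) by (tauto || assumption). ring.
  - destruct (Nat.eq_dec a (S k)) as [->|HaSk].
    + destruct H1 as [H1|H1]; [lia|].
      rewrite (row_swap k (S k) k n), (Aprod_swap_other k n) by (tauto || assumption). ring.
    + destruct H1 as [H1|H1]; [lia|]. destruct H2 as [H2|H2]; [lia|].
      rewrite IH, (row_swap_other k a n) by (tauto || (intros; lia) || assumption). ring.
Qed.

Lemma psi_swap (n k : nat) (X : conf) (zs : list Cx) : torus r n zs -> (S k < n)%nat ->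
  psi q n X (swap k zs) = (Sba q (zn zs k) (zn zs (S k)) * psi q n X zs)%cx.
Proof.
  intros Hz Hk. unfold psi. rewrite <- Csum_map_mul.
  rewrite (map_ext_in _ (fun s => Sba q (zn zs k) (zn zs (S k)) *
     (Aprod q (map (sw k) s) zs * wave (map (sw k) s) X zs))%cx).
  - rewrite <- (map_map (map (sw k)) (fun s => Sba q (zn zs k) (zn zs (S k)) *
     (Aprod q s zs * wave s X zs))%cx).
    apply Csum_perm, Permutation_map, perms_sw_permutation. assumption.
  - intros s Hs. rewrite wave_swap by (destruct Hz; lia).
    assert (Hin : forall i, (i < n)%nat -> In i s).
    { intros i Hi. apply in_perms in Hs. eapply Permutation_in; [apply Permutation_sym, Hs|].
      apply in_seq. lia. }
    rewrite (Aprod_swap k n); [ring|assumption|assumption| | |].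
    + eapply perms_NoDup_elt; eassumption.
    + apply Hin. lia.
    + apply Hin. lia.
Qed.

(** The Horner sums [gs m] stay in the class because [P] is closed under addition, and they miss the
    inverse by [w ^ m / (1 - w)]. *)
Lemma LaurentP_geom (P : (nat -> Z) -> Prop) n w rho :
  P (fun _ => 0%Z) -> (forall e f, P e -> P f -> P (fun i => (e i + f i)%Z)) ->
  0 <= rho < 1 -> LaurentP r P n w -> (forall zs, torus r n zs -> Cmod (w zs) <= rho) ->
  LaurentP r P n (fun zs => Cinv (C1 - w zs)%cx).
Proof.
  intros HP0 HPa Hrho Hw Hb.
  set (gs := fix gs m zs := match m with O => C0 | S m' => (C1 + w zs * gs m' zs)%cx end).
  assert (Hg : forall m, LaurentP r P n (gs m)).
  { induction m as [|m IH]; simpl; [now apply LaurentP_const|].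
    apply (LaurentP_add r P n (fun _ => C1) (fun zs => w zs * gs m zs)%cx); [now apply LaurentP_const|].
    now apply (LaurentP_mul r Hr0 P P). }
  assert (Hd : forall zs, torus r n zs -> 1 - rho <= Cmod (C1 - w zs)%cx).
  { intros zs Hz. eapply Rle_trans; [|apply Cmod_sub_ge]. rewrite Cmod_C1.
    specialize (Hb zs Hz). lra. }
  apply LaurentP_lim. intros e He.
  (* The factor [1 - rho] compensates the division by [|1 - w| >= 1 - rho]. *)
  destruct (pow_lt_1_zero rho) with (y := e * (1 - rho)) as (m & Hm).
  { rewrite Rabs_pos_eq; lra. }
  { apply Rmult_lt_0_compat; lra. }
  exists (gs m). split; [apply Hg|]. intros zs Hz.
  assert (Hne : (C1 - w zs)%cx <> C0) by (apply Cmod_pos_neq; specialize (Hd zs Hz); lra).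
  assert (E : (Cinv (C1 - w zs) - gs m zs)%cx = (Cpow (w zs) m * Cinv (C1 - w zs))%cx).
  { clear Hm. induction m as [|m IH]; simpl; [ring|].
    replace (w zs * Cpow (w zs) m * Cinv (C1 - w zs))%cx
      with (w zs * (Cpow (w zs) m * Cinv (C1 - w zs)))%cx by ring.
    rewrite <- IH. field. exact Hne. }
  rewrite E, Cmod_mul, Cmod_Cpow, Cmod_Cinv by assumption.
  specialize (Hm m (le_n m)). specialize (Hd zs Hz). specialize (Hb zs Hz).
  rewrite Rabs_pos_eq in Hm by (apply pow_le; lra).
  assert (H1 : Cmod (w zs) ^ m <= e * (1 - rho)).
  { apply Rle_trans with (rho ^ m); [|lra]. apply pow_incr. split; [apply Cmod_ge_0 | assumption]. }
  apply Rmult_le_reg_r with (Cmod (C1 - w zs)%cx); [lra|].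
  rewrite Rmult_assoc, Rinv_l by lra. nra.
Qed.

(** The exponents in the expansion of [S] with upper index [a] and lower index [b]: power series in
    [z_a] and in [1 / z_b]. *)
Definition cone (a b : nat) (e : nat -> Z) : Prop :=
  (0 <= e a)%Z /\ (e b <= 0)%Z /\ forall i, i <> a -> i <> b -> e i = 0%Z.

Lemma cone_zero a b : cone a b (fun _ => 0%Z).
Proof. repeat split; lia. Qed.

Lemma cone_add a b e f : cone a b e -> cone a b f -> cone a b (fun i => (e i + f i)%Z).
Proof.
  intros (H1 & H2 & H3) (H4 & H5 & H6). repeat split; try lia.
  intros i Ha Hb. rewrite H3, H6 by assumption. reflexivity.
Qed.

Lemma Czpow_1 (z : Cx) : Czpow z 1 = z.
Proof. simpl. ring. Qed.
Lemma Czpow_m1 (z : Cx) : Czpow z (-1) = Cinv z.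
Proof. simpl. f_equal. ring. Qed.

(* With [u = q / z_b + (1 - q)], the denominator of [S] is [z_b (1 - z_a u)], and
   [|z_a u| < 1] on the torus, so that [S] expands in a geometric series. *)
Lemma Sba_decomp n a b : (a < n)%nat -> (b < n)%nat -> a <> b ->
  exists T, LaurentP r (cone a b) n T /\
    forall zs, torus r n zs -> Sba q (zn zs a) (zn zs b) = (RtoC q + zn zs a * T zs)%cx.
Proof.
  intros Ha Hb Hab.
  set (u := fun zs : list Cx => (RtoC q * Cinv (zn zs b) + RtoC (1 - q))%cx).
  set (w := fun zs : list Cx => (zn zs a * u zs)%cx).
  assert (Hz1 : LaurentP r (cone a b) n (fun zs => zn zs a)).
  { apply LaurentP_ext with (fun zs => Czpow (nth a zs C0) 1).
    - intros. apply Czpow_1.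
    - apply LaurentP_var; [assumption|]. unfold cone, unit_expo. rewrite Nat.eqb_refl.
      repeat split; try lia.
      + destruct (Nat.eqb_spec b a); lia.
      + intros i H _. destruct (Nat.eqb_spec i a); [contradiction|reflexivity]. }
  assert (Hz2 : LaurentP r (cone a b) n (fun zs => Cinv (zn zs b))).
  { apply LaurentP_ext with (fun zs => Czpow (nth b zs C0) (-1)).
    - intros. apply Czpow_m1.
    - apply LaurentP_var; [assumption|]. unfold cone, unit_expo. rewrite Nat.eqb_refl.
      repeat split; try lia.
      + destruct (Nat.eqb_spec a b); lia.
      + intros i _ H. destruct (Nat.eqb_spec i b); [contradiction|reflexivity]. }
  assert (Hc : forall c, LaurentP r (cone a b) n (fun _ => c)) by (intros; apply LaurentP_const, cone_zero).
  assert (Hmul : forall F G, LaurentP r (cone a b) n F -> LaurentP r (cone a b) n G ->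
    LaurentP r (cone a b) n (fun zs => F zs * G zs)%cx).
  { intros F G. apply LaurentP_mul; [exact Hr0|]. apply cone_add. }
  assert (Hu : LaurentP r (cone a b) n u).
  { apply (LaurentP_add r (cone a b) n (fun zs => RtoC q * Cinv (zn zs b))%cx (fun _ => RtoC (1 - q))).
    - now apply (Hmul (fun _ => RtoC q)).
    - apply Hc. }
  assert (Hw : LaurentP r (cone a b) n w) by now apply Hmul.
  assert (Hmod : forall zs, torus r n zs -> Cmod (w zs) <= Rabs q + Rabs (1 - q) * r).
  { intros zs Hz. unfold w, u. rewrite Cmod_mul.
    assert (E1 : Cmod (zn zs a) = r) by (apply (torus_nth r n); assumption).
    assert (E2 : Cmod (zn zs b) = r) by (apply (torus_nth r n); assumption).
    rewrite E1. apply Rle_trans with (r * (Rabs q * / r + Rabs (1 - q))).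
    - apply Rmult_le_compat_l; [lra|]. eapply Rle_trans; [apply Cmod_add_le|].
      rewrite Cmod_mul, !Cmod_RtoC, Cmod_Cinv, E2 by (apply Cmod_pos_neq; lra). lra.
    - right. field. lra. }
  (* This is [(S - q) / z_a]. At [z_a = 0] the numerator of [S] is [q] times its denominator; the
     rest of the numerator is divisible by [z_a], and dividing both by [z_b] leaves only powers of
     [1 / z_b]. *)
  exists (fun zs => ((- C1) * Cinv (zn zs b) + RtoC (1 - q) + RtoC q * u zs) * Cinv (C1 - w zs))%cx.
  split.
  - apply (Hmul (fun zs => (- C1) * Cinv (zn zs b) + RtoC (1 - q) + RtoC q * u zs)%cx).
    + apply (LaurentP_add r (cone a b) n (fun zs => (- C1) * Cinv (zn zs b) + RtoC (1 - q))%cx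
        (fun zs => RtoC q * u zs)%cx).
      * apply (LaurentP_add r (cone a b) n (fun zs => (- C1) * Cinv (zn zs b))%cx); [|apply Hc].
        now apply (Hmul (fun _ => (- C1)%cx)).
      * now apply (Hmul (fun _ => RtoC q)).
    + apply LaurentP_geom with (Rabs q + Rabs (1 - q) * r); try assumption.
      * apply cone_zero.
      * apply cone_add.
      * pose proof (Rabs_pos q). pose proof (Rabs_pos (1 - q)). nra.
  - intros zs Hz.
    assert (E1 : Cmod (zn zs a) = r) by (apply (torus_nth r n); assumption).
    assert (E2 : Cmod (zn zs b) = r) by (apply (torus_nth r n); assumption).
    rewrite Sba_den. pose proof (den_neq0 _ _ E1 E2) as Hd.
    assert (Hb0 : zn zs b <> C0) by (apply Cmod_pos_neq; lra).
    assert (E : (C1 - w zs)%cx = (den (zn zs a) (zn zs b) * Cinv (zn zs b))%cx).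
    { unfold w, u, den. field. exact Hb0. }
    rewrite E. unfold u. remember (den (zn zs a) (zn zs b)) as d eqn:Ed.
    assert (E' : den (zn zs b) (zn zs a) =
      (- (RtoC q * d) - zn zs a * ((- C1) + RtoC (1 - q) * zn zs b
         + RtoC q * (RtoC q + RtoC (1 - q) * zn zs b)))%cx).
    { rewrite Ed. unfold den.
      assert (Eq : RtoC (1 - q) = (C1 - RtoC q)%cx) by (apply Cx_ext; simpl; ring).
      rewrite Eq. ring. }
    rewrite E'. field. split; assumption.
Qed.

Lemma LaurentP_Sba n a b : (a < n)%nat -> (b < n)%nat -> a <> b ->
  LaurentP r (cone a b) n (fun zs => Sba q (zn zs a) (zn zs b)).
Proof.
  intros Ha Hb Hab. destruct (Sba_decomp n a b Ha Hb Hab) as (T & HT & E).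
  apply LaurentP_ext with (fun zs => RtoC q + zn zs a * T zs)%cx.
  { intros. symmetry. now apply E. }
  apply (LaurentP_add r (cone a b) n (fun _ => RtoC q)).
  - apply LaurentP_const, cone_zero.
  - apply (LaurentP_mul r Hr0 (cone a b) (cone a b)); [apply cone_add| |assumption].
    apply LaurentP_ext with (fun zs => Czpow (nth a zs C0) 1).
    + intros. apply Czpow_1.
    + apply LaurentP_var; [assumption|]. unfold cone, unit_expo. rewrite Nat.eqb_refl.
      repeat split; try lia.
      * destruct (Nat.eqb_spec b a); lia.
      * intros i H _. destruct (Nat.eqb_spec i a); [contradiction|reflexivity].
Qed.

(** Expresses by exponents that [S] takes the value [q] at [z_a = 0]. *)
Lemma LaurentP_Sba_sub n a b : (a < n)%nat -> (b < n)%nat -> a <> b ->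
  LaurentP r (fun e => 1 <= e a)%Z n (fun zs => Sba q (zn zs a) (zn zs b) - RtoC q)%cx.
Proof.
  intros Ha Hb Hab. destruct (Sba_decomp n a b Ha Hb Hab) as (T & HT & E).
  apply LaurentP_ext with (fun zs => Czpow (nth a zs C0) 1 * T zs)%cx.
  { intros zs Hz. rewrite E, Czpow_1 by assumption. unfold zn. ring. }
  apply (LaurentP_mul r Hr0 (fun e => e a = 1%Z) (cone a b)); [|apply LaurentP_var; [assumption|]|assumption].
  - intros e f He (Hf & _). lia.
  - unfold unit_expo. now rewrite Nat.eqb_refl.
Qed.

End Scattering.

(** * Ordered configurations *)

(** The order of [in_S] between arbitrary indices and without the particle number, so that it passes
    to tails and initial segments. *)
Definition desc (X : conf) : Prop :=
  forall i j, (i <= j < length X)%nat -> (nth j X 0 <= nth i X 0)%Z.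

Lemma in_S_desc (n : nat) (X : conf) : in_S n X <-> length X = n /\ desc X.
Proof.
  split; intros [Hl H]; (split; [exact Hl|]).
  - intros i j [Hij Hj]. induction Hij as [|j Hij IH]; [lia|].
    specialize (H j ltac:(lia)). specialize (IH ltac:(lia)). lia.
  - intros i Hi. apply H. lia.
Qed.

Lemma desc_tail (a : Z) (X : conf) : desc (a :: X) -> desc X.
Proof. intros H i j Hij. apply (H (S i) (S j)). simpl. lia. Qed.

Lemma desc_head (a : Z) (X : conf) (x : Z) : desc (a :: X) -> In x X -> (x <= a)%Z.
Proof.
  intros H Hx. apply In_nth with (d := 0%Z) in Hx. destruct Hx as (j & Hj & <-).
  apply (H O (S j)). simpl; lia.
Qed.

Lemma desc_app_l (X X' : conf) : desc (X ++ X') -> desc X.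
Proof.
  intros H i j Hij. specialize (H i j). rewrite !app_nth1, length_app in H by lia. lia.
Qed.

Lemma desc_snoc (X : conf) (x a : Z) : desc (X ++ [x]) -> In a (X ++ [x]) -> (x <= a)%Z.
Proof.
  intros H Ha. apply In_nth with (d := 0%Z) in Ha. destruct Ha as (j & Hj & <-).
  specialize (H j (length X)). rewrite nth_middle, length_app in *. simpl in *. lia.
Qed.

Lemma eta_cons_eq (a : Z) (X : conf) : eta (a :: X) a = S (eta X a).
Proof. unfold eta. now rewrite count_occ_cons_eq. Qed.

Lemma eta_cons_neq (a x : Z) (X : conf) : a <> x -> eta (a :: X) x = eta X x.
Proof. intros H. unfold eta. now rewrite count_occ_cons_neq. Qed.

Lemma qint_S (q : R) (k : nat) : qint q (S k) = qint q k + q ^ k.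
Proof.
  unfold qint. rewrite seq_S, map_app, fold_right_app. simpl. rewrite Rplus_0_r.
  generalize (q ^ k). intros c. induction (map _ (seq 0 k)) as [|b l IH]; simpl; [ring|].
  rewrite IH. ring.
Qed.

(** The recursion from the low end: it matches a new first particle of a site, after which all the
    others carry one more factor [q]. *)
Lemma qint_S' (q : R) (k : nat) : qint q (S k) = 1 + q * qint q k.
Proof.
  induction k as [|k IH].
  - unfold qint; simpl; ring.
  - rewrite qint_S, IH at 1. rewrite (qint_S q k). simpl. ring.
Qed.

Lemma qfact_S (q : R) (k : nat) : qfact q (S k) = qint q (S k) * qfact q k.
Proof.
  unfold qfact. rewrite seq_S, map_app, fold_right_app. simpl (1 + k)%nat. simpl map at 1.
  simpl fold_right at 2. rewrite Rmult_1_r.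
  generalize (qint q (S k)). intros c. induction (map _ (seq 1 k)) as [|b l IH]; simpl; [ring|].
  rewrite IH. ring.
Qed.

(** From [(1 - q) [k]_q = 1 - q^k], which gives positivity for negative [q] as well. *)
Lemma qint_pos (q : R) (k : nat) : Rabs q < 1 -> 0 < qint q (S k).
Proof.
  intros Hq. assert (E : (1 - q) * qint q (S k) = 1 - q ^ S k).
  { induction k as [|k IH].
    - unfold qint; simpl; ring.
    - rewrite qint_S, Rmult_plus_distr_l, IH. simpl. ring. }
  assert (H1 : q < 1) by (apply Rabs_def2 in Hq; lra).
  assert (H2 : q ^ S k < 1).
  { eapply Rle_lt_trans; [apply Rle_abs|]. rewrite <- RPow_abs.
    apply pow_lt_1_compat; [|lia]. split; [apply Rabs_pos | assumption]. }
  apply Rmult_lt_reg_l with (1 - q); lra.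
Qed.

Lemma qfact_pos (q : R) (k : nat) : Rabs q < 1 -> 0 < qfact q k.
Proof.
  intros Hq. induction k as [|k IH].
  - unfold qfact; simpl; lra.
  - rewrite qfact_S. apply Rmult_lt_0_compat; [now apply qint_pos | assumption].
Qed.

(** Index 0 is always a top. A particle added in front can only change the status of the former
    index 0, and every other top is shifted by one. *)
Definition rtops (X : conf) : list nat := filter (is_top X) (seq 1 (length X - 1)).

Lemma tops_rtops (b : Z) (X : conf) : tops (b :: X) = O :: rtops (b :: X).
Proof.
  unfold tops, rtops. cbn [length]. replace (S (length X) - 1)%nat with (length X) by lia. reflexivity.
Qed.

Lemma filter_map_S (f g : nat -> bool) (l : list nat) :
  (forall j, In j l -> f (S j) = g j) -> filter f (map S l) = map S (filter g l).
Proof.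
  induction l as [|j l IH]; intros H; [reflexivity|].
  cbn [map filter]. rewrite H by now left. rewrite IH by (intros; apply H; now right).
  destruct (g j); reflexivity.
Qed.

Lemma rtops_cons (a b : Z) (X : conf) :
  rtops (a :: b :: X) =
    (if Z.eq_dec a b then [] else [1%nat]) ++ map S (rtops (b :: X)).
Proof.
  unfold rtops. cbn [length]. rewrite !Nat.sub_succ, !Nat.sub_0_r.
  change (seq 1 (S (length X))) with (1%nat :: seq 2 (length X)).
  rewrite <- seq_shift. cbn [filter].
  rewrite (filter_map_S _ (is_top (b :: X))).
  - change (is_top (a :: b :: X) 1) with (if Z.eq_dec a b then false else true).
    destruct (Z.eq_dec a b); reflexivity.
  - intros j Hj. apply in_seq in Hj. destruct j; [lia|]. reflexivity.
Qed.

(** The other tops sit strictly to the left of the first site, so a particle added in front leaves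
    their occupation numbers unchanged. *)
Lemma rtops_lt (b : Z) (X : conf) (j : nat) : desc (b :: X) -> In j (rtops (b :: X)) ->
  (j < length (b :: X))%nat /\ (nth j (b :: X) 0 < b)%Z.
Proof.
  intros H Hj. unfold rtops in Hj. apply filter_In in Hj. destruct Hj as [H1 H2].
  apply in_seq in H1. destruct j as [|j]; [lia|].
  cbn [is_top] in H2. destruct (Z.eq_dec _ _) as [|Hne] in H2; [discriminate|].
  split; [lia|].
  pose proof (H j (S j) ltac:(lia)). pose proof (H O j ltac:(lia)).
  change (nth 0 (b :: X) 0%Z) with b in *. lia.
Qed.

Lemma tops_in (X : conf) (j : nat) : In j (tops X) -> (j < length X)%nat.
Proof. intros H. unfold tops in H. apply filter_In in H. destruct H as [H _]. apply in_seq in H. lia. Qed.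

(** The inverse of [W]; division is postponed until the limit is taken. *)
Definition site_qfact (q : R) (X : conf) : R :=
  fold_right Rmult 1 (map (fun j => qfact q (eta X (nth j X 0%Z))) (tops X)).

Lemma site_qfact_pos (q : R) (X : conf) : Rabs q < 1 -> 0 < site_qfact q X.
Proof.
  intros Hq. unfold site_qfact. induction (tops X) as [|j l IH]; simpl; [lra|].
  apply Rmult_lt_0_compat; [now apply qfact_pos | assumption].
Qed.

Lemma site_qfact_cons (q : R) (a : Z) (X : conf) : desc (a :: X) ->
  site_qfact q (a :: X) = qint q (S (eta X a)) * site_qfact q X.
Proof.
  intros H. destruct X as [|b X].
  - unfold site_qfact, tops, eta; cbn -[qint qfact].
    destruct (Z.eq_dec a a); [|congruence]. rewrite qfact_S. unfold qfact; simpl. ring.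
  - unfold site_qfact.
    set (f := fun j => qfact q (eta (a :: b :: X) (nth j (a :: b :: X) 0%Z))).
    set (g := fun j => qfact q (eta (b :: X) (nth j (b :: X) 0%Z))).
    rewrite !tops_rtops, rtops_cons. cbn [map fold_right].
    assert (E0 : f O = qint q (S (eta (b :: X) a)) * qfact q (eta (b :: X) a)).
    { unfold f. cbn [nth]. now rewrite eta_cons_eq, qfact_S. }
    rewrite E0.
    assert (E1 : g O = qfact q (eta (b :: X) b)) by reflexivity.
    rewrite E1.
    assert (E : fold_right Rmult 1 (map f (map S (rtops (b :: X)))) =
                fold_right Rmult 1 (map g (rtops (b :: X)))).
    { rewrite map_map. f_equal. apply map_ext_in. intros j Hj. unfold f, g.
      change (nth (S j) (a :: b :: X) 0%Z) with (nth j (b :: X) 0%Z).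
      destruct (rtops_lt b X j (desc_tail _ _ H) Hj) as [Hj1 Hj2].
      pose proof (desc_head a (b :: X) b H (or_introl eq_refl)).
      rewrite eta_cons_neq by lia. reflexivity. }
    destruct (Z.eq_dec a b) as [->|Hab].
    + rewrite app_nil_l, E. ring.
    + cbn [app map fold_right]. rewrite E.
      assert (Eb : f 1%nat = qfact q (eta (b :: X) b)).
      { unfold f. cbn [nth]. rewrite (eta_cons_neq a b) by assumption. reflexivity. }
      assert (Ea : eta (b :: X) a = O).
      { unfold eta. apply count_occ_not_In. intros Hin.
        pose proof (desc_head a (b :: X) b H (or_introl eq_refl)).
        destruct Hin as [->|Hin]; [lia|].
        pose proof (desc_head b X a (desc_tail _ _ H) Hin). lia. }
      rewrite Eb, Ea. unfold qfact at 1; simpl. ring.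
Qed.

(** The initial condition removes the left-most particle, while [tops] is recursive at the
    right-most one. If both share a site, the two q-integers merely exchange their roles. *)
Lemma site_qfact_snoc (q : R) (X : conf) (x : Z) : desc (X ++ [x]) ->
  site_qfact q (X ++ [x]) = qint q (S (eta X x)) * site_qfact q X.
Proof.
  induction X as [|a X IH]; intros H.
  - apply site_qfact_cons. exact H.
  - change ((a :: X) ++ [x]) with (a :: (X ++ [x])) in *.
    rewrite site_qfact_cons by assumption. rewrite IH by now apply desc_tail in H.
    rewrite (site_qfact_cons q a X) by now apply desc_app_l with (X' := [x]).
    assert (E : eta (X ++ [x]) a = (eta X a + eta [x] a)%nat) by apply count_occ_app.
    rewrite E. destruct (Z.eq_dec a x) as [->|Hax].
    + rewrite !eta_cons_eq. change (eta [] x) with O.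
      replace (S (eta X x + 1)) with (S (S (eta X x))) by lia. ring.
    + rewrite !eta_cons_neq by congruence. change (eta [] a) with O.
      rewrite Nat.add_0_r. ring.
Qed.

(** Within a site the [c]'s form a geometric progression of ratio [q], whose sum is [[m]_q] times
    the term of the top. Here [c j] will be an average containing the factor [eps z_j]. *)
Lemma tops_rate_sum (q : R) (Y : conf) (c : nat -> Cx) : desc Y ->
  (forall k, (S k < length Y)%nat -> nth k Y 0%Z = nth (S k) Y 0%Z -> c (S k) = (RtoC q * c k)%cx) ->
  Csum (map (fun j => RtoC (rate q Y j) * c j)%cx (tops Y)) = Csum (map c (seq 0 (length Y))).
Proof.
  revert c. induction Y as [|a Y IH]; intros c H Hc; [reflexivity|].
  cbn [length]. change (seq 0 (S (length Y))) with (O :: seq 1 (length Y)).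
  rewrite <- seq_shift. cbn [map]. rewrite map_map, Csum_cons.
  specialize (IH (fun j => c (S j)) (desc_tail _ _ H)).
  rewrite <- IH by (intros k Hk E; apply Hc; [simpl; lia | exact E]). clear IH.
  destruct Y as [|b Y].
  - unfold tops, rate, eta; cbn -[qint]. destruct (Z.eq_dec a a); [|congruence].
    rewrite !Csum_cons. unfold qint; simpl. replace (RtoC (1 + 0)) with C1 by (apply Cx_ext; simpl; ring).
    ring.
  - rewrite !tops_rtops, rtops_cons. cbn [map]. rewrite !Csum_cons.
    assert (E : Csum (map (fun j => RtoC (rate q (a :: b :: Y) j) * c j)%cx (map S (rtops (b :: Y)))) =
                Csum (map (fun j => RtoC (rate q (b :: Y) j) * c (S j))%cx (rtops (b :: Y)))).
    { rewrite map_map. f_equal. apply map_ext_in. intros j Hj. unfold rate.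
      change (nth (S j) (a :: b :: Y) 0%Z) with (nth j (b :: Y) 0%Z).
      destruct (rtops_lt b Y j (desc_tail _ _ H) Hj) as [Hj1 Hj2].
      pose proof (desc_head a (b :: Y) b H (or_introl eq_refl)).
      rewrite eta_cons_neq by lia. reflexivity. }
    assert (E0 : rate q (a :: b :: Y) 0 = 1 + q * qint q (eta (b :: Y) a)).
    { unfold rate. cbn [nth]. now rewrite eta_cons_eq, qint_S'. }
    assert (E1 : rate q (b :: Y) 0 = qint q (eta (b :: Y) b)) by reflexivity.
    rewrite E0, E1.
    assert (Er : forall u v : R, RtoC (u + v) = (RtoC u + RtoC v)%cx)
      by (intros; apply Cx_ext; simpl; ring).
    assert (Em : forall u v : R, RtoC (u * v) = (RtoC u * RtoC v)%cx)
      by (intros; apply Cx_ext; simpl; ring).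
    rewrite Er, Em. change (RtoC 1) with C1.
    destruct (Z.eq_dec a b) as [->|Hab].
    (* The new rate is [1 + q [m]_q], and [q c_0 = c_1] turns its second part into the former
       contribution of the site. *)
    + rewrite app_nil_l, E. rewrite (Hc O) by (simpl; lia || reflexivity). ring.
    + cbn [app map]. rewrite Csum_cons, E.
      assert (Ea : eta (b :: Y) a = O).
      { unfold eta. apply count_occ_not_In. intros Hin.
        pose proof (desc_head a (b :: Y) b H (or_introl eq_refl)).
        destruct Hin as [->|Hin]; [lia|].
        pose proof (desc_head b Y a (desc_tail _ _ H) Hin). lia. }
      assert (E2 : rate q (a :: b :: Y) 1 = qint q (eta (b :: Y) b)).
      { unfold rate. cbn [nth]. now rewrite (eta_cons_neq a b). }
      rewrite Ea, E2.
      change (qint q 0) with 0. change (RtoC 0) with C0. ring.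
Qed.

Lemma length_jump (Y : conf) (j : nat) : (j < length Y)%nat -> length (jump Y j) = length Y.
Proof.
  intros Hl. unfold jump. rewrite length_app. cbn [length].
  rewrite length_firstn, length_skipn. lia.
Qed.

Lemma nth_jump (Y : conf) (i j : nat) : (j < length Y)%nat ->
  nth i (jump Y j) 0%Z = if (i =? j)%nat then (nth j Y 0 + 1)%Z else nth i Y 0%Z.
Proof.
  intros Hl. unfold jump. destruct (Nat.eqb_spec i j) as [->|Hij].
  - rewrite app_nth2 by (rewrite length_firstn; lia).
    rewrite length_firstn, Nat.min_l, Nat.sub_diag by lia. reflexivity.
  - destruct (Nat.lt_ge_cases i j).
    + rewrite app_nth1 by (rewrite length_firstn; lia).
      rewrite nth_firstn. destruct (Nat.ltb_spec i j); [reflexivity|lia].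
    + rewrite app_nth2 by (rewrite length_firstn; lia).
      rewrite length_firstn, Nat.min_l by lia.
      replace (i - j)%nat with (S (i - S j)) by lia. cbn [nth]. rewrite nth_skipn.
      f_equal. lia.
Qed.

(** A top either comes first or has a strictly larger position before it, which leaves room for one
    step. *)
Lemma desc_jump (Y : conf) (j : nat) : desc Y -> In j (tops Y) -> desc (jump Y j).
Proof.
  intros H Hj. pose proof (tops_in Y j Hj) as Hl.
  unfold tops in Hj. apply filter_In in Hj. destruct Hj as [_ Hj].
  intros i k Hik. rewrite length_jump in Hik by assumption. rewrite !nth_jump by lia.
  pose proof (H i k Hik) as H1.
  destruct (Nat.eqb_spec k j) as [->|], (Nat.eqb_spec i j) as [->|]; try lia.
  destruct j as [|j]; [lia|]. cbn [is_top] in Hj.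
  destruct (Z.eq_dec _ _) as [|Hne] in Hj; [discriminate|].
  pose proof (H j (S j) ltac:(lia)). pose proof (H i j ltac:(lia)). lia.
Qed.

(** * The initial condition *)

Definition expY (Y : conf) (i : nat) : Z := (- nth i Y 0)%Z.
(** One permutation at time 0. The [-1] of the exponents is already cancelled by the factor [z] of
    [dz]. *)
Definition bethe_term (q : R) (X Y : conf) (s : list nat) (zs : list Cx) : Cx :=
  (Aprod q s zs * wave s X zs * mono (expY Y) zs)%cx.

Lemma pair_factor_app (q : R) (zs zs' : list Cx) (a b : nat) :
  (a < length zs)%nat -> (b < length zs)%nat -> pair_factor q (zs ++ zs') a b = pair_factor q zs a b.
Proof. intros Ha Hb. unfold pair_factor, zn. now rewrite !app_nth1. Qed.

Lemma Aprod_app (q : R) (s : list nat) (zs zs' : list Cx) :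
  (forall a, In a s -> (a < length zs)%nat) -> Aprod q s (zs ++ zs') = Aprod q s zs.
Proof.
  induction s as [|a s IH]; intros H; simpl; [reflexivity|].
  rewrite IH by (intros; apply H; now right). f_equal. f_equal. apply map_ext_in.
  intros b Hb. apply pair_factor_app; apply H; [now left | now right].
Qed.

Lemma wave_app (s : list nat) (X : conf) (zs zs' : list Cx) :
  (forall a, In a s -> (a < length zs)%nat) -> wave s X (zs ++ zs') = wave s X zs.
Proof.
  revert X. induction s as [|a s IH]; intros [|x X] H; simpl; try reflexivity.
  rewrite IH by (intros; apply H; now right). f_equal. f_equal. unfold zn.
  apply app_nth1, H. now left.
Qed.

(** The default value 0 of [nth] beyond the end of [Y] gives the new variable exponent 0 in
    [expY Y]. *)
Lemma expY_snoc (Y : conf) (y : Z) (zs : list Cx) :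
  Forall (fun z => z <> C0) zs -> length zs = S (length Y) ->
  mono (expY (Y ++ [y])) zs = (mono (expY Y) zs * Czpow (zn zs (length Y)) (- y))%cx.
Proof.
  intros Hz Hl. unfold zn. rewrite <- mono_unit_expo by lia. rewrite <- mono_add by assumption.
  apply mono_ext. intros i Hi. unfold expY, unit_expo.
  destruct (Nat.eqb_spec i (length Y)) as [->|Hne].
  - rewrite nth_middle, nth_overflow by lia. lia.
  - rewrite app_nth1 by lia. lia.
Qed.

Section Initial.
Variables q r : R.
Hypothesis Hr0 : 0 < r.
Hypothesis Hr1 : Rabs q + Rabs (1 - q) * r < 1.

(** * Amplitudes and waves with exponents in an additive submonoid *)

Section Cone.
Variable P : (nat -> Z) -> Prop.
Hypothesis P0 : P (fun _ => 0%Z).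
Hypothesis Padd : forall e f, P e -> P f -> P (fun i => (e i + f i)%Z).

Lemma LaurentP_Cprod {A : Type} n (f : A -> list Cx -> Cx) (l : list A) :
  (forall a, In a l -> LaurentP r P n (f a)) -> LaurentP r P n (fun zs => Cprod (map (fun a => f a zs) l)).
Proof.
  induction l as [|a l IH]; intros H.
  - exact (LaurentP_const r P n C1 P0).
  - apply (LaurentP_mul r Hr0 P P P n (f a) (fun zs => Cprod (map (fun a => f a zs) l)) Padd).
    + apply H. now left.
    + apply IH. intros; apply H; now right.
Qed.

Lemma LaurentP_pair_factor n a b : (a < n)%nat -> (b < n)%nat ->
  (forall e, cone a b e -> P e) -> LaurentP r P n (fun zs => pair_factor q zs a b).
Proof.
  intros Ha Hb HP. unfold pair_factor. destruct (Nat.ltb_spec b a).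
  - eapply LaurentP_weaken; [exact HP|]. apply LaurentP_Sba; assumption || lia.
  - now apply LaurentP_const.
Qed.

(** The condition bears on ordered pairs, because the earlier label of an inversion is the upper
    index of [S] and the later one the lower index. *)
Lemma LaurentP_Aprod n s : (forall a, In a s -> (a < n)%nat) ->
  ForallOrdPairs (fun a b => forall e, cone a b e -> P e) s ->
  LaurentP r P n (Aprod q s).
Proof.
  intros Hs H. induction H as [|a s Ha H IH].
  - exact (LaurentP_const r P n C1 P0).
  - apply (LaurentP_mul r Hr0 P P P n (fun zs => Cprod (map (pair_factor q zs a) s)) (Aprod q s) Padd).
    + apply LaurentP_Cprod. intros b Hb. rewrite Forall_forall in Ha.
      apply LaurentP_pair_factor; [apply Hs; now left | apply Hs; now right | now apply Ha].
    + apply IH. intros; apply Hs; now right.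
Qed.

Lemma LaurentP_wave n s X : (forall a, In a s -> (a < n)%nat) ->
  (forall a k, In a s -> P (unit_expo a k)) -> LaurentP r P n (wave s X).
Proof.
  revert X. induction s as [|a s IH]; intros X Hs HP.
  - exact (LaurentP_const r P n C1 P0).
  - destruct X as [|x X]; [exact (LaurentP_const r P n C1 P0)|].
    apply (LaurentP_mul r Hr0 P P P n (fun zs => Czpow (zn zs a) x) (wave s X) Padd).
    + apply LaurentP_var; [apply Hs; now left | apply HP; now left].
    + apply IH; intros; [apply Hs | apply HP]; now right.
Qed.
End Cone.

Lemma ForallOrdPairs_all {A : Type} (Q : A -> A -> Prop) (l : list A) :
  (forall a b, Q a b) -> ForallOrdPairs Q l.
Proof.
  intros H. induction l; constructor; [|assumption]. apply Forall_forall. auto.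
Qed.

Lemma Laurent_bethe_term n X Y s : In s (perms n) -> Laurent r n (bethe_term q X Y s).
Proof.
  intros Hs. unfold bethe_term.
  apply (Laurent_mul r Hr0 n (fun zs => Aprod q s zs * wave s X zs)%cx (mono (expY Y))).
  - apply Laurent_mul; [exact Hr0| |].
    + apply LaurentP_Aprod; auto; [intros; eapply perms_lt; eassumption|].
      apply ForallOrdPairs_all. auto.
    + apply LaurentP_wave; auto. intros; eapply perms_lt; eassumption.
  - now apply LaurentP_mono.
Qed.

Lemma Laurent_psi n X : Laurent r n (psi q n X).
Proof.
  apply (proj1 (tavg_sum r Hr0 n (fun s zs => Aprod q s zs * wave s X zs)%cx (perms n)
    (fun s Hs => Laurent_mul r Hr0 n (Aprod q s) (wave s X)
      (LaurentP_Aprod (fun _ => True) I (fun _ _ _ _ => I) n s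
         (fun a => perms_lt n s a Hs) (ForallOrdPairs_all _ s (fun _ _ _ _ => I)))
      (LaurentP_wave (fun _ => True) I (fun _ _ _ _ => I) n s X
         (fun a => perms_lt n s a Hs) (fun _ _ _ => I))))).
Qed.

(* In the last position a label only occurs as the lower index of [S], so that
   the integrand is analytic outside the circle in that variable. *)
Lemma tavg_bethe_term_last n X x Y s m : length s = length X ->
  In (s ++ [m]) (perms n) -> (x < nth m Y 0)%Z ->
  tavg r n (bethe_term q (X ++ [x]) Y (s ++ [m])) = C0.
Proof.
  intros Hl Hs Hx.
  assert (Hlt : forall a, In a (s ++ [m]) -> (a < n)%nat) by (intros; eapply perms_lt; eassumption).
  assert (Hm : (m < n)%nat) by (apply Hlt, in_or_app; right; now left).
  pose proof (perms_NoDup_elt n _ Hs) as Hd. apply NoDup_remove_2 in Hd. rewrite app_nil_r in Hd.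
  (* The exponent of [z_m] is at most 0 in the amplitude, [x] in the wave and [- y_m] in the last
     factor. *)
  apply tavg_zero with (fun e => e m <= x - nth m Y 0)%Z; [exact Hr0| |].
  2:{ intros e He. apply zerob_false with m; [assumption|]. lia. }
  unfold bethe_term.
  apply (LaurentP_mul r Hr0 (fun e => e m <= x)%Z (fun e => e m = - nth m Y 0)%Z); [intros; lia| |].
  2:{ apply LaurentP_mono. reflexivity. }
  apply (LaurentP_mul r Hr0 (fun e => e m <= 0)%Z (fun e => e m = x)%Z); [intros; lia| |].
  - apply LaurentP_Aprod; [lia | intros; lia | assumption |].
    clear Hs Hlt Hl. induction s as [|a s IH].
    + repeat constructor.
    + simpl in Hd. constructor; [|apply IH; tauto].
      apply Forall_forall. intros b _ e (H1 & H2 & H3).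
      destruct (Nat.eq_dec m b) as [->|Hb]; [assumption|]. rewrite H3; [lia|intros ->; tauto|assumption].
  - apply LaurentP_ext with (fun zs => Czpow (zn zs m) x * wave (s ++ []) (X ++ []) zs)%cx.
    + intros zs _. symmetry. now apply wave_insert.
    + apply (LaurentP_mul r Hr0 (fun e => e m = x) (fun e => e m = 0%Z)); [intros; lia| |].
      * apply LaurentP_var; [assumption|]. unfold unit_expo. now rewrite Nat.eqb_refl.
      * rewrite app_nil_r. apply LaurentP_wave; [lia | intros; lia | |].
        -- intros; apply Hlt, in_or_app; now left.
        -- intros a k Ha. unfold unit_expo. destruct (Nat.eqb_spec m a) as [->|]; [contradiction|reflexivity].
Qed.

(** Telescoping [S f - q q^l = (S - q) f + q (f - q^l)]. Every label of [l] is smaller than [m], so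
    each one contributes a genuine factor [S]. *)
Lemma LaurentP_Cprod_sub n m l : (m < n)%nat -> (forall b, In b l -> (b < m)%nat) ->
  LaurentP r (fun e => 1 <= e m)%Z n
    (fun zs => Cprod (map (pair_factor q zs m) l) - RtoC (q ^ length l))%cx.
Proof.
  intros Hm. induction l as [|b l IH]; intros Hl.
  - intros e He. exists []. split; [constructor|]. intros zs _.
    change (Cprod (map (pair_factor q zs m) [])) with C1.
    change (ev [] zs) with C0. change (RtoC (q ^ length [])) with C1.
    replace (C1 - C1 - C0)%cx with C0 by ring.
    rewrite Cmod_C0. lra.
  - assert (Hb : (b < m)%nat) by (apply Hl; now left).
    apply LaurentP_ext with (fun zs =>
      (Sba q (zn zs m) (zn zs b) - RtoC q) * Cprod (map (pair_factor q zs m) l)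
      + RtoC q * (Cprod (map (pair_factor q zs m) l) - RtoC (q ^ length l)))%cx.
    + intros zs _. cbn [map length]. rewrite Cprod_cons.
      replace (pair_factor q zs m b) with (Sba q (zn zs m) (zn zs b))
        by (unfold pair_factor; destruct (Nat.ltb_spec b m); [reflexivity|lia]).
      replace (RtoC (q ^ S (length l))) with (RtoC q * RtoC (q ^ length l))%cx
        by (apply Cx_ext; simpl; ring). ring.
    + apply (LaurentP_add r _ n (fun zs => (Sba q (zn zs m) (zn zs b) - RtoC q) * Cprod (map (pair_factor q zs m) l))%cx).
      * apply (LaurentP_mul r Hr0 (fun e => 1 <= e m)%Z (fun e => 0 <= e m)%Z); [intros; lia| |].
        -- apply LaurentP_Sba_sub; assumption || lia.
        -- apply LaurentP_Cprod; [lia | intros; lia|]. intros c Hc.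
           assert (c < m)%nat by (apply Hl; now right).
           apply LaurentP_pair_factor; [lia| assumption | lia | intros e (H1 & _); exact H1].
      * apply LaurentP_scal. apply IH. intros; apply Hl; now right.
Qed.

(* The largest label only occurs as the upper index of [S], so that the integrand
   is analytic inside the circle in that variable, with [S = q] at the centre. *)
Lemma tavg_bethe_term_insert N X1 x X2 Y y l1 l2 : In (l1 ++ l2) (perms N) ->
  length l1 = length X1 -> length Y = N -> (y <= x)%Z ->
  tavg r (S N) (bethe_term q (X1 ++ x :: X2) (Y ++ [y]) (l1 ++ N :: l2)) =
  if (x =? y)%Z then (RtoC (q ^ length l2) * tavg r N (bethe_term q (X1 ++ X2) Y (l1 ++ l2)))%cx else C0.
Proof.
  intros Hs Hl HY Hxy.
  assert (Hlt : forall a, In a (l1 ++ l2) -> (a < N)%nat) by (intros; eapply perms_lt; eassumption).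
  assert (Hlt1 : forall a, In a l1 -> (a < N)%nat) by (intros; apply Hlt, in_or_app; now left).
  assert (Hlt2 : forall a, In a l2 -> (a < N)%nat) by (intros; apply Hlt, in_or_app; now right).
  (* The integrand after removal of label [N], still read as a function of [N + 1] variables. *)
  set (G := fun zs => (Aprod q (l1 ++ l2) zs * wave (l1 ++ l2) (X1 ++ X2) zs * mono (expY Y) zs)%cx).
  assert (E : forall zs, torus r (S N) zs ->
    (Czpow (zn zs N) (x - y) * (Cprod (map (pair_factor q zs N) l2) * G zs))%cx =
    bethe_term q (X1 ++ x :: X2) (Y ++ [y]) (l1 ++ N :: l2) zs).
  { intros zs Hz. unfold bethe_term, G. rewrite Aprod_insert, wave_insert by assumption.
    rewrite expY_snoc, HY.
    - unfold Z.sub. rewrite Czpow_add; [ring|].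
      apply (torus_nth_neq0 r (S N)); [assumption|assumption|lia].
    - eapply torus_neq0; eassumption.
    - destruct Hz as [-> _]. now rewrite HY. }
  rewrite <- (tavg_ext r Hr0 (S N) _ _ E).
  assert (HG : forall zs z, torus r N zs -> Cmod z = r ->
    G (zs ++ [z]) = bethe_term q (X1 ++ X2) Y (l1 ++ l2) zs).
  { intros zs z [Hz _] _. unfold G, bethe_term.
    rewrite Aprod_app, wave_app by (intros a Ha; rewrite Hz; now apply Hlt).
    f_equal. rewrite <- (mono_trunc_expo N _ _ z Hz). apply mono_ext. intros i _.
    unfold trunc_expo, expY. destruct (Nat.ltb_spec i N); [reflexivity|].
    rewrite nth_overflow by lia. reflexivity. }
  assert (HnT : Laurent r N (bethe_term q (X1 ++ X2) Y (l1 ++ l2))) by now apply Laurent_bethe_term.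
  assert (HnG : LaurentP r (fun e => e N = 0%Z) (S N) G) by (eapply LaurentP_weak; eassumption).
  assert (HnC : LaurentP r (fun e => 0 <= e N)%Z (S N) (fun zs => Cprod (map (pair_factor q zs N) l2))).
  { apply LaurentP_Cprod; [lia | intros; lia|]. intros c Hc. specialize (Hlt2 c Hc).
    apply LaurentP_pair_factor; [lia| lia | lia | intros e (H1 & _); exact H1]. }
  destruct (Z.eqb_spec x y) as [->|Hne].
  (* The product of [S] factors is split into its value at the centre and a remainder whose [z_N]
     exponents are at least 1; the remainder averages to 0. *)
  - rewrite (tavg_ext r Hr0 (S N) _ (fun zs =>
      (Cprod (map (pair_factor q zs N) l2) - RtoC (q ^ length l2)) * G zs + RtoC (q ^ length l2) * G zs)%cx).
    2:{ intros zs _. rewrite Z.sub_diag. cbn [Czpow]. ring. }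
    assert (H1 : LaurentP r (fun e => 1 <= e N)%Z (S N) (fun zs =>
      (Cprod (map (pair_factor q zs N) l2) - RtoC (q ^ length l2)) * G zs)%cx).
    { apply (LaurentP_mul r Hr0 (fun e => 1 <= e N)%Z (fun e => e N = 0%Z)); [intros; lia| |assumption].
      apply LaurentP_Cprod_sub; [lia|assumption]. }
    rewrite tavg_add; [|assumption|eapply LaurentP_nice; exact H1|apply LaurentP_scal; eapply LaurentP_nice; exact HnG].
    rewrite (tavg_zero r Hr0 _ (S N) _ H1) by (intros e He; apply zerob_false with N; lia).
    rewrite tavg_scal by (assumption || (eapply LaurentP_nice; exact HnG)).
    rewrite (tavg_weak r Hr0 N _ _ HnT HG). ring.
  (* Here [y < x], and [z_N ^ (x - y)] alone makes the exponent positive. *)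
  - apply tavg_zero with (fun e => 1 <= e N)%Z; [assumption| |intros e He; apply zerob_false with N; lia].
    apply (LaurentP_mul r Hr0 (fun e => 1 <= e N)%Z (fun e => 0 <= e N)%Z); [intros; lia| |].
    + apply LaurentP_var; [lia|]. unfold unit_expo. rewrite Nat.eqb_refl. lia.
    + apply (LaurentP_mul r Hr0 (fun e => 0 <= e N)%Z (fun e => e N = 0)%Z); [intros; lia|assumption|assumption].
Qed.

(** Removing any element of a constant tail gives the same list as removing the last one. *)
Lemma snoc_remove (X1 X2 X : conf) (x c d : Z) : X1 ++ x :: X2 = X ++ [d] ->
  (forall a, In a (x :: X2) -> a = c) -> X1 ++ X2 = X.
Proof.
  intros E H.
  assert (E' : x :: X2 = X2 ++ [c]).
  { assert (E2 : X2 = repeat c (length X2)).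
    { apply Forall_eq_repeat, Forall_forall. intros a Ha. symmetry. apply H. now right. }
    rewrite (H x) by now left. rewrite E2. apply (repeat_cons (length X2) c). }
  rewrite E', app_assoc in E. now apply app_inj_tail in E.
Qed.

(** The occurrences of [x] form a final segment, so the numbers of labels behind them run through 0,
    ..., m - 1. *)
Lemma qint_positions (X : conf) (x : Z) :
  (forall i j, (i <= j < length X)%nat -> nth i X 0%Z = x -> nth j X 0%Z = x) ->
  Csum (map (fun p => if (nth p X 0 =? x)%Z then RtoC (q ^ (length X - 1 - p)) else C0)
    (seq 0 (length X))) = RtoC (qint q (eta X x)).
Proof.
  induction X as [|a X IH]; intros H; [reflexivity|].
  cbn [length]. change (seq 0 (S (length X))) with (O :: seq 1 (length X)).
  rewrite <- seq_shift. cbn [map]. rewrite map_map, Csum_cons.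
  rewrite (map_ext_in _ (fun p => if (nth p X 0 =? x)%Z then RtoC (q ^ (length X - 1 - p)) else C0)).
  - rewrite IH. 2:{ intros i j Hij E. apply (H (S i) (S j)); [simpl; lia | exact E]. }
    cbn [nth]. rewrite Nat.sub_succ, !Nat.sub_0_r.
    destruct (Z.eqb_spec a x) as [->|Hax].
    + rewrite eta_cons_eq, qint_S.
      replace (eta X x) with (length X); [apply Cx_ext; simpl; ring|].
      assert (E : X = repeat x (length X)).
      { apply Forall_eq_repeat, Forall_forall. intros b Hb.
        apply In_nth with (d := 0%Z) in Hb. destruct Hb as (j & Hj & <-).
        symmetry. apply (H O (S j)); [simpl; lia | reflexivity]. }
      rewrite E at 2. unfold eta. rewrite count_occ_repeat_eq; reflexivity.
    + rewrite eta_cons_neq by assumption. ring.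
  - intros p Hp. apply in_seq in Hp. cbn [nth].
    replace (S (length X) - 1 - S p)%nat with (length X - 1 - p)%nat by lia. reflexivity.
Qed.

Definition init_avg (n : nat) (X Y : conf) : Cx :=
  tavg r n (fun zs => psi q n X zs * mono (expY Y) zs)%cx.

Lemma init_avg_sum n X Y :
  init_avg n X Y = Csum (map (fun s => tavg r n (bethe_term q X Y s)) (perms n)).
Proof.
  unfold init_avg. rewrite <- (proj2 (tavg_sum r Hr0 n (bethe_term q X Y) (perms n) (fun s => Laurent_bethe_term n X Y s))).
  apply tavg_ext; [assumption|]. intros zs _. unfold psi.
  replace (Csum _ * mono (expY Y) zs)%cx with
    (mono (expY Y) zs * Csum (map (fun s => Aprod q s zs * wave s X zs) (perms n)))%cx by ring.
  rewrite <- Csum_map_mul. f_equal. apply map_ext. intros s. unfold bethe_term. ring.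
Qed.

Lemma Csum_zero {A : Type} (f : A -> Cx) (l : list A) :
  (forall a, In a l -> f a = C0) -> Csum (map f l) = C0.
Proof.
  induction l as [|a l IH]; intros H; [reflexivity|].
  cbn [map]. rewrite Csum_cons, H by (now left). rewrite IH by (intros; apply H; now right). ring.
Qed.

Lemma Csum_flat_map {A B : Type} (f : B -> Cx) (g : A -> list B) (l : list A) :
  Csum (map f (flat_map g l)) = Csum (map (fun a => Csum (map f (g a))) l).
Proof.
  induction l as [|a l IH]; [reflexivity|]. cbn [flat_map map].
  now rewrite map_app, Csum_app, Csum_cons, IH.
Qed.

Lemma init_avg_snoc N X x Y y : length X = N -> length Y = N ->
  desc (X ++ [x]) -> desc (Y ++ [y]) ->
  init_avg (S N) (X ++ [x]) (Y ++ [y]) =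
  if (x =? y)%Z then (RtoC (qint q (S (eta X x))) * init_avg N X Y)%cx else C0.
Proof.
  intros HX HY HdX HdY. rewrite init_avg_sum. destruct (Z.lt_ge_cases x y) as [Hlt|Hge].
  - replace (x =? y)%Z with false by (symmetry; apply Z.eqb_neq; lia).
    apply Csum_zero. intros s Hs.
    pose proof (perms_length _ _ Hs) as Hl.
    destruct (exists_last (l := s)) as (s' & m & ->); [intros ->; discriminate|].
    rewrite length_app in Hl; simpl in Hl.
    apply tavg_bethe_term_last; [lia|assumption|].
    assert (Hm : (m < S N)%nat) by (eapply perms_lt; [exact Hs|]; apply in_or_app; right; now left).
    (* The last entry [y] is the smallest, so [x < y] places [x] below [y_m] whichever label [m]
       stands last. *)
    pose proof (desc_snoc Y y (nth m (Y ++ [y]) 0%Z) HdY) as H.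
    assert (Hin : In (nth m (Y ++ [y]) 0%Z) (Y ++ [y])).
    { apply nth_In. rewrite length_app; simpl; lia. }
    specialize (H Hin). lia.
  - cbn [perms]. rewrite Csum_flat_map.
    assert (E : forall s, In s (perms N) ->
      Csum (map (fun s' => tavg r (S N) (bethe_term q (X ++ [x]) (Y ++ [y]) s')) (insert_all N s)) =
      (if (x =? y)%Z then RtoC (qint q (S (eta X x))) * tavg r N (bethe_term q X Y s) else C0)%cx).
    { intros s Hs. pose proof (perms_length _ _ Hs) as Hl.
      rewrite insert_all_eq, map_map.
      (* As [x_p >= x >= y], the condition [x_p = y] separates into [x = y], which is independent of
         [p], and [x_p = x]. *)
      rewrite (map_ext_in _ (fun p => ((if (x =? y)%Z then tavg r N (bethe_term q X Y s) else C0) *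
        (if (nth p (X ++ [x]) 0 =? x)%Z then RtoC (q ^ (length (X ++ [x]) - 1 - p)) else C0))%cx)).
      - rewrite Csum_map_mul. replace (S (length s)) with (length (X ++ [x]))
          by (rewrite length_app; simpl; lia).
        rewrite qint_positions.
        + unfold eta. rewrite count_occ_app. simpl. destruct (Z.eq_dec x x); [|congruence].
          rewrite Nat.add_1_r. destruct (x =? y)%Z; ring.
        + intros i j Hij Ei. apply Z.le_antisymm.
          * rewrite <- Ei at 2. apply HdX. assumption.
          * apply (desc_snoc X x); [assumption|]. apply nth_In. lia.
      - intros p Hp. apply in_seq in Hp.
        set (X' := X ++ [x]). assert (HlX : length X' = S N) by (unfold X'; rewrite length_app; simpl; lia).
        assert (Hsp : X' = firstn p X' ++ nth p X' 0%Z :: skipn (S p) X').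
        { rewrite <- (firstn_skipn p X') at 1. f_equal.
          assert (Hs' : forall (l : conf) k, (k < length l)%nat -> skipn k l = nth k l 0%Z :: skipn (S k) l).
          { induction l as [|b l IHl]; intros k Hk; [simpl in Hk; lia|].
            destruct k; [reflexivity|]. simpl in Hk. simpl. rewrite IHl by lia. reflexivity. }
          apply Hs'. lia. }
        assert (Hge' : (x <= nth p X' 0)%Z).
        { apply (desc_snoc X x); [assumption|]. apply nth_In. unfold X' in *. lia. }
        rewrite Hsp at 1. rewrite tavg_bethe_term_insert; try lia.
        + rewrite length_skipn, Hl, HlX. replace (S N - 1 - p)%nat with (N - p)%nat by lia.
          destruct (Z.eqb_spec (nth p X' 0%Z) y) as [E1|E1], (Z.eqb_spec (nth p X' 0%Z) x) as [E2|E2],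
            (Z.eqb_spec x y) as [E3|E3]; try lia; try ring.
          rewrite firstn_skipn.
          (* From position [p] on all entries equal [x], so the remaining configuration is [X] for
             every contributing [p]. *)
          rewrite (snoc_remove (firstn p X') (skipn (S p) X') X (nth p X' 0%Z) x x).
          * ring.
          * symmetry. exact Hsp.
          * intros a Ha.
            assert (Ha' : In a X') by (rewrite Hsp; apply in_or_app; now right).
            apply Z.le_antisymm; [|now apply (desc_snoc X x)].
            destruct Ha as [<-|Ha]; [lia|].
            apply In_nth with (d := 0%Z) in Ha. destruct Ha as (j & Hj & <-).
            rewrite length_skipn in Hj. rewrite nth_skipn.
            rewrite <- E2. apply HdX. fold X'. lia.
        + rewrite firstn_skipn. exact Hs.
        + rewrite !length_firstn. lia. }
    rewrite (map_ext_in _ _ _ E). destruct (x =? y)%Z.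
    + rewrite Csum_map_mul, <- init_avg_sum. reflexivity.
    + now apply Csum_zero.
Qed.

Lemma init_avg_eq n X Y : length X = n -> length Y = n -> desc X -> desc Y ->
  init_avg n X Y = if list_eq_dec Z.eq_dec Y X then RtoC (site_qfact q X) else C0.
Proof.
  revert X Y. induction n as [|n IH]; intros X Y HX HY HdX HdY.
  - destruct X, Y; try discriminate. destruct (list_eq_dec _ _ _) as [_|]; [|congruence].
    rewrite init_avg_sum. unfold site_qfact, tops. simpl. rewrite Csum_cons. unfold bethe_term. simpl.
    change (Csum []) with C0. change (RtoC 1) with C1. ring.
  - destruct (exists_last (l := X)) as (X' & x & ->); [intros ->; discriminate|].
    destruct (exists_last (l := Y)) as (Y' & y & ->); [intros ->; discriminate|].
    rewrite length_app in HX, HY; simpl in HX, HY.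
    rewrite init_avg_snoc by (assumption || lia).
    rewrite IH by (lia || (eapply desc_app_l; eassumption)).
    rewrite site_qfact_snoc by assumption.
    destruct (Z.eqb_spec x y) as [->|Hxy].
    + destruct (list_eq_dec Z.eq_dec Y' X') as [->|Hne];
        destruct (list_eq_dec Z.eq_dec _ _) as [E|E]; try congruence.
      * apply Cx_ext; simpl; ring.
      * apply app_inj_tail in E. tauto.
      * ring.
    + destruct (list_eq_dec Z.eq_dec _ _) as [E|E]; [|reflexivity].
      apply app_inj_tail in E. destruct E; congruence.
Qed.

End Initial.

(** * The exponential series *)

(** Degrees below [m]: differentiating along a ray lowers [m] by one. *)
Definition cexp_part (m : nat) (w : Cx) : Cx :=
  Csum (map (fun i => RtoC (/ INR (fact i)) * Cpow w i)%cx (seq 0 m)).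

Lemma cexp_part_S (m : nat) (w : Cx) :
  cexp_part (S m) w = (cexp_part m w + RtoC (/ INR (fact m)) * Cpow w m)%cx.
Proof.
  unfold cexp_part. rewrite seq_S, map_app, Csum_app. cbn [map]. rewrite Csum_cons.
  change (Csum []) with C0. simpl (0 + m)%nat. ring.
Qed.

Lemma Cpow_scale (s : R) (w : Cx) (i : nat) :
  Cpow (RtoC s * w)%cx i = (RtoC (s ^ i) * Cpow w i)%cx.
Proof.
  induction i as [|i IH]; simpl; [apply Cx_ext; simpl; ring|].
  rewrite IH. replace (RtoC (s * s ^ i)) with (RtoC s * RtoC (s ^ i))%cx
    by (apply Cx_ext; simpl; ring). ring.
Qed.

(** [Cexp] is given by real functions, so it is compared with its series along the ray from 0 to
    [w], with real derivatives of both parts. *)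
Definition cderiv (f : R -> Cx) (s : R) (d : Cx) : Prop :=
  is_derive (fun x => fst (f x)) s (fst d) /\ is_derive (fun x => snd (f x)) s (snd d).

Lemma cderiv_ext (f g : R -> Cx) (s : R) (d e : Cx) :
  (forall x, f x = g x) -> d = e -> cderiv f s d -> cderiv g s e.
Proof.
  intros E <- [H1 H2]. split.
  - apply (is_derive_ext (fun x => fst (f x))); [intros; now rewrite E | assumption].
  - apply (is_derive_ext (fun x => snd (f x))); [intros; now rewrite E | assumption].
Qed.

Lemma cderiv_add (f g : R -> Cx) (s : R) (d e : Cx) :
  cderiv f s d -> cderiv g s e -> cderiv (fun x => f x + g x)%cx s (d + e)%cx.
Proof.
  intros [H1 H2] [H3 H4]. split.
  - apply (is_derive_plus (V := R_NormedModule) (fun x => fst (f x)) (fun x => fst (g x))); assumption.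
  - apply (is_derive_plus (V := R_NormedModule) (fun x => snd (f x)) (fun x => snd (g x))); assumption.
Qed.

Lemma cderiv_sub (f g : R -> Cx) (s : R) (d e : Cx) :
  cderiv f s d -> cderiv g s e -> cderiv (fun x => f x - g x)%cx s (d - e)%cx.
Proof.
  intros [H1 H2] [H3 H4]. split.
  - apply (is_derive_minus (V := R_NormedModule) (fun x => fst (f x)) (fun x => fst (g x))); assumption.
  - apply (is_derive_minus (V := R_NormedModule) (fun x => snd (f x)) (fun x => snd (g x))); assumption.
Qed.

Lemma cderiv_const (c : Cx) (s : R) : cderiv (fun _ => c) s C0.
Proof. split; apply (is_derive_const (V := R_NormedModule)). Qed.

Lemma is_derive_monomial (c : R) (m : nat) (s : R) :
  is_derive (fun x => c * x ^ S m) s (c * (INR (S m) * s ^ m)).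
Proof. rewrite S_INR. auto_derive; trivial. destruct m; simpl; ring. Qed.

Lemma cderiv_monomial (c : R) (w : Cx) (m : nat) (s : R) :
  cderiv (fun x => RtoC (c * x ^ S m) * w)%cx s (RtoC (c * (INR (S m) * s ^ m)) * w)%cx.
Proof.
  rewrite S_INR. split; cbn [fst snd RtoC Cmul]; auto_derive; trivial; rewrite <- ?S_INR; destruct m; simpl; ring.
Qed.

Lemma cderiv_cexp_part (w : Cx) (m : nat) (s : R) :
  cderiv (fun x => cexp_part (S m) (RtoC x * w)%cx) s (w * cexp_part m (RtoC s * w))%cx.
Proof.
  induction m as [|m IH].
  - apply cderiv_ext with (fun _ => C1) C0; [| |apply cderiv_const].
    + intros x. apply Cx_ext; simpl; field.
    + change (cexp_part 0 (RtoC s * w)%cx) with C0. ring.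
  - eapply cderiv_ext; [intros x; symmetry; apply cexp_part_S| |].
    2:{ apply cderiv_add; [exact IH|].
        eapply cderiv_ext; [| |apply (cderiv_monomial (/ INR (fact (S m))) (Cpow w (S m)) m s)].
        - intros x. cbv beta. rewrite Cpow_scale.
          replace (RtoC (/ INR (fact (S m)) * x ^ S m))
            with (RtoC (/ INR (fact (S m))) * RtoC (x ^ S m))%cx by (apply Cx_ext; simpl; ring).
          ring.
        - reflexivity. }
    rewrite cexp_part_S, Cpow_scale. cbn [Cpow].
    replace (RtoC (/ INR (fact (S m)) * (INR (S m) * s ^ m)))
      with (RtoC (/ INR (fact m)) * RtoC (s ^ m))%cx; [ring|].
    rewrite fact_simpl, mult_INR.
    pose proof (INR_fact_neq_0 m). assert (INR (S m) <> 0) by (apply not_0_INR; lia).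
    apply Cx_ext; cbn [fst snd RtoC Cmul]; field; auto.
Qed.

Lemma cderiv_Cexp (w : Cx) (s : R) :
  cderiv (fun x => Cexp (RtoC x * w)%cx) s (w * Cexp (RtoC s * w))%cx.
Proof.
  assert (E : forall x, Cexp (RtoC x * w)%cx =
    (exp (x * fst w) * cos (x * snd w), exp (x * fst w) * sin (x * snd w))).
  { intros x. unfold Cexp. cbn [fst snd RtoC Cmul].
    replace (x * fst w - 0 * snd w) with (x * fst w) by ring.
    replace (x * snd w + 0 * fst w) with (x * snd w) by ring. reflexivity. }
  eapply cderiv_ext; [intros x; symmetry; apply E | rewrite E; reflexivity |].
  split; cbn [fst snd Cmul]; auto_derive; trivial; ring.
Qed.

Lemma nonneg_of_derive (h dh : R -> R) (s : R) : 0 <= s ->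
  (forall x, is_derive h x (dh x)) -> (forall x, 0 <= x <= s -> 0 <= dh x) -> h 0 = 0 -> 0 <= h s.
Proof.
  intros Hs Hd Hp H0.
  destruct (MVT_gen h 0 s dh) as (c & Hc & E).
  - intros; apply Hd.
  - intros x _. apply derivable_continuous_pt. exists (dh x). apply is_derive_Reals, Hd.
  - rewrite Rmin_left, Rmax_right in Hc by assumption.
    specialize (Hp c Hc). nra.
Qed.

Lemma abs_le_of_derive (f df g dg : R -> R) (s : R) : 0 <= s ->
  (forall x, is_derive f x (df x)) -> (forall x, is_derive g x (dg x)) ->
  (forall x, 0 <= x <= s -> Rabs (df x) <= dg x) -> f 0 = 0 -> g 0 = 0 -> Rabs (f s) <= g s.
Proof.
  intros Hs Hf Hg Hle Hf0 Hg0.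
  assert (H1 : 0 <= g s - f s).
  { apply (nonneg_of_derive (fun x => g x - f x) (fun x => dg x - df x)); [assumption| | |lra].
    - intros x. apply (is_derive_minus (V := R_NormedModule) g f); auto.
    - intros x Hx. specialize (Hle x Hx). pose proof (Rle_abs (df x)). lra. }
  assert (H2 : 0 <= g s + f s).
  { apply (nonneg_of_derive (fun x => g x + f x) (fun x => dg x + df x)); [assumption| | |lra].
    - intros x. apply (is_derive_plus (V := R_NormedModule) g f); auto.
    - intros x Hx. specialize (Hle x Hx). pose proof (Rle_abs (- df x)).
      rewrite Rabs_Ropp in H. lra. }
  apply Rabs_le. lra.
Qed.

Lemma cexp_part_0 (m : nat) : cexp_part (S m) C0 = C1.
Proof.
  induction m as [|m IH].
  - apply Cx_ext; simpl; field.
  - rewrite cexp_part_S, IH. cbn [Cpow]. ring.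
Qed.

(** The remainder of order [S m] vanishes at [s = 0] and has derivative [w] times the remainder of
    order [m], so the bound integrates. Passing from the parts to the modulus at each stage turns
    [B] into [2 * B]. *)
Lemma Cexp_rem (B : R) (w : Cx) (m : nat) : 0 <= B -> Cmod w <= B ->
  forall s, 0 <= s <= 1 ->
  let rem := (Cexp (RtoC s * w) - cexp_part m (RtoC s * w))%cx in
  Rabs (fst rem) <= exp B * ((2 * B * s) ^ m / INR (fact m)) /\
  Rabs (snd rem) <= exp B * ((2 * B * s) ^ m / INR (fact m)).
Proof.
  intros HB Hw. induction m as [|m IH]; intros s Hs.
  - assert (He : exp (s * fst w) <= exp B).
    { destruct (Rle_lt_or_eq_dec (s * fst w) B) as [H|H].
      - apply Rle_trans with (Rabs (s * fst w)); [apply Rle_abs|].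
        rewrite Rabs_mult, (Rabs_pos_eq s) by lra. pose proof (fst_le_Cmod w).
        pose proof (Rabs_pos (fst w)). nra.
      - left. now apply exp_increasing.
      - right. now rewrite H. }
    assert (Hb : forall a c, Rabs c <= 1 -> a <= exp B -> 0 < a -> Rabs (a * c) <= exp B).
    { intros a c Hc Ha Ha'. rewrite Rabs_mult, (Rabs_pos_eq a) by lra.
      pose proof (Rabs_pos c). nra. }
    assert (Hcs : forall x, Rabs (cos x) <= 1 /\ Rabs (sin x) <= 1).
    { intros x. split; apply Rabs_le; [apply COS_bound | apply SIN_bound]. }
    change (cexp_part 0 (RtoC s * w)%cx) with C0.
    cbn [pow fact INR]. cbn [Csub Cadd Copp C0 Cexp fst snd RtoC Cmul].
    replace (s * fst w - 0 * snd w) with (s * fst w) by ring.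
    replace (exp B * (1 / 1)) with (exp B) by field.
    rewrite !Ropp_0, !Rplus_0_r.
    split; apply Hb; try assumption; try apply exp_pos; apply Hcs.
  - cbv zeta.
    set (g := fun x => exp B * ((2 * B * x) ^ S m / INR (fact (S m)))).
    set (dg := fun x => 2 * B * (exp B * ((2 * B * x) ^ m / INR (fact m)))).
    assert (Hg : forall x, is_derive g x (dg x)).
    { intros x.
      pose proof (INR_fact_neq_0 m) as Hf. assert (Hm : INR (S m) <> 0) by (apply not_0_INR; lia).
      assert (E : forall y, exp B * (2 * B) ^ S m / INR (fact (S m)) * y ^ S m = g y).
      { intros y. unfold g. rewrite (Rpow_mult_distr (2 * B) y). field. apply INR_fact_neq_0. }
      apply (is_derive_ext _ g x _ E).
      - replace (dg x) with (exp B * (2 * B) ^ S m / INR (fact (S m)) * (INR (S m) * x ^ m)).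
        + apply is_derive_monomial.
        + unfold dg. rewrite (Rpow_mult_distr (2 * B) x), fact_simpl, mult_INR. cbn [pow]. field. auto. }
    assert (Hd : forall x, cderiv
      (fun x => Cexp (RtoC x * w) - cexp_part (S m) (RtoC x * w))%cx x
      (w * (Cexp (RtoC x * w) - cexp_part m (RtoC x * w)))%cx).
    { intros x.
      replace (w * (Cexp (RtoC x * w) - cexp_part m (RtoC x * w)))%cx
        with (w * Cexp (RtoC x * w) - w * cexp_part m (RtoC x * w))%cx by ring.
      apply cderiv_sub; [apply cderiv_Cexp | apply cderiv_cexp_part]. }
    assert (H0 : (Cexp (RtoC 0 * w) - cexp_part (S m) (RtoC 0 * w))%cx = C0).
    { replace (RtoC 0 * w)%cx with C0 by (apply Cx_ext; simpl; ring). rewrite cexp_part_0.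
      apply Cx_ext; simpl; rewrite exp_0, ?cos_0, ?sin_0; ring. }
    assert (Hg0 : g 0 = 0).
    { unfold g. rewrite Rmult_0_r, pow_ne_zero by lia. unfold Rdiv. ring. }
    assert (Hle : forall x, 0 <= x <= s ->
      Cmod (w * (Cexp (RtoC x * w) - cexp_part m (RtoC x * w)))%cx <= dg x).
    { intros x Hx. destruct (IH x ltac:(lra)) as [I1 I2].
      pose proof (Cmod_le_parts _ _ I1 I2) as I3. rewrite Cmod_mul. unfold dg.
      pose proof (Cmod_ge_0 w). pose proof (Cmod_ge_0 (Cexp (RtoC x * w) - cexp_part m (RtoC x * w))%cx).
      eapply Rle_trans; [apply Rmult_le_compat; [assumption|assumption|exact Hw|exact I3]|].
      right. ring. }
    split.
    + apply (abs_le_of_derive (fun x => fst (Cexp (RtoC x * w) - cexp_part (S m) (RtoC x * w))%cx)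
        (fun x => fst (w * (Cexp (RtoC x * w) - cexp_part m (RtoC x * w)))%cx) g dg s);
        [lra | intros x; apply Hd | exact Hg | | cbv beta; now rewrite H0 | exact Hg0].
      intros x Hx. eapply Rle_trans; [apply fst_le_Cmod | auto].
    + apply (abs_le_of_derive (fun x => snd (Cexp (RtoC x * w) - cexp_part (S m) (RtoC x * w))%cx)
        (fun x => snd (w * (Cexp (RtoC x * w) - cexp_part m (RtoC x * w)))%cx) g dg s);
        [lra | intros x; apply Hd | exact Hg | | cbv beta; now rewrite H0 | exact Hg0].
      intros x Hx. eapply Rle_trans; [apply snd_le_Cmod | auto].
Qed.

Lemma Cexp_part_unif (B e : R) : 0 <= B -> 0 < e ->
  exists M, forall m, (M <= m)%nat -> forall w, Cmod w <= B ->
    Cmod (Cexp w - cexp_part m w)%cx <= e.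
Proof.
  intros HB He. pose proof (exp_pos B) as Hp.
  destruct (cv_speed_pow_fact (2 * B) (e / (2 * exp B))) as (M & HM).
  { apply Rdiv_lt_0_compat; lra. }
  exists M. intros m Hm w Hw. specialize (HM m Hm). unfold Rdist in HM.
  rewrite Rminus_0_r in HM.
  destruct (Cexp_rem B w m HB Hw 1 ltac:(lra)) as [H1 H2].
  assert (E : (RtoC 1 * w)%cx = w) by (apply Cx_ext; simpl; ring).
  rewrite E in H1, H2. rewrite Rmult_1_r in H1, H2.
  eapply Rle_trans; [exact (Cmod_le_parts _ _ H1 H2)|].
  pose proof (Rle_abs ((2 * B) ^ m / INR (fact m))).
  apply Rle_trans with (2 * (exp B * (e / (2 * exp B)))).
  - apply Rmult_le_compat_l; [lra|]. apply Rmult_le_compat_l; lra.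
  - right. field. lra.
Qed.

Lemma Cexp_add (w w' : Cx) : Cexp (w + w')%cx = (Cexp w * Cexp w')%cx.
Proof.
  unfold Cexp. cbn [fst snd Cadd]. rewrite exp_plus, cos_plus, sin_plus.
  apply Cx_ext; simpl; ring.
Qed.

Lemma Cexp_sum {A : Type} (f : A -> Cx) (l : list A) :
  Cprod (map (fun a => Cexp (f a)) l) = Cexp (Csum (map f l)).
Proof.
  induction l as [|a l IH].
  - apply Cx_ext; simpl; unfold Csum; simpl; rewrite exp_0, ?cos_0, ?sin_0; ring.
  - cbn [map]. rewrite Cprod_cons, Csum_cons, IH. symmetry. apply Cexp_add.
Qed.

(** * The backward equation *)

Definition esum (zs : list Cx) : Cx := Csum (map eps zs).

Lemma swap_perm {A : Type} (k : nat) (l : list A) : Permutation (swap k l) l.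
Proof.
  revert l. induction k as [|k IH]; intros [|a l]; simpl; auto.
  destruct l; [reflexivity|]. apply perm_swap.
Qed.

Lemma esum_swap (k : nat) (zs : list Cx) : esum (swap k zs) = esum zs.
Proof. apply Csum_perm, Permutation_map, swap_perm. Qed.

Lemma esum_zn (n : nat) (zs : list Cx) : length zs = n ->
  esum zs = Csum (map (fun j => eps (zn zs j)) (seq 0 n)).
Proof.
  intros <-. unfold esum. rewrite <- (map_nth_seq zs C0) at 1. now rewrite map_map.
Qed.

Lemma mono_Cprod (e : nat -> Z) (zs : list Cx) :
  mono e zs = Cprod (map (fun a => Czpow (zn zs a) (e a)) (seq 0 (length zs))).
Proof.
  revert e. induction zs as [|z zs IH]; intros e; [reflexivity|].
  cbn [length]. change (seq 0 (S (length zs))) with (O :: seq 1 (length zs)).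
  rewrite <- seq_shift. cbn [map mono]. rewrite map_map, Cprod_cons, IH. reflexivity.
Qed.

Lemma wave_Cprod (s : list nat) (X : conf) (zs : list Cx) : length s = length X ->
  Cprod (map (fun i => Czpow (zn zs (nth i s O)) (nth i X 0%Z)) (seq 0 (length X))) = wave s X zs.
Proof.
  revert X. induction s as [|a s IH]; intros [|x X] H; simpl in H; try lia; [reflexivity|].
  cbn [length]. change (seq 0 (S (length X))) with (O :: seq 1 (length X)).
  rewrite <- seq_shift. cbn [map wave]. rewrite map_map, Cprod_cons, <- IH by lia. reflexivity.
Qed.

Lemma Cprod_map_mul {A : Type} (f g : A -> Cx) (l : list A) :
  Cprod (map (fun a => f a * g a)%cx l) = (Cprod (map f l) * Cprod (map g l))%cx.
Proof.
  induction l as [|a l IH]; [change (Cprod (map _ [])) with C1; change (Cprod (map _ [])) with C1; ring|].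
  cbn [map]. rewrite !Cprod_cons, IH. ring.
Qed.

Lemma RtoC_add (u v : R) : RtoC (u + v) = (RtoC u + RtoC v)%cx.
Proof. apply Cx_ext; simpl; ring. Qed.
Lemma RtoC_mul (u v : R) : RtoC (u * v) = (RtoC u * RtoC v)%cx.
Proof. apply Cx_ext; simpl; ring. Qed.

Lemma RtoC_sum {A : Type} (f : A -> R) (l : list A) :
  RtoC (fold_right Rplus 0 (map f l)) = Csum (map (fun a => RtoC (f a)) l).
Proof.
  induction l as [|a l IH]; [reflexivity|]. cbn [map fold_right].
  now rewrite RtoC_add, Csum_cons, IH.
Qed.

Section Backward.
Variables q r : R.
Hypothesis Hq : Rabs q < 1.
Hypothesis Hr0 : 0 < r.
Hypothesis Hr1 : Rabs q + Rabs (1 - q) * r < 1.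
Variables (n : nat) (X : conf).

(** [X] stays fixed while [Y] moves, as in a backward equation. The weight [h] stands for a
    symmetric function: a power of [esum], a partial sum or the exponential. *)
Definition weighted (h : list Cx -> Cx) (Y : conf) (zs : list Cx) : Cx :=
  (psi q n X zs * mono (expY Y) zs * h zs)%cx.

Lemma Laurent_weighted h Y : Laurent r n h -> Laurent r n (weighted h Y).
Proof.
  intros Hh. apply (Laurent_mul r Hr0 n (fun zs => psi q n X zs * mono (expY Y) zs)%cx h); [|assumption].
  apply Laurent_mul; [assumption| |].
  - now apply Laurent_psi.
  - now apply LaurentP_mono.
Qed.

Lemma Laurent_eps j : (j < n)%nat -> Laurent r n (fun zs => eps (zn zs j)).
Proof.
  intros Hj. apply LaurentP_ext with (fun zs => Czpow (zn zs j) (-1) + (- C1))%cx.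
  - intros zs _. rewrite Czpow_m1. unfold eps. ring.
  - apply (LaurentP_add r _ n (fun zs => Czpow (zn zs j) (-1)) (fun _ => - C1)%cx).
    + now apply LaurentP_var.
    + now apply Laurent_const.
Qed.

Lemma Laurent_esum : Laurent r n esum.
Proof.
  apply LaurentP_ext with (fun zs => Csum (map (fun j => eps (zn zs j)) (seq 0 n))).
  - intros zs [Hl _]. symmetry. now apply esum_zn.
  - apply (tavg_sum r Hr0 n (fun j zs => eps (zn zs j))). intros j Hj. apply Laurent_eps.
    apply in_seq in Hj. lia.
Qed.

Lemma Laurent_esum_pow m : Laurent r n (fun zs => Cpow (esum zs) m).
Proof.
  induction m as [|m IH].
  - exact (Laurent_const r n C1).
  - apply (Laurent_mul r Hr0 n esum (fun zs => Cpow (esum zs) m)); [apply Laurent_esum | exact IH].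
Qed.

(* The factor [eps z_(k+1) - q eps z_k] cancels the only asymmetric factor of
   the integrand, whose average is then its own opposite. *)
Lemma tavg_boundary h Y k : Laurent r n h -> (S k < n)%nat -> length Y = n ->
  (forall zs, h (swap k zs) = h zs) -> nth k Y 0%Z = nth (S k) Y 0%Z ->
  tavg r n (fun zs => weighted h Y zs * eps (zn zs (S k)))%cx =
  (RtoC q * tavg r n (fun zs => weighted h Y zs * eps (zn zs k)))%cx.
Proof.
  intros Hh Hk HY Hsym HYk.
  set (G := fun zs => (weighted h Y zs * eps (zn zs (S k)) + (- RtoC q) * (weighted h Y zs * eps (zn zs k)))%cx).
  assert (H1 : Laurent r n (fun zs => weighted h Y zs * eps (zn zs (S k)))%cx).
  { apply Laurent_mul; [assumption | now apply Laurent_weighted | now apply Laurent_eps]. }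
  assert (H2 : Laurent r n (fun zs => weighted h Y zs * eps (zn zs k))%cx).
  { apply Laurent_mul; [assumption | now apply Laurent_weighted | apply Laurent_eps; lia]. }
  assert (HG : Laurent r n G).
  { apply (LaurentP_add r _ n (fun zs => weighted h Y zs * eps (zn zs (S k)))%cx); [exact H1|].
    now apply LaurentP_scal. }
  assert (E : tavg r n G = (- C1 * tavg r n G)%cx).
  { rewrite <- tavg_scal, <- (tavg_swap r Hr0 n k G) by assumption.
    apply tavg_ext; [assumption|]. intros zs Hz.
    assert (Hlen : length zs = n) by apply Hz.
    unfold G, weighted. rewrite (psi_swap q r Hr0 Hr1 n k X zs Hz Hk), Hsym, !zn_swap, sw_k, sw_Sk by lia.
    rewrite mono_swap by lia.
    (* The equality [y_k = y_(k+1)] makes this monomial symmetric. *)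
    rewrite (mono_ext _ (expY Y)).
    - pose proof (Sba_eps q r Hr0 Hr1 (zn zs (S k)) (zn zs k)
        (torus_nth r n zs k Hz ltac:(lia)) (torus_nth r n zs (S k) Hz Hk)) as HS.
      transitivity (psi q n X zs * mono (expY Y) zs * h zs *
        (Sba q (zn zs k) (zn zs (S k)) * (eps (zn zs k) - RtoC q * eps (zn zs (S k)))))%cx; [ring|].
      rewrite HS. ring.
    - intros i _. unfold expY. rewrite sw_cases.
      destruct (Nat.eqb_spec i k) as [->|]; [congruence|].
      destruct (Nat.eqb_spec i (S k)) as [->|]; [congruence|reflexivity]. }
  assert (E0 : tavg r n G = C0).
  { assert (E2 : (RtoC 2 * tavg r n G)%cx = C0).
    { transitivity (tavg r n G + tavg r n G)%cx; [apply Cx_ext; simpl; ring|].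
      rewrite E at 2. ring. }
    transitivity (RtoC (/ 2) * (RtoC 2 * tavg r n G))%cx; [apply Cx_ext; simpl; field|].
    rewrite E2. ring. }
  assert (E1 : tavg r n G = (tavg r n (fun zs => weighted h Y zs * eps (zn zs (S k)))
    + (- RtoC q) * tavg r n (fun zs => weighted h Y zs * eps (zn zs k)))%cx).
  { rewrite <- tavg_scal by assumption. apply tavg_add; [assumption|assumption|now apply LaurentP_scal]. }
  rewrite E0 in E1.
  match goal with |- ?a = (RtoC q * ?b)%cx => transitivity ((a + - RtoC q * b) + RtoC q * b)%cx; [ring|] end.
  rewrite <- E1. ring.
Qed.

(** In [eps z_j = 1 / z_j - 1] the first term raises [y_j] by one. This is an identity of exponents,
    also for those [j] whose jump leaves the ordered configurations. *)
Lemma tavg_jump h Y j : Laurent r n h -> (j < n)%nat -> length Y = n ->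
  tavg r n (fun zs => weighted h Y zs * eps (zn zs j))%cx = (tavg r n (weighted h (jump Y j)) - tavg r n (weighted h Y))%cx.
Proof.
  intros Hh Hj HY.
  transitivity (tavg r n (fun zs => weighted h (jump Y j) zs + (- C1) * weighted h Y zs)%cx).
  - apply tavg_ext; [assumption|]. intros zs Hz. unfold weighted.
    replace (mono (expY (jump Y j)) zs) with (mono (expY Y) zs * Czpow (zn zs j) (-1))%cx.
    + rewrite Czpow_m1. unfold eps. ring.
    + assert (Hl : length zs = n) by apply Hz. unfold zn. rewrite <- mono_unit_expo by lia.
      rewrite <- mono_add by now apply (torus_neq0 r n).
      apply mono_ext. intros i _. unfold expY, unit_expo. rewrite nth_jump by lia.
      destruct (Nat.eqb_spec i j) as [->|]; lia.
  - assert (H1 : Laurent r n (weighted h Y)) by now apply Laurent_weighted.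
    assert (H2 : Laurent r n (weighted h (jump Y j))) by now apply Laurent_weighted.
    rewrite tavg_add, tavg_scal; try assumption; [ring | now apply LaurentP_scal].
Qed.

Lemma Qpow_tavg m Y : length X = n -> desc X -> length Y = n -> desc Y ->
  RtoC (site_qfact q X * Qpow q m Y X) = tavg r n (weighted (fun zs => Cpow (esum zs) m) Y).
Proof.
  intros HX HdX. revert Y. induction m as [|m IH]; intros Y HY HdY.
  - transitivity (init_avg q r n X Y).
    + rewrite init_avg_eq by assumption. simpl. destruct (list_eq_dec _ _ _).
      * now rewrite Rmult_1_r.
      * now rewrite Rmult_0_r.
    + apply tavg_ext; [assumption|]. intros zs _. unfold weighted. simpl. ring.
  - set (h := fun zs => Cpow (esum zs) m).
    assert (Hh : Laurent r n h) by apply Laurent_esum_pow.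
    (* One factor [esum] is split into its summands. The boundary condition collapses the sum onto
       the tops before the induction hypothesis is applied, since that requires [jump Y j] to be
       ordered. *)
    transitivity (Csum (map (fun j => tavg r n (fun zs => weighted h Y zs * eps (zn zs j))%cx) (seq 0 n))).
    + replace (seq 0 n) with (seq 0 (length Y)) by now rewrite HY.
      rewrite <- (tops_rate_sum q Y _ HdY).
      2:{ intros k Hk E. apply tavg_boundary; try assumption; [lia|].
          intros zs. unfold h. now rewrite esum_swap. }
      cbn [Qpow]. unfold total_rate.
      rewrite Rmult_plus_distr_l, RtoC_add.
      rewrite (map_ext_in (fun j => RtoC (rate q Y j) * _)%cx (fun j =>
        (RtoC (site_qfact q X * (- Qpow q m Y X * rate q Y j))
         + RtoC (site_qfact q X * (rate q Y j * Qpow q m (jump Y j) X)))%cx)).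
      * rewrite !RtoC_mul, RtoC_sum.
        assert (Esum : forall (f g : nat -> Cx) l, Csum (map (fun a => f a + g a)%cx l) =
          (Csum (map f l) + Csum (map g l))%cx).
        { intros f g l. induction l as [|a l IHl]; [change (Csum (map _ [])) with C0;
            change (Csum (map _ [])) with C0; ring|].
          cbn [map]. rewrite !Csum_cons, IHl. ring. }
        rewrite Esum. f_equal.
        -- rewrite (map_ext _ (fun j => (RtoC (site_qfact q X) * RtoC (- Qpow q m Y X)) * RtoC (rate q Y j))%cx)
             by (intros; rewrite !RtoC_mul; ring).
           rewrite Csum_map_mul, <- RtoC_sum.
           apply Cx_ext; simpl; ring.
        -- rewrite <- Csum_map_mul. f_equal. apply map_ext. intros j.
           rewrite !RtoC_mul. reflexivity.
      * intros j Hj. pose proof (tops_in Y j Hj) as Hjl.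
        rewrite tavg_jump by (assumption || lia).
        unfold h. rewrite <- !IH; [|assumption|assumption| |].
        -- apply Cx_ext; simpl; ring.
        -- rewrite length_jump; assumption.
        -- now apply desc_jump.
    + rewrite <- (proj2 (tavg_sum r Hr0 n (fun j zs => weighted h Y zs * eps (zn zs j))%cx (seq 0 n)
        (fun j Hj => Laurent_mul r Hr0 n (weighted h Y) (fun zs => eps (zn zs j)) (Laurent_weighted h Y Hh)
          (Laurent_eps j (proj2 (proj1 (in_seq n 0 j) Hj)))))).
      apply tavg_ext; [assumption|]. intros zs [Hl _].
      rewrite Csum_map_mul, <- (esum_zn n) by assumption. unfold weighted, h. cbn [Cpow]. ring.
Qed.

Definition evolved (t : R) (Y : conf) : list Cx -> Cx := weighted (fun zs => Cexp (esum zs * RtoC t)%cx) Y.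

Lemma cexp_part_esum t m zs : cexp_part m (esum zs * RtoC t)%cx =
  Csum (map (fun i => RtoC (t ^ i / INR (fact i)) * Cpow (esum zs) i)%cx (seq 0 m)).
Proof.
  unfold cexp_part. f_equal. apply map_ext. intros i.
  replace (esum zs * RtoC t)%cx with (RtoC t * esum zs)%cx by ring.
  rewrite Cpow_scale. unfold Rdiv. rewrite RtoC_mul. ring.
Qed.

Lemma Laurent_cexp_part t m : Laurent r n (fun zs => cexp_part m (esum zs * RtoC t)%cx).
Proof.
  apply LaurentP_ext with (fun zs =>
    Csum (map (fun i => RtoC (t ^ i / INR (fact i)) * Cpow (esum zs) i)%cx (seq 0 m))).
  - intros zs _. symmetry. apply cexp_part_esum.
  - apply (tavg_sum r Hr0 n (fun i zs => RtoC (t ^ i / INR (fact i)) * Cpow (esum zs) i)%cx).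
    intros i _. apply LaurentP_scal, Laurent_esum_pow.
Qed.

Lemma esum_bounded t : exists B, 0 <= B /\
  forall zs, torus r n zs -> Cmod (esum zs * RtoC t)%cx <= B.
Proof.
  apply (LaurentP_bounded r Hr0 (fun _ => True) n (fun zs => esum zs * RtoC t)%cx).
  apply Laurent_mul; [assumption | apply Laurent_esum | now apply Laurent_const].
Qed.

Lemma Laurent_Cexp t : Laurent r n (fun zs => Cexp (esum zs * RtoC t)%cx).
Proof.
  destruct (esum_bounded t) as (B & HB & Hb). apply LaurentP_lim. intros e He.
  destruct (Cexp_part_unif B e HB He) as (M & HM).
  exists (fun zs => cexp_part M (esum zs * RtoC t)%cx). split; [apply Laurent_cexp_part|].
  intros zs Hz. apply HM; [lia | auto].
Qed.

Lemma tavg_partial t m Y : length X = n -> desc X -> length Y = n -> desc Y ->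
  tavg r n (weighted (fun zs => cexp_part (S m) (esum zs * RtoC t)%cx) Y) =
  RtoC (site_qfact q X * sum_f_R0 (fun k => t ^ k / INR (fact k) * Qpow q k Y X) m).
Proof.
  intros HX HdX HY HdY.
  transitivity (Csum (map (fun i => tavg r n (fun zs =>
    RtoC (t ^ i / INR (fact i)) * weighted (fun zs => Cpow (esum zs) i) Y zs)%cx) (seq 0 (S m)))).
  - rewrite <- (proj2 (tavg_sum r Hr0 n (fun i zs =>
      RtoC (t ^ i / INR (fact i)) * weighted (fun zs => Cpow (esum zs) i) Y zs)%cx (seq 0 (S m))
      (fun i _ => LaurentP_scal r _ n _ _ (Laurent_weighted _ Y (Laurent_esum_pow i))))).
    apply tavg_ext; [assumption|]. intros zs _. unfold weighted at 1.
    rewrite cexp_part_esum, <- Csum_map_mul. f_equal. apply map_ext. intros i. unfold weighted. ring.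
  - rewrite (map_ext _ (fun i => (RtoC (site_qfact q X) * RtoC (t ^ i / INR (fact i) * Qpow q i Y X))%cx)).
    + rewrite Csum_map_mul, RtoC_mul. f_equal.
      induction m as [|m IH].
      * simpl. rewrite Csum_cons. change (Csum []) with C0. ring.
      * rewrite seq_S, map_app, Csum_app, IH. cbn [map sum_f_R0]. rewrite Csum_cons, RtoC_add.
        change (Csum []) with C0. simpl (0 + S m)%nat. ring.
    + intros i. rewrite tavg_scal by (assumption || apply Laurent_weighted, Laurent_esum_pow).
      rewrite <- Qpow_tavg by assumption. rewrite !RtoC_mul. ring.
Qed.

(** The scaled partial sums of the generator's series are averages with truncated exponentials.
    These converge uniformly on the torus because [esum] is bounded there, which yields both the
    limit and its value. *)
Lemma trans_prob_tavg t Y : length X = n -> desc X -> length Y = n -> desc Y ->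
  exists P, trans_prob q Y X t P /\ RtoC (site_qfact q X * P) = tavg r n (evolved t Y).
Proof.
  intros HX HdX HY HdY. set (v := site_qfact q X). assert (Hv : 0 < v) by now apply site_qfact_pos.
  destruct (LaurentP_bounded r Hr0 (fun _ => True) n (fun zs => psi q n X zs * mono (expY Y) zs)%cx)
    as (B & HB & HBb).
  { apply Laurent_mul; [assumption | now apply Laurent_psi | now apply LaurentP_mono]. }
  destruct (esum_bounded t) as (B' & HB' & HBb').
  set (S_ := sum_f_R0 (fun k => t ^ k / INR (fact k) * Qpow q k Y X)).
  assert (Hlim : forall e, 0 < e -> exists M, forall m, (M <= m)%nat ->
    Cmod (tavg r n (evolved t Y) - RtoC (v * S_ m))%cx <= e).
  { intros e He.
    assert (H2 : 0 < 2 ^ n) by (apply pow_lt; lra).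
    destruct (Cexp_part_unif B' (e / (2 ^ n * (B + 1))) HB') as (M & HM).
    { apply Rdiv_lt_0_compat; [lra|]. apply Rmult_lt_0_compat; lra. }
    exists M. intros m Hm. unfold v, S_. rewrite <- tavg_partial by assumption.
    assert (N1 : Laurent r n (evolved t Y)) by apply Laurent_weighted, Laurent_Cexp.
    assert (N2 : Laurent r n (weighted (fun zs => cexp_part (S m) (esum zs * RtoC t)%cx) Y))
      by apply Laurent_weighted, Laurent_cexp_part.
    replace (tavg r n (evolved t Y) - tavg r n (weighted (fun zs => cexp_part (S m) (esum zs * RtoC t)) Y))%cx
      with (tavg r n (fun zs => evolved t Y zs +
        (- C1) * weighted (fun zs => cexp_part (S m) (esum zs * RtoC t)%cx) Y zs)%cx).
    2:{ rewrite tavg_add, tavg_scal; try assumption; [ring | now apply LaurentP_scal]. }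
    eapply Rle_trans; [apply tavg_bound with (B := B * (e / (2 ^ n * (B + 1))))|].
    - assumption.
    - apply (LaurentP_add r _ n (evolved t Y)); [assumption | now apply LaurentP_scal].
    - intros zs Hz. unfold evolved, weighted.
      replace (_ + _)%cx with ((psi q n X zs * mono (expY Y) zs) *
        (Cexp (esum zs * RtoC t) - cexp_part (S m) (esum zs * RtoC t)))%cx by ring.
      rewrite Cmod_mul. apply Rmult_le_compat; try apply Cmod_ge_0; auto.
    - apply Rle_trans with (2 ^ n * ((B + 1) * (e / (2 ^ n * (B + 1))))).
      + apply Rmult_le_compat_l; [lra|]. apply Rmult_le_compat_r; [|lra].
        left. apply Rdiv_lt_0_compat; [lra|]. apply Rmult_lt_0_compat; lra.
      + right. field. split; lra. }
  set (L := tavg r n (evolved t Y)) in *.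
  exists (fst L / v). split.
  - intros e He. destruct (Hlim (e * v / 2)) as (M & HM).
    { apply Rdiv_lt_0_compat; [nra | lra]. }
    exists M. intros m Hm. specialize (HM m Hm).
    fold S_. unfold Rdist.
    pose proof (fst_le_Cmod (L - RtoC (v * S_ m))%cx) as H. simpl in H.
    rewrite Rabs_minus_sym.
    replace (fst L / v - S_ m) with ((fst L + - (v * S_ m)) * / v) by (field; lra).
    rewrite Rabs_mult, (Rabs_pos_eq (/ v)) by (left; now apply Rinv_0_lt_compat).
    apply Rmult_lt_reg_r with v; [assumption|]. rewrite Rmult_assoc, Rinv_l by lra. nra.
  - apply Cx_ext; simpl; [field; lra|].
    (* The average is a limit of real partial sums, so its imaginary part vanishes. *)
    assert (H : Rabs (snd L) <= 0).
    { apply Rle_all_eps with 1. intros e He. destruct (Hlim e He) as (M & HM).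
      specialize (HM M (le_n M)). pose proof (snd_le_Cmod (L - RtoC (v * S_ M))%cx) as H.
      simpl in H. rewrite Ropp_0, Rplus_0_r in H. lra. }
    pose proof (Rabs_pos (snd L)). destruct (Req_dec (snd L) 0) as [|Hne]; [auto|].
    apply Rabs_no_R0 in Hne. lra.
Qed.

(** The exponent [x_i - y_sigma(i) - 1] is split. The part in [sigma(i)] alone, multiplied over all
    [i], does not depend on the permutation, and neither does the product of exponentials. *)
Lemma integrand_eq t Y zs : length X = n -> torus r n zs ->
  integrand q n X Y t zs =
  (psi q n X zs * mono (fun i => (expY Y i + -1)%Z) zs * Cexp (esum zs * RtoC t))%cx.
Proof.
  intros HX Hz. pose proof Hz as [Hl _]. unfold integrand.
  rewrite (map_ext_in _ (fun s => (mono (fun i => (expY Y i + -1)%Z) zs * Cexp (esum zs * RtoC t)) *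
    (Aprod q s zs * wave s X zs))%cx).
  - rewrite Csum_map_mul. fold (psi q n X zs). ring.
  - intros s Hs. pose proof (perms_length _ _ Hs) as Hls.
    rewrite <- Hls at 1. rewrite A_sigma_Aprod.
    rewrite Cprod_map_mul, (Cexp_sum (fun i => eps (nth i zs C0) * RtoC t)%cx).
    rewrite (map_ext_in _ (fun i => Czpow (zn zs (nth i s O)) (nth i X 0%Z) *
      Czpow (zn zs (nth i s O)) (expY Y (nth i s O) + -1))%cx).
    + rewrite Cprod_map_mul. rewrite <- HX at 1. rewrite wave_Cprod by lia.
      rewrite <- (map_map (fun i => nth i s O) (fun a => Czpow (zn zs a) (expY Y a + -1))).
      rewrite <- Hls at 1. rewrite map_nth_seq.
      rewrite (Cprod_perm _ _ (Permutation_map _ (proj1 (in_perms n s) Hs))).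
      rewrite (mono_Cprod (fun i => (expY Y i + -1)%Z)), Hl.
      replace (Csum (map (fun i => eps (nth i zs C0) * RtoC t)%cx (seq 0 n)))
        with (esum zs * RtoC t)%cx; [ring|].
      rewrite (esum_zn n) by assumption.
      rewrite (map_ext (fun i => eps (nth i zs C0) * RtoC t)%cx
        (fun i => RtoC t * eps (zn zs i))%cx) by (intros; unfold zn; ring).
      rewrite Csum_map_mul. ring.
    + intros i Hi. apply in_seq in Hi. rewrite <- Czpow_add.
      * unfold zn, expY. f_equal. lia.
      * apply (torus_nth_neq0 r n); try assumption. eapply perms_lt; [exact Hs|].
        apply nth_In. lia.
Qed.

Lemma Laurent_integrand t Y : length X = n -> Laurent r n (integrand q n X Y t).
Proof.
  intros HX.
  apply LaurentP_ext with (fun zs =>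
    psi q n X zs * mono (fun i => (expY Y i + -1)%Z) zs * Cexp (esum zs * RtoC t))%cx.
  - intros zs Hz. symmetry. now apply integrand_eq.
  - apply Laurent_mul; [assumption| |apply Laurent_Cexp].
    apply Laurent_mul; [assumption | now apply Laurent_psi | now apply LaurentP_mono].
Qed.

Lemma integrand_evolved t Y zs : length X = n -> torus r n zs ->
  (integrand q n X Y t zs * Cprod zs)%cx = evolved t Y zs.
Proof.
  intros HX Hz. rewrite integrand_eq by assumption. unfold evolved, weighted.
  pose proof (torus_neq0 r n zs Hr0 Hz) as Hne.
  rewrite (mono_add (expY Y) (fun _ => (-1)%Z)) by assumption.
  assert (E : (mono (fun _ => (-1)%Z) zs * Cprod zs)%cx = C1).
  { clear Hz. induction Hne as [|z zs Hz0 Hne IH].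
    - change (Cprod []) with C1. simpl. ring.
    - cbn [mono]. rewrite Cprod_cons, Czpow_m1.
      transitivity (Cinv z * z * (mono (fun _ => (-1)%Z) zs * Cprod zs))%cx; [ring|].
      rewrite IH. field. assumption. }
  transitivity (psi q n X zs * mono (expY Y) zs * Cexp (esum zs * RtoC t) *
    (mono (fun _ => (-1)%Z) zs * Cprod zs))%cx; [ring|]. rewrite E. ring.
Qed.

End Backward.

(** * The integral formula *)

Lemma Cpow_Cinv_l (c : Cx) (n : nat) : c <> C0 -> (Cpow (Cinv c) n * Cpow c n)%cx = C1.
Proof.
  intros Hc. induction n as [|n IH]; simpl; [ring|].
  transitivity (Cinv c * c * (Cpow (Cinv c) n * Cpow c n))%cx; [ring|].
  rewrite IH. field. assumption.
Qed.

Theorem theorem1 (N : nat) (q r t : R) (X Y : conf) :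
  (1 <= N)%nat ->
  0 < Rabs q < 1 ->
  0 < r < (1 - Rabs q) / Rabs (1 - q) ->
  in_S N X -> in_S N Y ->
  0 <= t ->
  exists (L : Cx) (P : R),
    iter_contour r N (integrand q N X Y t) L /\
    trans_prob q Y X t P /\
    RtoC P = Cmul (RtoC (W q X)) (Cmul (Cpow (Cinv (Cmul (RtoC (2 * PI)) Ci)) N) L).
Proof.
  intros _ [_ Hq] [Hr0 Hr] HX HY _.
  apply in_S_desc in HX, HY. destruct HX as [HX HdX], HY as [HY HdY].
  assert (Hq1 : 0 < Rabs (1 - q)).
  { apply Rabs_pos_lt. apply Rabs_def2 in Hq. lra. }
  assert (Hr1 : Rabs q + Rabs (1 - q) * r < 1).
  (* The hypothesis on the radius with its denominator cleared. *)
  { apply (Rmult_lt_compat_l (Rabs (1 - q))) in Hr; [|assumption].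
    replace (Rabs (1 - q) * ((1 - Rabs q) / Rabs (1 - q))) with (1 - Rabs q) in Hr by (field; lra).
    lra. }
  destruct (trans_prob_tavg q r Hq Hr0 Hr1 N X t Y HX HdX HY HdY) as (P & HP & E).
  (* The power of [2 pi i] collected from the integrations; the prefactor of the formula cancels
     it. *)
  exists (Cpow (RtoC (2 * PI) * Ci)%cx N * tavg r N (fun zs => integrand q N X Y t zs * Cprod zs))%cx, P.
  split; [|split; [exact HP|]].
  - apply iter_contour_tavg; [assumption|]. now apply Laurent_integrand.
  - rewrite (tavg_ext r Hr0 N _ (evolved q N X t Y)) by (intros; now apply (integrand_evolved q r Hr0)).
    rewrite <- E.
    assert (Hc : (RtoC (2 * PI) * Ci)%cx <> C0).
    { apply Cmul_neq0; apply Cmod_pos_neq.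
      - rewrite Cmod_RtoC, Rabs_pos_eq; pose proof two_PI_pos; lra.
      - replace (Cmod Ci) with 1 by (symmetry; exact Cmod_Ci). lra. }
    transitivity (RtoC (W q X) * ((Cpow (Cinv (RtoC (2 * PI) * Ci)) N * Cpow (RtoC (2 * PI) * Ci) N)
      * RtoC (site_qfact q X * P)))%cx; [|ring].
    rewrite Cpow_Cinv_l by assumption.
    change (W q X) with (/ site_qfact q X). pose proof (site_qfact_pos q X Hq).
    apply Cx_ext; simpl; field; lra.
Qed.
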